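(* Let $d\in\mathbb{N}$. The function $(\alpha, \beta, \delta) \mapsto (\mathbb{EP}1)(\alpha, \beta\,; d\,; \delta)$ is continuous in the range $\alpha \geq \beta >-1$ and $\delta >0$.
   Context: For $z = (z_1,\ldots,z_d) \in \mathbb{C}^d$ let $\|z\| := \sup \{ |\sum_{n=1}^d z_n t_n| : t \in \mathbb{R}^d, |t|\leq 1\}$, where $|t|$ is the Euclidean norm. An entire function $F: \mathbb{C}^d \to \mathbb{C}$, not identically zero, has exponential type if $\tau(F):= \limsup_{\|z\|\to \infty} \|z\|^{-1}\log|F(z)| < \infty$, and $\tau(F)$ is then called its exponential type. For $\alpha>-1$ and $\delta>0$, $\mathcal{H}_{\alpha}(d; \delta)$ is the Hilbert space of entire functions $F:\mathbb{C}^d\to\mathbb{C}$ of exponential type at most $\delta$ (together with the zero function) such that $\int_{\mathbb{R}^d} |F(x)|^2 |x|^{2\alpha + 2 -d}\,dx <\infty$. For $\alpha \geq \beta > -1$ one has $\mathcal{H}_{\alpha}(d;\delta)\subset \mathcal{H}_{\beta}(d;\delta)$, and one defines $$(\mathbb{EP}1)(\alpha, \beta\,; d\,; \delta):= \inf_{ 0 \neq F \in \mathcal{H}_{\alpha}(d; \delta) } \frac{\int_{\mathbb{R}^d} |F(x)|^2 \, |x|^{2\alpha + 2 -d}\,dx}{\int_{\mathbb{R}^d} |F(x)|^2 \, |x|^{2\beta + 2 -d}\,dx}.$$ *)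

(* Defs.v *)
From HB Require Import structures.
From mathcomp Require Import all_boot all_order all_algebra.
From mathcomp Require Import complex.
From mathcomp Require Import all_classical all_reals all_analysis.

Set Implicit Arguments.
Unset Strict Implicit.
Unset Printing Implicit Defensive.

Import Order.TTheory GRing.Theory Num.Theory.
Import numFieldNormedType.Exports.

Local Open Scope classical_set_scope.
Local Open Scope complex_scope.
Local Open Scope ring_scope.

Notation Rn R n := (n.-tuple (measurableTypeR R)).

(* [R[i]^o] rather than [R[i]]: only the former carries the topology, and
   [differentiable] then means complex-linear Frechet differentiability. *)
Notation Cn R n := ('rV[(R[i])^o]_n).

Section lebesgue_measure_Rn.
Context {R : realType}.

Definition tcons n (p : measurableTypeR R * Rn R n) : Rn R n.+1 :=
  [tuple of p.1 :: p.2].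

Let measurable_tcons n : measurable_fun [set: _] (@tcons n).
Proof. exact: measurable_cons. Qed.

HB.instance Definition _ n := isMeasurableFun.Build _ _ _ _ (@tcons n)
  (@measurable_tcons n).

Section step.
Context n (mu : {sigma_finite_measure set (Rn R n) -> \bar R}).

Definition lebesgue_step : set (Rn R n.+1) -> \bar R :=
  pushforward (@lebesgue_measure R \x mu)%E (@tcons n).

Let step0 : lebesgue_step set0 = 0%E.
Proof. exact: measure0. Qed.

Let step_ge0 A : (0 <= lebesgue_step A)%E.
Proof. exact: measure_ge0. Qed.

Let step_sigma_additive : semi_sigma_additive lebesgue_step.
Proof. exact: measure_semi_sigma_additive. Qed.

HB.instance Definition _ := isMeasure.Build _ _ _ lebesgue_step
  step0 step_ge0 step_sigma_additive.

Lemma lebesgue_stepE (A : set (measurableTypeR R)) (B : set (Rn R n)) :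
  measurable A -> measurable B ->
  lebesgue_step [set t | A (thead t) /\ B [tuple of behead t]] =
  (lebesgue_measure A * mu B)%E.
Proof.
move=> mA mB; rewrite -product_measure1E//.
rewrite /lebesgue_step /pushforward; congr product_measure1.
apply/funext => -[x t]/=.
by rewrite theadE (_ : [tuple of _] = t)//; exact/val_inj.
Qed.

Lemma measurable_cylinder (A : set (measurableTypeR R)) (B : set (Rn R n)) :
  measurable A -> measurable B ->
  measurable [set t : Rn R n.+1 | A (thead t) /\ B [tuple of behead t]].
Proof.
move=> mA mB; apply: measurableI.
  by rewrite -[X in measurable X]setTI; exact: measurable_tnth.
by rewrite -[X in measurable X]setTI; exact: measurable_behead.
Qed.

Let step_sigma_finite : sigma_finite setT lebesgue_step.
Proof.
have /sigma_finiteP[F [TF ndF Foo]] := sigma_finiteT (@lebesgue_measure R).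
have /sigma_finiteP[G [TG ndG Goo]] := sigma_finiteT mu.
exists (fun k => [set t | F k (thead t) /\ G k [tuple of behead t]]).
  apply/esym; rewrite -subTset => t _.
  have [i _ Fi] : (\bigcup_i F i) (thead t) by rewrite -TF.
  have [j _ Gj] : (\bigcup_i G i) [tuple of behead t] by rewrite -TG.
  exists (maxn i j) => //; split.
    by move: Fi; exact/subsetPset/ndF/leq_maxl.
  by move: Gj; exact/subsetPset/ndG/leq_maxr.
move=> k; have [mF Fk] := Foo k; have [mG Gk] := Goo k.
split; first exact: measurable_cylinder.
by rewrite lebesgue_stepE// lte_mul_pinfty// ge0_fin_numE.
Qed.

HB.instance Definition _ := Measure_isSigmaFinite.Build _ _ _ lebesgue_step
  step_sigma_finite.

End step.

Fixpoint lebesgue_Rn n : {sigma_finite_measure set (Rn R n) -> \bar R} :=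
  if n is n'.+1 then lebesgue_step (lebesgue_Rn n') else \d_[tuple].

Lemma lebesgue_Rn_box n (A : 'I_n -> set (measurableTypeR R)) :
  (forall i, measurable (A i)) ->
  lebesgue_Rn n [set t | forall i, A i (tnth t i)] =
  (\prod_(i < n) lebesgue_measure (A i))%E.
Proof.
elim: n A => [|n IHn] A mA.
  by rewrite big_ord0 /= diracE mem_set// => -[].
have mbox : measurable
    [set t : Rn R n | forall i, A (lift ord0 i) (tnth t i)].
  rewrite (_ : [set _ | _] =
      \bigcap_(i in [set: 'I_n]) (fun t => tnth t i) @^-1` A (lift ord0 i)).
    apply: fin_bigcap_measurable => // i _.
    by rewrite -[X in measurable X]setTI; exact: measurable_tnth.
  by apply/seteqP; split => t /= At i; [move=> _|]; exact: At.
rewrite big_ord_recl/= -IHn// -lebesgue_stepE//.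
have beheadE (t : Rn R n.+1) i :
    tnth [tuple of behead t] i = tnth t (lift ord0 i).
  by rewrite [in RHS](tuple_eta t) tnthS.
congr lebesgue_step; apply/seteqP; split => t /=.
  by move=> At; split => [|i]; [exact: At|rewrite beheadE; exact: At].
move=> [At0 At] i; have [j ->|->//] := unliftP ord0 i.
by rewrite -beheadE; exact: At.
Qed.

End lebesgue_measure_Rn.

Section extremal_problem.
Context {R : realType}.

Definition enorm n (x : Rn R n) : R := Num.sqrt (\sum_(i < n) tnth x i ^+ 2).

Definition Rn_to_Cn n (x : Rn R n) : Cn R n := \row_i (tnth x i)%:C.

Definition cnorm n (z : Cn R n) : R :=
  sup [set Normc.normc (\sum_(i < n) z ord0 i * (tnth t i)%:C)
      | t in [set t : Rn R n | enorm t <= 1]].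

Definition entire n (F : Cn R n -> R[i]^o) : Prop :=
  forall z, differentiable F z.

Definition cnorm_infty n : set_system (Cn R n) :=
  filter_from [set: R] (fun M => [set z | M < cnorm z]).

(* The logarithm is [lne], with value -oo at 0, and not [ln], for which
   [ln 0 = 0]. *)
Definition exp_type n (F : Cn R n -> R[i]^o) : \bar R :=
  limf_esup
    (fun z => ((cnorm z)^-1%:E * lne (Normc.normc (F z))%:E)%E)
    (@cnorm_infty n).

(* [powR] takes the value 0 (instead of an infinite one) at the single point
   x = 0 when the exponent is negative, which does not affect the integral. *)
Definition weighted_sqnorm n (a : R) (F : Cn R n -> R[i]^o) : \bar R :=
  (\int[@lebesgue_Rn R n]_x
    (Normc.normc (F (Rn_to_Cn x)) ^+ 2
     * enorm x `^ (2 * a + 2 - n%:R))%:E)%E.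

Definition Hspace (a : R) n (delta : R) : set (Cn R n -> R[i]^o) :=
  [set F | [/\ entire F,
               F = cst 0 \/ (exp_type F <= delta%:E)%E &
               (weighted_sqnorm a F < +oo)%E]].

(* For -1 < b <= a both integrals are finite and nonzero, so that [fine] only
   reads off their values; [inf] is the infimum in R. *)
Definition EP1 (a b : R) n (delta : R) : R :=
  inf [set fine (weighted_sqnorm a F) / fine (weighted_sqnorm b F)
      | F in Hspace a delta `\ (cst 0 : Cn R n -> R[i]^o)].

End extremal_problem.

(* Main.v *)
From HB Require Import structures.
Require Import Defs.
From mathcomp Require Import all_boot all_order all_algebra.
From mathcomp Require Import complex ring lra.
From mathcomp Require Import all_classical all_reals all_analysis measurable_realfun.

(** By homogeneity EP1(a, b; d; delta) = delta^(-2(a-b)) EP1(a, b; d; 1), so only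
    continuity in (a, b) at type 1 is at stake. It is proved without any compactness
    of the spaces H_a, from one a priori bound: for -1 < g <= b <= b1 the norm of
    weight g is at most a constant (depending on g, b1 and the type only) times that
    of weight b. On a line this follows from the Poisson majorization
    |f(i)| <= C int |f(t)| dt / (1 + t^2) for f holomorphic of exponential type in the
    closed upper half plane; averaging over the lines through 0 gives it in R^d.
    Hence the part of int |F|^2 |x|^(2a+2-d) over |x| <= rho is
    O(rho^(2(a-g))) int |F|^2 |x|^(2b+2-d), uniformly in F.

    If a > b, the ratio bound also controls the part over |x| >= R in the norm of
    weight b. A nearly extremal F for (a, b) is turned into a competitor for nearby
    (a', b') by multiplying it by m(x) = prod_i sinc(eps x_i): m is close to 1 on
    |x| <= R, its decay compensates a' > a at infinity, and the excess of type eps d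
    is removed by a dilation. If a = b, the same bound near 0 and a fixed test function show
    that EP1 tends to 1. *)

Set Implicit Arguments.
Unset Strict Implicit.
Unset Printing Implicit Defensive.

Import Order.TTheory GRing.Theory Num.Theory.
Import numFieldNormedType.Exports.
Import Normc.

Local Open Scope classical_set_scope.
Local Open Scope complex_scope.
Local Open Scope ring_scope.

(** * Contour integrals and the Poisson majorization *)

(** The obstacle is that the spaces move with (a, b): an F in H_a need not lie in H_a' for a' > a,
    and a minimizing sequence may lose mass at 0 or at infinity. Loss at 0 is excluded by a spare
    exponent g strictly between -1 and b; loss at infinity by the gap a - b, which is why the
    diagonal needs its own argument. Off the diagonal the inequality EP1(a', b') <= EP1(a, b) + eps
    is proved for any two pairs near (a0, b0), so exchanging their roles gives both
    semicontinuities.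

    On a line the weighted integral does not control f near 0 directly when |s|^(2b+1) vanishes
    there. Hence the Poisson majorization is used twice: from the real axis to the line Im z = -1,
    with a rational factor vanishing at 0, and from that line back to [-1, 1]. No constant has to be
    sharp, so a lower bound for a contour integral replaces the residue at i. What matters is that
    the constants depend on F through its type only: the radius from which the growth bound holds
    must not enter. *)

Section complex_norm.
Context {R : realType}.
Notation C := (R[i]^o).
Lemma normCE (z : C) : `|z| = (normc z)%:C. Proof. by []. Qed.

Lemma nbhsCP (z : C) (P : set C) :
  nbhs z P <-> exists2 d : R, 0 < d & forall h : C, normc h < d -> P (z + h).
Proof.
split=> [/nbhs_ballP[[a b]/=]|[d d0 dP]].
  rewrite ltcE /= => /andP[/eqP -> a0] aP; exists a => // h ha.
  apply: aP; rewrite /ball/= opprD addNKr normrN normCE.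
  by rewrite ltcR.
apply/nbhs_ballP; exists d%:C => /=; first by rewrite ltcR.
move=> w; rewrite /ball/= normCE ltcR => wd.
rewrite -(subrKC z w); apply: dP.
by rewrite -normcN opprB.
Qed.

Lemma differentiable_eps (f : C -> C) (z : C) : differentiable f z ->
  exists c : C, forall e : R, 0 < e -> exists2 d : R, 0 < d &
    forall h : C, normc h < d ->
      normc (f (z + h) - f z - c * h) <= e * normc h.
Proof.
move=> /derivable1_diffP/derivable_nbhsP df; exists ('D_1 f z) => e e0.
have /eqaddoP /(_ e%:C) := df; rewrite ltcR => /(_ e0) /nbhsCP[d d0 dP].
exists d => // h hd; have := dP h hd.
rewrite add0r /= -![(_ + _ : _ -> _) _]/(_ + _) -![(- _ : _ -> _) _]/(- _).
rewrite !normCE -(rmorphM (real_complex R)) lecR [_%:A]mulr1 opprD /cst addrA.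
by rewrite [h + z]addrC /GRing.scale/= [h * _]mulrC.
Qed.

Lemma continuousCP (f : C -> C) (z : C) : {for z, continuous f} ->
  forall e : R, 0 < e -> exists2 d : R, 0 < d &
    forall h : C, normc h < d -> normc (f (z + h) - f z) < e.
Proof.
move=> cf e e0.
have : nbhs (f z) [set w | normc (w - f z) < e].
  apply/nbhsCP; exists e => // h; rewrite /= addrAC subrr add0r//.
move/cf => /nbhsCP[d d0 dP]; exists d => // h /dP //.
Qed.

Lemma continuousR_eps (f : R -> R) (x : R) :
  (forall e : R, 0 < e -> exists2 d : R, 0 < d &
    forall h : R, `|h| < d -> `|f (x + h) - f x| < e) -> {for x, continuous f}.
Proof.
move=> H; apply/cvgrPdist_lt => e e0; have [d d0 dP] := H e e0.
apply/nbhs_ballP; exists d => // y; rewrite /ball/= => yd.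
by have := dP (y - x); rewrite subrKC distrC => /(_ yd); rewrite distrC.
Qed.

Lemma normRe (z : C) : `|complex.Re z| <= normc z.
Proof. by have := normc_ge_Re z; rewrite normCE lecR. Qed.

Lemma normc_ge0 (z : R[i]) : 0 <= normc z.
Proof. by case: z => a b; exact: sqrtr_ge0. Qed.

Lemma normci : normc ('i : R[i]) = 1.
Proof. by rewrite /normc /= !expr2 mulr0 mulr1 add0r sqrtr1. Qed.

Lemma normcR (x : R) : normc (x%:C) = `|x|.
Proof. by rewrite /normc /= [0 ^+ 2]expr2 mulr0 addr0 sqrtr_sqr. Qed.

Lemma normIm (z : C) : `|complex.Im z| <= normc z.
Proof. by have := normRe (z * 'i); rewrite ReiNIm normrN normcM normci mulr1. Qed.

Lemma le_normcReIm (z : C) : normc z <= `|complex.Re z| + `|complex.Im z|.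
Proof.
case: z => a b; rewrite [X in normc X](_ : _ = a%:C + b%:C * 'i); last by simpc.
by rewrite (le_trans (le_normcD _ _))// normcM !normcR normci mulr1.
Qed.
End complex_norm.

Section cint.
Context {R : realType}.
Notation C := (R[i]^o).
Notation mu := (@lebesgue_measure R).
Notation Re := (@complex.Re R).
Notation Im := (@complex.Im R).

Definition cint (a b : R) (f : R -> R[i]) : R[i] :=
  (\int[mu]_(x in `[a, b]) Re (f x)) +i* (\int[mu]_(x in `[a, b]) Im (f x)).

(** Two-sided at the end points: [x + h] may leave [a, b]. Differentiability at the points of a
    closed contour provides this, so no one-sided case arises. *)
Definition ccont (a b : R) (f : R -> R[i]) := forall x e : R,
  a <= x <= b -> 0 < e -> exists2 d : R, 0 < d &
  forall h, `|h| < d -> normc (f (x + h) - f x) < e.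

Lemma ccont_integrable a b f (g : R[i] -> R) : ccont a b f ->
  (forall z w, `|g z - g w| <= normc (z - w)) ->
  mu.-integrable `[a, b] (EFin \o (g \o f)).
Proof.
move=> cf gl; apply: continuous_compact_integrable; first exact: segment_compact.
apply: continuous_in_subspaceT => x /[!inE]; rewrite /= in_itv/= => xab.
apply: continuousR_eps => e e0; have [d d0 dP] := cf x e xab e0.
by exists d => // h /dP; exact: le_lt_trans (gl _ _).
Qed.

Lemma Re_lip (z w : R[i]) : `|Re z - Re w| <= normc (z - w).
Proof. by rewrite -raddfB; exact: normRe. Qed.

Lemma Im_lip (z w : R[i]) : `|Im z - Im w| <= normc (z - w).
Proof. by rewrite -raddfB; exact: normIm. Qed.

Lemma normc_lip (z w : R[i]) : `|normc z - normc w| <= normc (z - w).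
Proof.
have H (x y : R[i]) : normc x - normc y <= normc (x - y).
  by rewrite lerBlDr (le_trans _ (le_normcD _ _))// subrK.
by rewrite ler_norml H lerNl opprB -(normcN (z - w)) opprB H.
Qed.

Lemma ccontRe a b f : ccont a b f -> mu.-integrable `[a, b] (EFin \o (Re \o f)).
Proof. by move=> cf; exact: ccont_integrable cf Re_lip. Qed.

Lemma ccontIm a b f : ccont a b f -> mu.-integrable `[a, b] (EFin \o (Im \o f)).
Proof. by move=> cf; exact: ccont_integrable cf Im_lip. Qed.

Lemma cintD a b f g : ccont a b f -> ccont a b g ->
  cint a b (fun t => f t + g t) = cint a b f + cint a b g.
Proof.
move=> cf cg; rewrite /cint.
under eq_Rintegral do rewrite raddfD.
under [X in _ +i* X]eq_Rintegral do rewrite raddfD.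
rewrite !RintegralD//; [exact: ccontIm|exact: ccontIm|exact: ccontRe|exact: ccontRe].
Qed.

Lemma cintZ a b c f : ccont a b f -> cint a b (fun t => c * f t) = c * cint a b f.
Proof.
move=> cf; rewrite /cint; case: c => u v.
have E t : (u +i* v) * f t = (u * Re (f t) - v * Im (f t)) +i* (u * Im (f t) + v * Re (f t)).
  by case: (f t) => p q /=; simpc.
under eq_Rintegral do rewrite E/=.
under [X in _ +i* X]eq_Rintegral do rewrite E/=.
have iRe := ccontRe cf; have iIm := ccontIm cf.
have iZ k g : mu.-integrable `[a, b] (EFin \o g) ->
    mu.-integrable `[a, b] (EFin \o (fun x => k * g x)).
  move=> ig; rewrite (_ : EFin \o _ = fun x => (k%:E * (EFin \o g) x)%E)//.
  exact: integrableZl.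
rewrite RintegralB//; [|exact: iZ|exact: iZ].
rewrite RintegralD//; [|exact: iZ|exact: iZ].
by rewrite !RintegralZl//; simpc.
Qed.

Lemma cint_split a m b f : a <= m <= b -> ccont a b f ->
  cint a b f = cint a m f + cint m b f.
Proof.
move=> /andP[am mb] cf.
have H (g : R -> R) : mu.-integrable `[a, b] (EFin \o g) ->
    \int[mu]_(x in `[a, b]) g x = \int[mu]_(x in `[a, m]) g x + \int[mu]_(x in `[m, b]) g x.
  move=> ig; have := @Rintegral_itvB R g (BLeft a) (BRight b) m ig.
  rewrite !bnd_simp => /(_ am mb); rewrite Rintegral_itv_obnd_cbnd; last first.
    apply: integrableS ig => //; apply: subset_itv; rewrite bnd_simp//.
  by move=> <-; rewrite addrC subrK.
rewrite /cint (H _ (ccontRe cf)) (H _ (ccontIm cf)).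
by simpc.
Qed.

Lemma fine_mu_itv a b : a <= b -> fine (mu `[a, b]) = b - a.
Proof.
move=> ab; have -> : mu `[a, b] = (if (a%:E < b%:E)%E then b%:E - a%:E else 0)%E.
  by have := lebesgue_measure_itv `[a, b].
rewrite lte_fin; case: ifPn => //; rewrite -leNgt => ba.
have -> : a = b by apply/eqP; rewrite eq_le ab ba.
by rewrite subrr.
Qed.

Lemma cint_cst a b (c : R[i]) : a <= b -> cint a b (fun=> c) = (b - a)%:C * c.
Proof.
move=> ab; rewrite /cint !Rintegral_cst// fine_mu_itv//.
by case: c => u v /=; simpc; rewrite ![(b - a) * _]mulrC.
Qed.

Lemma cint_id a b : a <= b -> cint a b (fun t => t%:C) = ((b ^+ 2 - a ^+ 2) / 2)%:C.
Proof.
rewrite le_eqVlt => /predU1P[->|ab].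
  by rewrite subrr mul0r /cint set_itv1 !Rintegral_set1.
rewrite /cint/= Rintegral_cst// mul0r; congr (_ +i* _).
rewrite /Rintegral (@continuous_FTC2 _ _ (fun x => x ^+ 2 / 2))//.
- by rewrite /= mulrBl.
- by apply: continuous_subspaceT => x.
- split.
  + by move=> x _; exact: derivableM.
  + by apply: cvg_at_right_filter; apply: cvgM; [exact: exprn_continuous|exact: cvg_cst].
  + by apply: cvg_at_left_filter; apply: cvgM; [exact: exprn_continuous|exact: cvg_cst].
- move=> x _; rewrite derive1E deriveM// derive_cst.
  rewrite scaler0 add0r exp_derive expr1 [_%:A]mulr1.
  by rewrite /GRing.scale/= mulrA mulVf// mul1r.
Qed.

(** The factor 2 comes from estimating real and imaginary parts separately; only the order of
    magnitude is used later. *)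
Lemma normc_cint a b f : ccont a b f ->
  normc (cint a b f) <= 2 * \int[mu]_(x in `[a, b]) normc (f x).
Proof.
move=> cf; rewrite (le_trans (le_normcReIm _))// mulr2n mulrDl mul1r /=.
have iN := ccont_integrable cf normc_lip.
have iR := ccontRe cf; have iI := ccontIm cf.
apply: lerD.
  rewrite (le_trans (le_normr_Rintegral _ _))//.
  apply: le_Rintegral => //; last by move=> x _; exact: normRe.
  exact: (integrable_norm iR).
rewrite (le_trans (le_normr_Rintegral _ _))//.
apply: le_Rintegral => //; last by move=> x _; exact: normIm.
exact: (integrable_norm iI).
Qed.

Lemma normc_cint_le a b f M : a <= b -> ccont a b f ->
  (forall x, a <= x <= b -> normc (f x) <= M) ->
  normc (cint a b f) <= 2 * M * (b - a).
Proof.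
move=> ab cf fM; rewrite (le_trans (normc_cint cf))// -mulrA ler_wpM2l//.
have -> : M * (b - a) = \int[mu]_(x in `[a, b]) M.
  by rewrite Rintegral_cst// fine_mu_itv.
apply: le_Rintegral => //.
- exact: ccont_integrable cf normc_lip.
- apply: continuous_compact_integrable; first exact: segment_compact.
  by apply: continuous_subspaceT => x; exact: cvg_cst.
Qed.
End cint.

(** * Goursat's theorem on rectangles *)

Section goursat.
Context {R : realType}.
Notation C := (R[i]^o).

Definition rect_cont (f : C -> C) (a b c d : R) := forall (z : C) (e : R),
  a <= complex.Re z <= b -> c <= complex.Im z <= d -> 0 < e ->
  exists2 r : R, 0 < r &
  forall h : C, normc h < r -> normc (f (z + h) - f z) < e.

(** The contour integral of [f] along the boundary of [a, b] x [c, d], counterclockwise. *)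
Definition bd (f : C -> C) (a b c d : R) : R[i] :=
  cint a b (fun t => f (t +i* c)) + 'i * cint c d (fun t => f (b +i* t))
  - cint a b (fun t => f (t +i* d)) - 'i * cint c d (fun t => f (a +i* t)).

Lemma normc_hor (x : R) : normc (x +i* 0) = `|x|.
Proof. exact: normcR. Qed.

Lemma normc_ver (x : R) : normc (0 +i* x) = `|x|.
Proof.
rewrite (_ : 0 +i* x = x%:C * 'i); last by simpc.
by rewrite normcM normcR normci mulr1.
Qed.

Lemma rect_cont_hor f a b c d a' b' y : rect_cont f a b c d ->
  a <= a' -> b' <= b -> c <= y <= d -> ccont a' b' (fun t => f (t +i* y)).
Proof.
move=> cf aa bb cyd x e /andP[ax xb] e0.
have [||//|r r0 rP] := cf (x +i* y) e; rewrite /= ?cyd//.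
  by rewrite (le_trans aa)// (le_trans xb).
exists r => // h hr; rewrite (_ : (x + h) +i* y = x +i* y + h +i* 0).
  by apply: rP; rewrite normc_hor.
by simpc.
Qed.

Lemma rect_cont_ver f a b c d c' d' x : rect_cont f a b c d ->
  c <= c' -> d' <= d -> a <= x <= b -> ccont c' d' (fun t => f (x +i* t)).
Proof.
move=> cf aa bb axb y e /andP[ay yb] e0.
have [||//|r r0 rP] := cf (x +i* y) e; rewrite /= ?axb//.
  by rewrite (le_trans aa)// (le_trans yb).
exists r => // h hr; rewrite (_ : x +i* (y + h) = x +i* y + 0 +i* h).
  by apply: rP; rewrite normc_ver.
by simpc.
Qed.

Lemma rect_contS f a b c d a' b' c' d' : rect_cont f a b c d ->
  a <= a' -> b' <= b -> c <= c' -> d' <= d -> rect_cont f a' b' c' d'.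
Proof.
move=> cf aa bb cc dd z e /andP[za zb] /andP[zc zd]; apply: cf.
  by rewrite (le_trans aa)// (le_trans zb).
by rewrite (le_trans cc)// (le_trans zd).
Qed.

(** Only the four edges are involved, so that rectangles around a singular point are allowed. *)
Definition bd_cont (f : C -> C) (a b c d : R) :=
  [/\ ccont a b (fun t => f (t +i* c)), ccont a b (fun t => f (t +i* d)),
      ccont c d (fun t => f (a +i* t)) & ccont c d (fun t => f (b +i* t))].

Lemma rect_cont_bd f a b c d : rect_cont f a b c d -> a <= b -> c <= d ->
  bd_cont f a b c d.
Proof.
move=> cf ab cd; split.
- by apply: (rect_cont_hor cf) => //; rewrite lexx.
- by apply: (rect_cont_hor cf) => //; rewrite lexx andbT.
- by apply: (rect_cont_ver cf) => //; rewrite lexx.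
- by apply: (rect_cont_ver cf) => //; rewrite lexx andbT.
Qed.

Lemma bd_splith f a m b c d : bd_cont f a b c d -> a <= m <= b ->
  bd f a b c d = bd f a m c d + bd f m b c d.
Proof.
move=> [cc cd _ _] amb; rewrite /bd.
by rewrite (cint_split amb cc) (cint_split amb cd); ring.
Qed.

Lemma bd_splitv f a b c m d : bd_cont f a b c d -> c <= m <= d ->
  bd f a b c d = bd f a b c m + bd f a b m d.
Proof.
move=> [_ _ ca cb] cmd; rewrite /bd.
by rewrite (cint_split cmd ca) (cint_split cmd cb); ring.
Qed.

Lemma normc_bd_le f a b c d M : bd_cont f a b c d -> a <= b -> c <= d ->
  (forall x, a <= x <= b -> normc (f (x +i* c)) <= M /\ normc (f (x +i* d)) <= M) ->
  (forall y, c <= y <= d -> normc (f (a +i* y)) <= M /\ normc (f (b +i* y)) <= M) ->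
  normc (bd f a b c d) <= 4 * M * (b - a + (d - c)).
Proof.
move=> [cc cd ca cb] ab lcd fM gM; rewrite /bd.
have h1 : normc (cint a b (fun t => f (t +i* c))) <= 2 * M * (b - a).
  by apply: normc_cint_le => // x /fM[].
have h2 : normc (cint a b (fun t => f (t +i* d))) <= 2 * M * (b - a).
  by apply: normc_cint_le => // x /fM[].
have h3 : normc ('i * cint c d (fun t => f (a +i* t))) <= 2 * M * (d - c).
  by rewrite normcM normci mul1r; apply: normc_cint_le => // x /gM[].
have h4 : normc ('i * cint c d (fun t => f (b +i* t))) <= 2 * M * (d - c).
  by rewrite normcM normci mul1r; apply: normc_cint_le => // x /gM[].
have -> : 4 * M * (b - a + (d - c)) = 2 * M * (b - a) + 2 * M * (d - c) + 2 * M * (b - a) + 2 * M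
  * (d - c) by ring.
rewrite (le_trans (le_normcD _ _))// lerD ?normcN//.
rewrite (le_trans (le_normcD _ _))// lerD ?normcN//.
by rewrite (le_trans (le_normcD _ _))// lerD.
Qed.

Lemma rect_cont_affine (u v : C) a b c d : rect_cont (fun z => u + v * z) a b c d.
Proof.
move=> z e _ _ e0; exists (e / (normc v + 1)).
  by rewrite divr_gt0// ltr_wpDl// normc_ge0.
move=> h hr; rewrite (_ : _ - _ = v * h); last by ring.
rewrite normcM; move: hr; rewrite ltr_pdivlMr ?ltr_wpDl// ?normc_ge0//.
apply: le_lt_trans; rewrite mulrC ler_wpM2l ?normc_ge0//.
by rewrite lerDl.
Qed.

Lemma bdD f g a b c d : bd_cont f a b c d -> bd_cont g a b c d ->
  bd (fun z => f z + g z) a b c d = bd f a b c d + bd g a b c d.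
Proof.
by move=> [? ? ? ?] [? ? ? ?]; rewrite /bd !cintD//; ring.
Qed.

Lemma bdZ (u : C) f a b c d : bd_cont f a b c d ->
  bd (fun z => u * f z) a b c d = u * bd f a b c d.
Proof.
by move=> [? ? ? ?]; rewrite /bd !cintZ//; ring.
Qed.

(** These are the functions subtracted in Goursat's argument; they are integrated explicitly, edge
    by edge. *)
Lemma bd_affine (u v : C) a b c d : a <= b -> c <= d ->
  bd (fun z => u + v * z) a b c d = 0.
Proof.
move=> ab cd.
have cc (w : C) p q : ccont p q (fun=> w).
  by move=> x e _ e0; exists 1 => // h _; rewrite subrr normc0.
have DC (x h : R) : (x + h)%:C = x%:C + h%:C by exact: (rmorphD (real_complex R)).
have ci p q : ccont p q (fun t : R => t%:C).
  move=> x e _ e0; exists e => // h he; rewrite DC addrAC subrr add0r.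
  by rewrite normcR.
have cZ (w : C) p q : ccont p q (fun t : R => w * t%:C).
  move=> x e _ e0; exists (e / (normc w + 1)).
    by rewrite divr_gt0// ltr_wpDl// normc_ge0.
  move=> h hr; rewrite DC mulrDr addrAC subrr add0r normcM normcR.
  move: hr; rewrite ltr_pdivlMr ?ltr_wpDl// ?normc_ge0//.
  by apply: le_lt_trans; rewrite mulrC ler_wpM2l// lerDl.
have Eh y : cint a b (fun t => u + v * (t +i* y)) =
    (b - a)%:C * (u + v * (0 +i* y)) + v * ((b ^+ 2 - a ^+ 2) / 2)%:C.
  rewrite -cint_cst// -cint_id// -cintZ// -cintD//; congr cint.
  by apply/funext => t; rewrite -addrA -mulrDr; congr (_ + _ * _); simpc.
have Ev x : cint c d (fun t => u + v * (x +i* t)) =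
    (d - c)%:C * (u + v * (x +i* 0)) + v * 'i * ((d ^+ 2 - c ^+ 2) / 2)%:C.
  rewrite -cint_cst// -cint_id// -cintZ// -cintD//; congr cint.
  by apply/funext => t; rewrite -addrA -mulrA -mulrDr; congr (_ + _ * _); simpc.
rewrite /bd !Eh !Ev.
by case: u v {Eh Ev} => [u1 u2] [v1 v2]; simpc; congr (_ +i* _); field.
Qed.

Lemma rect_contD f g a b c d : rect_cont f a b c d -> rect_cont g a b c d ->
  rect_cont (fun z => f z + g z) a b c d.
Proof.
move=> cf cg z e zab zcd e0.
have e20 : 0 < e / 2 by rewrite divr_gt0.
have [r r0 rP] := cf z (e / 2) zab zcd e20.
have [s s0 sP] := cg z (e / 2) zab zcd e20.
exists (Num.min r s); first by rewrite lt_min r0.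
move=> h; rewrite lt_min => /andP[/rP h1 /sP h2].
rewrite (_ : _ - _ = (f (z + h) - f z) + (g (z + h) - g z)); last by ring.
rewrite (le_lt_trans (le_normcD _ _))//; lra.
Qed.

Lemma rect_cont_diff (f : C -> C) a b c d :
  (forall z : C, a <= complex.Re z <= b -> c <= complex.Im z <= d -> differentiable f z) ->
  rect_cont f a b c d.
Proof.
move=> df z e zab zcd e0; apply: continuousCP => //.
exact/differentiable_continuous/df.
Qed.

(** Inner edges cancel, so the integral is the sum over the four quarters; if each were smaller than
    a quarter of the total, the triangle inequality would fail. *)
Lemma bd_quarter f a L c H : 0 <= L -> 0 <= H -> rect_cont f a (a + L) c (c + H) ->
  exists2 p : R * R, [/\ a <= p.1, p.1 + L / 2 <= a + L, c <= p.2 & p.2 + H / 2 <= c + H] &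
    normc (bd f a (a + L) c (c + H)) <=
    4 * normc (bd f p.1 (p.1 + L / 2) p.2 (p.2 + H / 2)).
Proof.
move=> L0 H0 cf.
have E : bd f a (a + L) c (c + H) =
   bd f a (a + L / 2) c (c + H / 2) + bd f a (a + L / 2) (c + H / 2) (c + H / 2 + H / 2) +
   (bd f (a + L / 2) (a + L / 2 + L / 2) c (c + H / 2) +
    bd f (a + L / 2) (a + L / 2 + L / 2) (c + H / 2) (c + H / 2 + H / 2)).
  have -> : a + L / 2 + L / 2 = a + L by field.
  have -> : c + H / 2 + H / 2 = c + H by field.
  have cf0 : bd_cont f a (a + L) c (c + H) by apply: rect_cont_bd => //; lra.
  rewrite (bd_splith (m := a + L / 2) cf0); [|lra].
  rewrite (@bd_splitv _ a (a + L / 2) c (c + H / 2)); [| |lra]; last first.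
    by apply: rect_cont_bd; [apply: rect_contS cf _ _ _ _|..]; lra.
  rewrite (@bd_splitv _ (a + L / 2) _ c (c + H / 2)); [| |lra]; last first.
    by apply: rect_cont_bd; [apply: rect_contS cf _ _ _ _|..]; lra.
  by [].
apply: contrapT => nex.
have N x y : [/\ a <= x, x + L / 2 <= a + L, c <= y & y + H / 2 <= c + H] ->
    4 * normc (bd f x (x + L / 2) y (y + H / 2)) <
    normc (bd f a (a + L) c (c + H)).
  by move=> pP; rewrite ltNge; apply/negP => le; apply: nex; exists (x, y).
have := N a c ltac:(split; lra).
have := N a (c + H / 2) ltac:(split; lra).
have := N (a + L / 2) c ltac:(split; lra).
have := N (a + L / 2) (c + H / 2) ltac:(split; lra).
have tri (z1 z2 z3 z4 : R[i]) : normc (z1 + z2 + (z3 + z4)) <=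
    normc z1 + normc z2 + (normc z3 + normc z4).
  by rewrite (le_trans (le_normcD _ _))// lerD// le_normcD.
rewrite {N nex} E => k1 k2 k3 k4.
have := lt_le_trans k1 (tri _ _ _ _); have := lt_le_trans k2 (tri _ _ _ _).
have := lt_le_trans k3 (tri _ _ _ _); have := lt_le_trans k4 (tri _ _ _ _).
move: (normc _) (normc _) (normc _) (normc _) => x1 x2 x3 x4.
by clear; lra.
Qed.

(** Bisection: the n-th nested rectangle carries at least a fraction 4^-n of the integral, while
    near the common point p the function is affine up to e' |z - p|, which leaves only O(e' 4^-n) on
    a rectangle of size O(2^-n). *)
Lemma goursat (f : C -> C) a L c H : 0 <= L -> 0 <= H ->
  (forall z : C, a <= complex.Re z <= a + L -> c <= complex.Im z <= c + H ->
     differentiable f z) ->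
  bd f a (a + L) c (c + H) = 0.
Proof.
move=> L0 H0 df; have cf := rect_cont_diff df.
pose l n := L / 2 ^+ n; pose k n := H / 2 ^+ n.
have l0 n : 0 <= l n by rewrite divr_ge0// exprn_ge0.
have k0 n : 0 <= k n by rewrite divr_ge0// exprn_ge0.
have lS n : l n / 2 = l n.+1 by rewrite /l exprSr invfM mulrA.
have kS n : k n / 2 = k n.+1 by rewrite /k exprSr invfM mulrA.
pose inn n (p : R * R) :=
  [/\ a <= p.1, p.1 + l n <= a + L, c <= p.2 & p.2 + k n <= c + H].
pose nxt n (p q : R * R) :=
  [/\ p.1 <= q.1, q.1 + l n.+1 <= p.1 + l n, p.2 <= q.2 & q.2 + k n.+1 <= p.2 + k n]
  /\ normc (bd f p.1 (p.1 + l n) p.2 (p.2 + k n)) <=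
     4 * normc (bd f q.1 (q.1 + l n.+1) q.2 (q.2 + k n.+1)).
(* [choice] needs a total function: the step is stated for every (n, p) and is vacuous unless the
   rectangle at p lies in the initial one. *)
have step (np : nat * (R * R)) : exists q,
    inn np.1 np.2 -> inn np.1.+1 q /\ nxt np.1 np.2 q.
  case: np => n [x y]; have [[ax xa cy yc]|//] := pselect (inn n (x, y)); last first.
    by move=> N; exists (0, 0).
  have cf' : rect_cont f x (x + l n) y (y + k n) by exact: rect_contS cf _ _ _ _.
  have [[u v] [xu ux yv vy] Q] := bd_quarter (l0 n) (k0 n) cf'.
  rewrite lS kS in ux vy Q.
  exists (u, v) => _; split; split => //.
  - exact: le_trans xu.
  - exact: le_trans xa.
  - exact: le_trans yv.
  - exact: le_trans yc.
have [g gP] := choice step.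
pose fix u n : R * R := if n is m.+1 then g (m, u m) else (a, c).
have uin n : inn n (u n).
  elim: n => [|n IH]; first by rewrite /inn /l /k !expr0 !divr1 /= !lexx.
  by have [] := gP (n, u n) IH.
have unxt n : nxt n (u n) (u n.+1) by have [] := gP (n, u n) (uin n).
have umono m n : (m <= n)%N -> [/\ (u m).1 <= (u n).1, (u n).1 + l n <= (u m).1 + l m,
    (u m).2 <= (u n).2 & (u n).2 + k n <= (u m).2 + k m].
  move=> /subnK <-; elim: (n - m)%N => [|j [h1 h2 h3 h4]]; first by rewrite !lexx.
  have [[g1 g2 g3 g4] _] := unxt (j + m)%N.
  by split; [exact: le_trans g1|exact: le_trans h2|exact: le_trans g3|exact: le_trans h4].
have ule m n : (u m).1 <= (u n).1 + l n /\ (u m).2 <= (u n).2 + k n.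
  have [/umono[h1 h2 h3 h4]|/ltnW/umono[h1 h2 h3 h4]] := leqP m n.
    by split; rewrite ler_wpDr.
  have := l0 m; have := k0 m; split; lra.
(* The common point of the nested rectangles, as the supremum of their lower left corners. *)
pose X := sup (range (fun n => (u n).1)); pose Y := sup (range (fun n => (u n).2)).
have hX : has_sup (range (fun n => (u n).1)).
  split; first by exists (u 0%N).1; exists 0%N.
  by exists ((u 0%N).1 + l 0%N) => _ [m _ <-]; have [] := ule m 0%N.
have hY : has_sup (range (fun n => (u n).2)).
  split; first by exists (u 0%N).2; exists 0%N.
  by exists ((u 0%N).2 + k 0%N) => _ [m _ <-]; have [] := ule m 0%N.
have Xb n : (u n).1 <= X <= (u n).1 + l n.
  rewrite sup_upper_bound//=; last by exists n.
  by apply: sup_le_ub => [|_ [m _ <-]]; [case: hX|have [] := ule m n].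
have Yb n : (u n).2 <= Y <= (u n).2 + k n.
  rewrite sup_upper_bound//=; last by exists n.
  by apply: sup_le_ub => [|_ [m _ <-]]; [case: hY|have [] := ule m n].
have B n : normc (bd f a (a + L) c (c + H)) <=
    4 ^+ n * normc (bd f (u n).1 ((u n).1 + l n) (u n).2 ((u n).2 + k n)).
  elim: n => [|n /le_trans]; first by rewrite expr0 mul1r /l /k !expr0 !divr1.
  apply; rewrite exprSr -mulrA ler_wpM2l ?exprn_ge0//.
  by have [_] := unxt n.
have [v vP] : exists v : C, forall e : R, 0 < e -> exists2 d : R, 0 < d &
    forall h : C, normc h < d ->
      normc (f ((X +i* Y) + h) - f (X +i* Y) - v * h) <= e * normc h.
  apply/differentiable_eps/df => /=.
    by have := Xb 0%N; rewrite /l /= expr0 divr1.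
  by have := Yb 0%N; rewrite /k /= expr0 divr1.
apply/eq0_normc/eqP; rewrite eq_le normc_ge0 andbT.
apply/ler_addgt0Pr => e e0; rewrite add0r.
(* With slope error e' the final bound is 4 ^+ n * (4 * e' * (l n + k n) ^+ 2), that is 4 * e' * (L
   + H) ^+ 2, whatever n is; the added 1 keeps the divisor positive when L = H = 0. *)
have K0 : 0 < 4 * (L + H) * (L + H) + 1.
  by rewrite ltr_wpDl// !mulr_ge0// addr_ge0.
have [d d0 dP] := vP (e / (4 * (L + H) * (L + H) + 1)) (divr_gt0 e0 K0).
have [n nd] : exists n, l n + k n < d.
  pose n := Num.bound ((L + H) / d); exists n.
  rewrite -mulrDl ltr_pdivrMr ?exprn_gt0// mulrC -ltr_pdivrMr//.
  rewrite (lt_le_trans (archi_boundP _)) ?divr_ge0 ?addr_ge0 ?(ltW d0)//.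
  by rewrite -natrX ler_nat ltnW// ltn_expl.
apply: (le_trans (B n)).
(* [w + v * z] is the tangent map of f at the common point; its contour integral is 0, so it can be
   subtracted. *)
set w := f (X +i* Y) - v * (X +i* Y).
have ab : (u n).1 <= (u n).1 + l n by rewrite lerDl.
have cd : (u n).2 <= (u n).2 + k n by rewrite lerDl.
have cf' : rect_cont f (u n).1 ((u n).1 + l n) (u n).2 ((u n).2 + k n).
  by have [? ? ? ?] := uin n; exact: rect_contS cf _ _ _ _.
have ca : rect_cont (fun z => - w + - v * z) (u n).1 ((u n).1 + l n) (u n).2 ((u n).2 + k n).
  exact: rect_cont_affine.
have E : bd f (u n).1 ((u n).1 + l n) (u n).2 ((u n).2 + k n) =
   bd (fun z => f z + (- w + - v * z)) (u n).1 ((u n).1 + l n) (u n).2 ((u n).2 + k n).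
  by rewrite bdD ?bd_affine ?addr0//; exact: rect_cont_bd.
have {E}-> := E.
have le1 : normc (bd (fun z => f z + (- w + - v * z)) (u n).1 ((u n).1 + l n) (u n).2 ((u n).2 + k
  n))
   <= 4 * (e / (4 * (L + H) * (L + H) + 1) * (l n + k n)) * (l n + k n).
  rewrite [X in _ * X](_ : _ = (u n).1 + l n - (u n).1 + ((u n).2 + k n - (u n).2)); last first.
    by ring.
  suff bz (z : C) : (u n).1 <= complex.Re z <= (u n).1 + l n ->
      (u n).2 <= complex.Im z <= (u n).2 + k n ->
      normc (f z + (- w + - v * z)) <= e / (4 * (L + H) * (L + H) + 1) * (l n + k n).
    apply: normc_bd_le => //; first by apply: rect_cont_bd => //; exact: rect_contD.
      by move=> x xx; split; apply: bz; rewrite /= ?lexx ?cd.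
    by move=> x xx; split; apply: bz; rewrite /= ?lexx ?ab.
  move=> zx zy; have zE : z = (X +i* Y) + (z - (X +i* Y)) by rewrite subrKC.
  have zd : normc (z - (X +i* Y)) <= l n + k n.
    rewrite (le_trans (le_normcReIm _))// lerD// !raddfB/=.
      have := Xb n; move: zx => /andP[? ?] /andP[? ?].
      by rewrite ler_norml; apply/andP; split; lra.
    have := Yb n; move: zy => /andP[? ?] /andP[? ?].
    by rewrite ler_norml; apply/andP; split; lra.
  have := dP _ (le_lt_trans zd nd); rewrite -zE => /le_trans fz.
  rewrite (_ : _ + _ = f z - f (X +i* Y) - v * (z - (X +i* Y))); last by rewrite /w; ring.
  by apply: fz; rewrite ler_wpM2l// divr_ge0// ltW.
apply: (@le_trans _ _ (4 ^+ n * (4 * (e / (4 * (L + H) * (L + H) + 1) * (l n + k n)) * (l n + k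
  n)))).
  by rewrite ler_wpM2l ?exprn_ge0.
have -> : l n + k n = (L + H) / 2 ^+ n by rewrite -mulrDl.
have E4 : 4 ^+ n = 2 ^+ n * 2 ^+ n :> R by rewrite -exprMn -natrM.
have T0 : 2 ^+ n != 0 :> R by rewrite expf_neq0.
have T0' : 4 * (L + H) * (L + H) + 1 != 0 by rewrite gt_eqF.
rewrite E4 (_ : _ * _ = e * (4 * (L + H) * (L + H) / (4 * (L + H) * (L + H) + 1))); last first.
  by field; rewrite T0 T0'.
rewrite ger_pMr// ler_pdivrMr// mul1r lerDl//.
Qed.

Lemma ccont_hor_diff (f : C -> C) a b y :
  (forall x, a <= x <= b -> differentiable f (x +i* y : C)) ->
  ccont a b (fun t => f (t +i* y)).
Proof.
move=> df x e axb e0.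
have [r r0 rP] := continuousCP (differentiable_continuous (df _ axb)) e0.
exists r => // h hr; rewrite (_ : (x + h) +i* y = x +i* y + h +i* 0); last by simpc.
by apply: rP; rewrite normc_hor.
Qed.

Lemma ccont_ver_diff (f : C -> C) a b x :
  (forall y, a <= y <= b -> differentiable f (x +i* y : C)) ->
  ccont a b (fun t => f (x +i* t)).
Proof.
move=> df y e axb e0.
have [r r0 rP] := continuousCP (differentiable_continuous (df _ axb)) e0.
exists r => // h hr; rewrite (_ : x +i* (y + h) = x +i* y + 0 +i* h); last by simpc.
by apply: rP; rewrite normc_ver.
Qed.

Lemma bd_cont_diff (f : C -> C) a b c d :
  (forall x, a <= x <= b -> differentiable f (x +i* c : C) /\ differentiable f (x +i* d : C)) ->
  (forall y, c <= y <= d -> differentiable f (a +i* y : C) /\ differentiable f (b +i* y : C)) ->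
  bd_cont f a b c d.
Proof.
move=> dh dv; split.
- by apply: ccont_hor_diff => x /dh[].
- by apply: ccont_hor_diff => x /dh[].
- by apply: ccont_ver_diff => x /dv[].
- by apply: ccont_ver_diff => x /dv[].
Qed.

Lemma goursat_itv (f : C -> C) a b c d : a <= b -> c <= d ->
  (forall z : C, a <= complex.Re z <= b -> c <= complex.Im z <= d ->
     differentiable f z) ->
  bd f a b c d = 0.
Proof.
move=> ab cd df; rewrite -(subrKC a b) -(subrKC c d).
by apply: goursat; rewrite ?subr_ge0// !subrKC.
Qed.

(** If f stays bounded near its exceptional point, Goursat on the four surrounding rectangles leaves
    a square of side 2h about p, whose contribution is O(M h). *)
Lemma goursat_puncture (f : C -> C) (p : C) a b c d M r :
  a < complex.Re p < b -> c < complex.Im p < d ->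
  (forall z : C, a <= complex.Re z <= b -> c <= complex.Im z <= d -> z != p ->
     differentiable f z) ->
  0 < r -> (forall z : C, z != p -> normc (z - p) <= r -> normc (f z) <= M) ->
  bd f a b c d = 0.
Proof.
case: p => x0 y0 /= /andP[ax xb] /andP[cy yd] df r0 fM.
have M0 : 0 <= M.
  apply: le_trans (fM (x0 +i* y0 + r%:C) _ _); first exact: normc_ge0.
    by rewrite -subr_eq0 addrAC subrr add0r; apply/eqP => -[]/eqP; rewrite gt_eqF.
  by rewrite addrAC subrr add0r normcR gtr0_norm.
suff H (e : R) : 0 < e -> normc (bd f a b c d) <= e.
  apply/eq0_normc/eqP; rewrite eq_le normc_ge0 andbT.
  by apply/ler_addgt0Pr => e e0; rewrite add0r H.
move=> e0.
(* The square must fit in the rectangle and, since |Re| + |Im| is at most 2h on it, in the disc of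
   radius r. On it [normc_bd_le] gives 16 * M * h, hence the last entry. *)
pose h := Num.min (Num.min (x0 - a) (b - x0)) (Num.min (Num.min (y0 - c) (d - y0))
  (Num.min (r / 2) (e / (16 * M + 1)))).
have K0 : 0 < 16 * M + 1 by lra.
have h0 : 0 < h by rewrite !lt_min !subr_gt0 ax xb cy yd !divr_gt0.
have : h <= h by []. rewrite {2}/h !le_min.
move=> /and3P[/andP[ha hb] /andP[hc hd] /andP[hr he]].
have df' (z : C) : a <= complex.Re z <= b -> c <= complex.Im z <= d ->
    (complex.Re z != x0) || (complex.Im z != y0) -> differentiable f z.
  move=> zx zy zN; apply: df => //; apply: contraTN zN => /eqP ->/=.
  by rewrite !eqxx.
have E1 : bd f a b c d = bd f (x0 - h) (x0 + h) c d.
  rewrite (@bd_splith _ a (x0 - h)); last by lra.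
    rewrite [X in X + _]goursat_itv ?add0r; [|lra|lra|]; last first.
      by move=> z zx zy; apply: df' => //; [lra|rewrite lt_eqF//; lra].
    rewrite (@bd_splith _ _ (x0 + h)); last by lra.
      rewrite [X in _ + X]goursat_itv ?addr0//; [lra|lra|].
      by move=> z zx zy; apply: df' => //; [lra|rewrite gt_eqF//; lra].
    apply: bd_cont_diff => [x xx|y yy]; split; apply: df' => /=; lra.
  apply: bd_cont_diff => [x xx|y yy]; split; apply: df' => /=; lra.
have E2 : bd f a b c d = bd f (x0 - h) (x0 + h) (y0 - h) (y0 + h).
  rewrite {}E1 (@bd_splitv _ _ _ c (y0 - h)); last by lra.
    rewrite [X in X + _]goursat_itv ?add0r; [|lra|lra|]; last first.
      by move=> z zx zy; apply: df' => //; [lra|lra|rewrite orbC lt_eqF//; lra].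
    rewrite (@bd_splitv _ _ _ _ (y0 + h)); last by lra.
      rewrite [X in _ + X]goursat_itv ?addr0//; [lra|lra|].
      by move=> z zx zy; apply: df' => //; [lra|lra|rewrite orbC gt_eqF//; lra].
    apply: bd_cont_diff => [x xx|y yy]; split; apply: df' => /=; lra.
  apply: bd_cont_diff => [x xx|y yy]; split; apply: df' => /=; lra.
rewrite {}E2 (@le_trans _ _ (4 * M * (x0 + h - (x0 - h) + (y0 + h - (y0 - h)))))//; last first.
  rewrite (_ : _ * _ = (16 * M) * h); last by ring.
  move: he; rewrite ler_pdivlMr// mulrC; apply: le_trans.
  by rewrite ler_wpM2r// ?(ltW h0)//; lra.
have bz (z : C) : `|complex.Re z - x0| <= h -> `|complex.Im z - y0| <= h ->
   (complex.Re z != x0) || (complex.Im z != y0) -> normc (f z) <= M.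
  move=> zx zy zN; apply: fM.
    by apply: contraTN zN => /eqP ->/=; rewrite !eqxx.
  by rewrite (le_trans (le_normcReIm _))// !raddfB/= (le_trans (lerD zx zy))//; lra.
apply: normc_bd_le; [|lra|lra|..].
- apply: bd_cont_diff => [x xx|y yy]; split; apply: df' => /=; lra.
- move=> x xx; split; apply: bz => /=; rewrite ?ler_norml; lra.
- move=> x xx; split; apply: bz => /=; rewrite ?ler_norml; lra.
Qed.
End goursat.

(** * The complex exponential *)

Section expC.
Context {R : realType}.
Notation C := (R[i]^o).

Lemma eps_differentiable (f : C -> C) (z c : C) :
  (forall e : R, 0 < e -> exists2 d : R, 0 < d & forall h : C, normc h < d ->
      normc (f (z + h) - f z - c * h) <= e * normc h) ->
  differentiable f z.
Proof.
move=> H; apply/derivable1_diffP; apply/cvg_ex; exists c.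
apply/(@cvgrPdist_le _ C); move=> [e e'] /=; rewrite ltcE /= => /andP[/eqP -> e0].
have [d d0 dP] := H e e0.
rewrite /= near_withinE; apply/nbhsCP; exists d => // h hd; rewrite add0r => h0.
have {dP}/= := dP h hd; rewrite [h%:A]mulr1 [h + z]addrC => dP.
rewrite distrC normCE (_ : e +i* 0 = e%:C)// lecR.
rewrite (_ : _ - _ = h^-1 * (f (z + h) - f z - c * h)); last first.
  by rewrite /GRing.scale/= [RHS]mulrBr [c * h]mulrC mulKf.
have N0 : 0 < normc h.
  by rewrite lt_neqAle normc_ge0 andbT eq_sym; apply: contra h0 => /eqP/eq0_normc/eqP.
by rewrite normcM normcV ler_pdivrMl// [_ * e]mulrC.
Qed.

Definition expC (z : R[i]) : R[i] :=
  (expR (complex.Re z) * cos (complex.Im z)) +i* (expR (complex.Re z) * sin (complex.Im z)).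

Lemma expCD z w : expC (z + w) = expC z * expC w.
Proof.
case: z w => [a b] [c d]; rewrite /expC /= expRD cosD sinD; simpc.
by congr (_ +i* _); ring.
Qed.

Lemma normc_expC z : normc (expC z) = expR (complex.Re z).
Proof.
rewrite /expC /normc !exprMn -mulrDr cos2Dsin2 mulr1 sqrtr_sqr gtr0_norm//.
exact: expR_gt0.
Qed.

Lemma derivable_eps (f : R -> R) (x df : R) : is_derive x 1 f df ->
  forall e : R, 0 < e -> exists2 d : R, 0 < d &
    forall h, `|h| < d -> `|f (x + h) - f x - df * h| <= e * `|h|.
Proof.
move=> [/derivable_nbhsP fd <-] e e0.
have /eqaddoP /(_ e e0) /nbhs_ballP[d d0 dP] := fd.
exists d => // h hd; have := dP h; rewrite /ball/= sub0r normrN => /(_ hd).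
rewrite -![(_ + _ : _ -> _) _]/(_ + _) -![(- _ : _ -> _) _]/(- _).
by rewrite /= [_%:A]mulr1 opprD /cst addrA [h + x]addrC /GRing.scale/= [h * _]mulrC.
Qed.

Lemma expC_eps0 (e : R) : 0 < e -> exists2 d : R, 0 < d & forall h : C, normc h < d ->
  normc (expC h - 1 - h) <= e * normc h.
Proof.
(* Real and imaginary part of the error will each be at most 3 * (k * N), with N the norm of h;
   requiring N < k / 2 makes the second-order term 2 * N * N fit. *)
move=> e0; pose k := Num.min 1 (e / 20).
have k0 : 0 < k by rewrite lt_min ltr01 divr_gt0.
have k1 : k <= 1 by rewrite /k ge_min lexx.
have ke : k <= e / 20 by rewrite /k ge_min lexx orbT.
have [d1 d10 dE] := derivable_eps (is_derive_expR 0) k0.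
have [d2 d20 dC] := derivable_eps (is_derive_cos 0) k0.
have [d3 d30 dS] := derivable_eps (is_derive_sin 0) k0.
exists (Num.min (Num.min d1 d2) (Num.min d3 (k / 2))).
  by rewrite !lt_min d10 d20 d30 divr_gt0.
move=> h; rewrite !lt_min => /andP[/andP[h1 h2] /andP[h3 h4]].
have ha := normRe h; have hb := normIm h.
have := dE _ (le_lt_trans ha h1); have := dC _ (le_lt_trans hb h2).
have := dS _ (le_lt_trans hb h3).
rewrite !add0r expR0 cos0 sin0 oppr0 mul0r !addr0 ?subr0 !mul1r.
move=> hS hC hE; rewrite (le_trans (le_normcReIm _))//.
move: ha hb h4 (normc_ge0 h) hS hC hE => {h1 h2 h3 dE dC dS}; move: (normc h) => N.
case: h => a b; rewrite /expC/= subr0 => ha hb hk N0 hS hC hE.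
set E := expR a in hE *; set c := cos b in hC *; set s := sin b in hS *.
have hE1 : `|E - 1| <= 2 * N.
  rewrite (_ : E - 1 = (E - 1 - a) + a); last by ring.
  rewrite (le_trans (ler_normD _ _))// mulr2n mulrDl mul1r lerD//.
  by rewrite (le_trans hE)// (le_trans (ler_piMl _ k1)).
have hE3 : `|E| <= 2.
  rewrite (_ : E = (E - 1) + 1); last by ring.
  rewrite (le_trans (ler_normD _ _))// normr1; lra.
have kN : k * N <= e / 20 * N by rewrite ler_wpM2r.
have hR : `|E * c - 1 - a| <= 3 * (k * N).
  rewrite (_ : _ - a = (E - 1 - a) + E * (c - 1)); last by ring.
  rewrite (le_trans (ler_normD _ _))// normrM.
  rewrite (_ : 3 * _ = k * N + 2 * (k * N)); last by ring.
  rewrite lerD//; first by rewrite (le_trans hE)// ler_wpM2l// ltW.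
  by apply: ler_pM => //; rewrite (le_trans hC)// ler_wpM2l// ltW.
have hI : `|E * s - b| <= 3 * (k * N).
  rewrite (_ : _ - b = E * (s - b) + (E - 1) * b); last by ring.
  rewrite (le_trans (ler_normD _ _))// !normrM.
  rewrite (_ : 3 * _ = 2 * (k * N) + (k * N)); last by ring.
  rewrite lerD//.
    by apply: ler_pM => //; rewrite (le_trans hS)// ler_wpM2l// ltW.
  apply: (@le_trans _ _ (2 * N * N)); first exact: ler_pM.
  rewrite ler_wpM2r//; lra.
rewrite (le_trans (lerD hR hI))//.
move: kN N0; set x := k * N; set y := e / 20 * N => kN N0.
have -> : e * N = 20 * y by rewrite /y; field.
have y0 : 0 <= y by rewrite /y mulr_ge0// divr_ge0// ltW.
by lra.
Qed.

Lemma differentiable_expC (z : C) : differentiable (expC : C -> C) z.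
Proof.
apply: (@eps_differentiable _ _ (expC z)) => e e0.
have K0 : 0 < normc (expC z) by rewrite normc_expC expR_gt0.
have [d d0 dP] := expC_eps0 (divr_gt0 e0 K0).
exists d => // h /dP H.
rewrite expCD (_ : _ - _ = expC z * (expC h - 1 - h)); last by ring.
by rewrite normcM -ler_pdivlMl// mulrA [_^-1 * e]mulrC.
Qed.

End expC.

Section diffC.
Context {R : realType} {V : normedModType R[i]}.
Notation C := (R[i]^o).
Implicit Types (f g : V -> C).

Lemma cdiffM f g z : differentiable f z -> differentiable g z ->
  differentiable (fun z => f z * g z : C) z.
Proof. by move=> df dg; exact: (differentiableM df dg). Qed.

Lemma cdiffD f g z : differentiable f z -> differentiable g z ->
  differentiable (fun z => f z + g z : C) z.
Proof. by move=> df dg; exact: (differentiableD df dg). Qed.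

Lemma cdiffB f g z : differentiable f z -> differentiable g z ->
  differentiable (fun z => f z - g z : C) z.
Proof. by move=> df dg; exact: (differentiableB df dg). Qed.

Lemma cdiffV f z : differentiable f z -> f z != 0 -> differentiable (fun z => (f z)^-1 : C) z.
Proof. by move=> df f0; exact: (differentiableV df f0). Qed.

Lemma cdiff_cst (c : C) (z : V) : differentiable (fun _ : V => c) z.
Proof. exact: differentiable_cst. Qed.
Lemma cdiffX f n z : differentiable f z -> differentiable (fun z => f z ^+ n : C) z.
Proof.
move=> df; elim: n => [|n IH]; first exact: cdiff_cst.
rewrite (_ : (fun z => _) = (fun z => f z * f z ^+ n : C)); first exact: cdiffM.
by apply/funext => w; rewrite exprS.
Qed.

End diffC.

(** * Cauchy's formula at the point i *)

Section poisson.
Context {R : realType}.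
Notation C := (R[i]^o).
Notation mu := (@lebesgue_measure R).

Lemma cdiff_id (z : C) : differentiable (fun z : C => z) z.
Proof. exact/derivable1_diffP/derivable_id. Qed.

(** This is 1/(z - i) - 1/(z + i), the Cauchy kernel at i minus its reflection. On the real axis it
    equals 2i/(1 + t^2), and it decays like |z|^-2, one order better than the Cauchy kernel. *)
Definition pkernel (z : C) : C := (2 * 'i) * ((z - 'i) * (z + 'i))^-1.

Lemma im_neq (z : C) : 0 <= complex.Im z -> z != 'i -> (z - 'i) * (z + 'i) != 0.
Proof.
move=> z0 zi; rewrite mulf_neq0 ?subr_eq0// addr_eq0.
apply: contraTN z0 => /eqP ->; rewrite -ltNge /= oppr_lt0 ltr01//.
Qed.

Lemma pkernel_diff (z : C) : 0 <= complex.Im z -> z != 'i -> differentiable pkernel z.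
Proof.
move=> z0 zi; apply: cdiffM; first exact: cdiff_cst.
apply: (@cdiffV _ _ (fun z : C => (z - 'i) * (z + 'i) : C)); last exact: im_neq.
apply: (@cdiffM _ _ (fun z : C => z - 'i : C) (fun z : C => z + 'i : C)).
  by apply: cdiffB; [exact: cdiff_id|exact: cdiff_cst].
by apply: cdiffD; [exact: cdiff_id|exact: cdiff_cst].
Qed.

Lemma pkernel_real (t : R) : pkernel (t +i* 0) = 0 +i* (2 / (1 + t ^+ 2)).
Proof.
have h : 1 + t ^+ 2 != 0 by rewrite gt_eqF// ltr_pwDl// sqr_ge0.
rewrite /pkernel (_ : (_ - _) * _ = (1 + t ^+ 2)%:C); last first.
  by simpc; congr (_ +i* _); ring.
rewrite -(fmorphV (real_complex R)) (_ : 2 = 2%:C :> R[i])//.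
by simpc.
by rewrite (rmorph_nat (real_complex R)).
Qed.

Lemma normc2 : normc (2 : R[i]) = 2.
Proof. by rewrite -[2%R in LHS](rmorph_nat (real_complex R)) normcR ger0_norm. Qed.

Lemma pkernel_far (z : C) (r : R) : 2 <= r -> r <= normc z -> normc (pkernel z) <= 4 / r ^+ 2.
Proof.
move=> r2 rz; rewrite /pkernel normcM normcM normci mulr1.
rewrite (_ : (_ - _) * _ = z * z + 1); last first.
  rewrite (_ : 1 = - ('i * 'i)); first by ring.
  by rewrite -expr2 sqr_i opprK.
rewrite normc2.
rewrite normcV.
have h : r ^+ 2 / 2 <= normc (z * z + 1).
  have := le_normcD (z * z + 1) (- 1); rewrite addrK normcM normcN normc1.
  have : r ^+ 2 <= normc z * normc z.
    by rewrite expr2 ler_pM//; lra.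
  have : 2 * 2 <= r ^+ 2 by rewrite expr2 ler_pM.
  lra.
have r0 : 0 < r ^+ 2 by rewrite exprn_gt0//; lra.
have r20 : 0 < r ^+ 2 / 2 by rewrite divr_gt0.
rewrite (_ : 4 / r ^+ 2 = 2 * (r ^+ 2 / 2)^-1); last by field; rewrite gt_eqF//; lra.
by rewrite ler_wpM2l// lef_pV2// posrE// (lt_le_trans _ h).
Qed.

(** The three sides off the real axis have total length 4 * r and cost at most 2 * M per unit of
    length. *)
Lemma bd_bottom (f : C -> C) r M : 0 <= r -> bd_cont f (- r) r 0 r ->
  (forall z : C, complex.Im z = r \/ `|complex.Re z| = r -> `|complex.Re z| <= r ->
     0 <= complex.Im z <= r -> normc (f z) <= M) ->
  normc (bd f (- r) r 0 r - cint (- r) r (fun t => f (t +i* 0))) <= 8 * M * r.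
Proof.
move=> r0 [c1 c2 c3 c4] fM; rewrite /bd.
rewrite -!addrA addrC -!addrA addNr addr0 addrC.
have h2 : normc (cint (- r) r (fun t => f (t +i* r))) <= 2 * M * (r - - r).
  apply: normc_cint_le => //; first lra.
  by move=> x xr; apply: fM => /=; [left|rewrite ler_norml|rewrite lexx r0].
have h3 : normc ('i * cint 0 r (fun t => f (- r +i* t))) <= 2 * M * (r - 0).
  rewrite normcM normci mul1r; apply: normc_cint_le => //.
  by move=> x xr; apply: fM => //=; [right|]; rewrite normrN ger0_norm.
have h4 : normc ('i * cint 0 r (fun t => f (r +i* t))) <= 2 * M * (r - 0).
  rewrite normcM normci mul1r; apply: normc_cint_le => //.
  by move=> x xr; apply: fM => //=; [right|]; rewrite ger0_norm.
rewrite (le_trans (le_normcD _ _))//.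
rewrite (_ : 8 * M * r = 2 * M * (r - - r) + 2 * M * (r - 0) + 2 * M * (r - 0)); last by ring.
by rewrite lerD// (le_trans (le_normcD _ _))// !normcN lerD.
Qed.

(** The exact value is 2 pi i, but a lower bound suffices: on the real side the part over [-1, 1]
    alone contributes at least 2, and the other sides at most 8 * (4 / r ^+ 2) * r = 32 / r, which
    is at most 1. This fixes the threshold 32. *)
Lemma bd_pkernel r : 32 <= r -> 1 <= normc (bd pkernel (- r) r 0 r).
Proof.
move=> r32; have r0 : 0 < r by lra.
have df (z : C) : complex.Im z = r \/ `|complex.Re z| = r \/ complex.Im z = 0 ->
     0 <= complex.Im z <= r -> differentiable pkernel z.
  case: z => x y /= h /andP[y0 yr]; apply: pkernel_diff => //.
  apply/eqP => -[x0 y1]; move: h; rewrite x0 y1 normr0.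
  by case=> [h|[h|/eqP]]; [lra|lra|rewrite oner_eq0].
have cK : bd_cont pkernel (- r) r 0 r.
  apply: bd_cont_diff => [x xr|y yr]; split; apply: df => //=.
  - by right; right.
  - by rewrite lexx ltW.
  - by left.
  - by rewrite lexx ltW.
  - by right; left; rewrite normrN gtr0_norm.
  - by right; left; rewrite gtr0_norm.
have := @bd_bottom pkernel r (4 / r ^+ 2) (ltW r0) cK.
have far (z : C) : complex.Im z = r \/ `|complex.Re z| = r ->
    `|complex.Re z| <= r -> 0 <= complex.Im z <= r -> normc (pkernel z) <= 4 / r ^+ 2.
  move=> h _ zi; apply: pkernel_far; first lra.
  have := normRe z; have := normIm z; case: h => [->|->//].
  by rewrite ger0_norm// ltW.
move=> /(_ far) {far}.
set b := bd _ _ _ _ _; set c := cint _ _ _ => bc.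
have hc : 2 <= normc c.
  have E : complex.Im c = \int[mu]_(x in `[(- r), r]) (2 / (1 + x ^+ 2)).
    by apply: eq_Rintegral => x _; rewrite pkernel_real.
  rewrite (le_trans _ (normIm _))// (le_trans _ (ler_norm _))// {}E.
  have cont a d : {within `[a, d], continuous (fun t : R => 2 / (1 + t ^+ 2))}.
    apply: continuous_subspaceT => t; apply: cvgM; first exact: cvg_cst.
    by apply: cvgV; [rewrite gt_eqF// ltr_pwDl// sqr_ge0|
      apply: cvgD; [exact: cvg_cst|exact: exprn_continuous]].
  have ci a d : mu.-integrable `[a, d] (EFin \o (fun t : R => 2 / (1 + t ^+ 2))).
    apply: continuous_compact_integrable; first exact: segment_compact.
    exact: cont.
  apply: (@le_trans _ _ (\int[mu]_(t in `[(-1), 1]) (1 : R))).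
    rewrite Rintegral_cst// fine_mu_itv; lra.
  apply: (@le_trans _ _ (\int[mu]_(x in `[(-1), 1]) (2 / (1 + x ^+ 2)))).
    apply: le_Rintegral => //.
      apply: continuous_compact_integrable; first exact: segment_compact.
      by apply: continuous_subspaceT => x; exact: cvg_cst.
    move=> x; rewrite /= in_itv/= => x1.
    rewrite ler_pdivlMr ?mul1r; last by rewrite ltr_pwDl// sqr_ge0.
    rewrite -[2]/(1 + 1) lerD2l -real_normK ?num_real// exprn_ile1//.
    by rewrite ler_norml.
  rewrite -lee_fin /Rintegral !fineK; try exact: integrable_fin_num.
  apply: ge0_subset_integral => //.
  - by case/integrableP: (ci (-r) r).
  - by move=> x _; rewrite lee_fin divr_ge0// addr_ge0// sqr_ge0.
  - by apply: subset_itv; rewrite bnd_simp; lra.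
have h8 : 8 * (4 / r ^+ 2) * r <= 1.
  rewrite (_ : _ * r = 32 / r); last by field; rewrite gt_eqF.
  by rewrite ler_pdivrMr// mul1r.
have := le_normcD b (- b + c); rewrite addrA subrr add0r.
rewrite -[X in _ <= _ + X](normcN (- b + c)) opprD opprK.
lra.
Qed.

(** Cauchy's formula with the residue left as an unevaluated integral: (f - f(i)) times the kernel
    stays bounded near i, so [goursat_puncture] applies to it. *)
Lemma pkernel_far_diff (f : C -> C) r : 32 <= r ->
  (forall z : C, 0 <= complex.Im z -> differentiable f z) ->
  bd (fun z => f z * pkernel z) (- r) r 0 r = f 'i * bd pkernel (- r) r 0 r.
Proof.
move=> r32 df; have r0 : 0 < r by lra.
have cont (g : C -> C) : (forall z : C, 0 <= complex.Im z -> z != 'i -> differentiable g z) ->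
    bd_cont g (- r) r 0 r.
  move=> dg; apply: bd_cont_diff => [x xr|y yr]; split; apply: dg => /=; try lra.
  - by apply/eqP => -[_ /eqP]; rewrite lt_eqF.
  - by apply/eqP => -[_ /eqP]; rewrite gt_eqF//; lra.
  - by apply/eqP => -[/eqP]; rewrite oppr_eq0 gt_eqF//.
  - by apply/eqP => -[/eqP]; rewrite gt_eqF//.
apply/eqP; rewrite -subr_eq0 -mulNr; apply/eqP.
rewrite -bdZ; last by apply: cont => z; exact: pkernel_diff.
rewrite -bdD; last 2 first.
- by apply: cont => z z0 zi; apply: cdiffM; [exact: df|exact: pkernel_diff].
- by apply: cont => z z0 zi; apply: cdiffM; [exact: cdiff_cst|exact: pkernel_diff].
have [v vP] := differentiable_eps (df ('i : C) ler01).
have [d d0 dP] := vP 1 ltr01.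
(* Near i one has |f(z) - f(i)| <= (|v| + 1) |z - i|, and |z + i| >= 1 as soon as |z - i| <= 1; the
   factor 2 is |2i|. *)
apply: (@goursat_puncture _ _ 'i _ _ _ _ (2 * (normc v + 1)) (Num.min 1 (d / 2))) => /=; try lra.
- move=> z zr /andP[z0 _] zi; apply: cdiffD.
    by apply: cdiffM; [exact: df|exact: pkernel_diff].
  by apply: cdiffM; [exact: cdiff_cst|exact: pkernel_diff].
- by rewrite lt_min ltr01 divr_gt0.
- move=> z zi; rewrite le_min => /andP[z1 zd].
  have zd' : normc (z - 'i) < d by lra.
  have := dP (z - 'i) zd'; rewrite subrKC mul1r => H.
  rewrite -mulrDl normcM.
  have N0 : 0 < normc (z - 'i).
    rewrite lt_neqAle normc_ge0 andbT eq_sym; apply/eqP => /eq0_normc/eqP.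
    by rewrite subr_eq0 (negPf zi).
  have h1 : normc (f z + - f 'i) <= (normc v + 1) * normc (z - 'i).
    have := le_normcD (f z - f 'i - v * (z - 'i)) (v * (z - 'i)).
    rewrite subrK normcM; lra.
  have h2 : 1 <= normc (z + 'i).
    have := le_normcD (z + 'i) (- (z - 'i)); rewrite normcN.
    rewrite (_ : z + 'i - _ = 2 * 'i); last by ring.
    rewrite normcM normci mulr1 normc2; lra.
  rewrite /pkernel normcM normcM normci mulr1 normcV normcM invfM.
  rewrite normc2.
  apply: (@le_trans _ _ ((normc v + 1) * normc (z - 'i) * (2 * ((normc (z - 'i))^-1 * 1)))).
    apply: ler_pM => //; rewrite ?normc_ge0//.
      by rewrite !mulr_ge0// invr_ge0 normc_ge0.
    rewrite ler_wpM2l// ler_wpM2l ?invr_ge0 ?normc_ge0// invf_le1//.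
    by rewrite (lt_le_trans ltr01).
  by rewrite mulr1 mulrCA -!mulrA mulfV ?gt_eqF// mulr1.
Qed.
End poisson.

Section poissonbound.
Context {R : realType}.
Notation C := (R[i]^o).
Notation mu := (@lebesgue_measure R).

(* On the three far sides of [-r, r] x [0, r] the real part of z^2/r - 2iz is at
   least r, so that the factor kills the growth of f; it is at most 1 on the real
   side and bounded below at i, uniformly in r. *)
Definition damp (k r : R) (z : C) : C :=
  expC (- (k%:C) * (r^-1%:C * (z * z) - 2 * 'i * z)).

Lemma damp_diff k r (z : C) : differentiable (damp k r) z.
Proof.
apply: (@differentiable_comp _ _ _ _ (fun z : C =>
  - (k%:C) * (r^-1%:C * (z * z) - 2 * 'i * z) : C) (expC : C -> C)).
  apply: cdiffM; first exact: cdiff_cst.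
  apply: cdiffB.
    by apply: cdiffM; [exact: cdiff_cst|apply: cdiffM; exact: cdiff_id].
  by apply: cdiffM; [exact: cdiff_cst|exact: cdiff_id].
exact: differentiable_expC.
Qed.

Lemma normc_damp k r x y :
  normc (damp k r (x +i* y)) = expR (- k * ((x ^+ 2 - y ^+ 2) / r + 2 * y)).
Proof.
rewrite normc_expC; congr expR.
rewrite -(rmorph_nat (real_complex R) 2) -[- (k%:C)](rmorphN (real_complex R)) /=.
by simpc => /=; ring.
Qed.

Lemma normc_hor_continuous (f : C -> C) y :
  (forall x, differentiable f (x +i* y : C)) ->
  continuous (fun t : R => normc (f (t +i* y))).
Proof.
move=> df x; apply: (@continuousR_eps R (fun t => normc (f (t +i* y)))) => e e0.
have cf : ccont x x (fun t => f (t +i* y)) by apply: ccont_hor_diff => t _; exact: df.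
have [d d0 dP] := cf x e ltac:(by rewrite lexx) e0.
by exists d => // h /dP; exact: le_lt_trans (normc_lip _ _).
Qed.

(** Cauchy's formula for f times [damp (2 * k) r]. On the far sides |z| is at most 2 * r, so f is at
    most exp(2kr), while the damping exponent has real part at least r: hence the rate [2 * k], and
    a product bounded by 1. At i the factor is at least exp(-4k). *)
Lemma damped_bound (k r : R) (f : C -> C) : 0 <= k -> 32 <= r ->
  (forall z : C, 0 <= complex.Im z -> differentiable f z) ->
  (forall z : C, 0 <= complex.Im z -> r <= normc z ->
    normc (f z) <= expR (k * normc z)) ->
  normc (f 'i) * expR (- (4 * k)) <=
    4 * \int[mu]_(t in `[(- r), r]) (normc (f (t +i* 0)) / (1 + t ^+ 2)) + 32 / r.
Proof.
move=> k0 r32 df fk; have r0 : 0 < r by lra.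
pose F z : C := f z * damp (2 * k) r z.
have dF (z : C) : 0 <= complex.Im z -> differentiable F z.
  by move=> z0; apply: cdiffM; [exact: df|exact: damp_diff].
have Fi : normc (f 'i) * expR (- (4 * k)) <= normc (F 'i).
  rewrite /F normcM ler_wpM2l ?normc_ge0// normc_damp ler_expR.
  have : 0 <= 2 * k * r^-1 by rewrite !mulr_ge0// invr_ge0 ltW.
  rewrite expr0n expr1n /= (_ : - (2 * k) * _ = - (4 * k) + 2 * k * r^-1); last by ring.
  by move=> ?; rewrite lerDl.
have Fb (t : R) : normc (F (t +i* 0)) <= normc (f (t +i* 0)).
  rewrite /F normcM ler_piMr ?normc_ge0// normc_damp -[X in _ <= X]expR0 ler_expR.
  rewrite mulr0 expr0n/= subr0 addr0 mulNr oppr_le0.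
  by apply: mulr_ge0; [exact: mulr_ge0|rewrite divr_ge0 ?sqr_ge0// ltW].
have Fs (z : C) : complex.Im z = r \/ `|complex.Re z| = r ->
    `|complex.Re z| <= r -> 0 <= complex.Im z <= r -> normc (F z) <= 1.
  case: z => x y /= h xr /andP[y0 yr].
  have rz : r <= normc (x +i* y).
    have := @normRe R (x +i* y); have := @normIm R (x +i* y) => /=.
    by case: h => [->|->//]; rewrite gtr0_norm.
  rewrite /F normcM normc_damp (le_trans (ler_wpM2r _ (fk _ _ rz)))// ?expR_ge0//.
  rewrite -expRD -[X in _ <= X]expR0 ler_expR.
  have nz : normc (x +i* y) <= 2 * r.
    by rewrite (le_trans (le_normcReIm _))//= (ger0_norm y0); lra.
  have v : r <= (x ^+ 2 - y ^+ 2) / r + 2 * y.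
    rewrite -lerBlDr ler_pdivlMr//; case: h => [->|h].
      have := sqr_ge0 x; rewrite expr2; lra.
    rewrite -(real_normK (num_real x)) h.
    have : 0 <= y * (2 * r - y) by rewrite mulr_ge0//; lra.
    rewrite !expr2; lra.
  have h1 : k * normc (x +i* y) <= k * (2 * r) by rewrite ler_wpM2l.
  have h2 : k * r <= k * ((x ^+ 2 - y ^+ 2) / r + 2 * y) by rewrite ler_wpM2l.
  rewrite mulNr subr_le0 (le_trans h1)// mulrCA -mulrA ler_wpM2l//.
have E := pkernel_far_diff r32 dF.
have cb : bd_cont (fun z => F z * pkernel z) (- r) r 0 r.
  apply: bd_cont_diff => [x xr|y yr]; split; (apply: cdiffM;
    [apply: dF|apply: pkernel_diff]) => /=; try lra.
  - by apply/eqP => -[_ /eqP]; rewrite lt_eqF.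
  - by apply/eqP => -[_ /eqP]; rewrite gt_eqF//; lra.
  - by apply/eqP => -[/eqP]; rewrite oppr_eq0 gt_eqF//.
  - by apply/eqP => -[/eqP]; rewrite gt_eqF//.
have := @bd_bottom _ _ r (4 / r ^+ 2) (ltW r0) cb.
have far (z : C) : complex.Im z = r \/ `|complex.Re z| = r ->
    `|complex.Re z| <= r -> 0 <= complex.Im z <= r -> normc (F z * pkernel z) <= 4 / r ^+ 2.
  move=> h zr zi; rewrite normcM -[X in _ <= X]mul1r.
  apply: ler_pM; rewrite ?normc_ge0//; first exact: Fs.
  apply: pkernel_far; first lra.
  have := normRe z; have := normIm z; case: h => [->|->//].
  by rewrite ger0_norm// ltW.
move=> /(_ far) {far}.
have -> : 8 * (4 / r ^+ 2) * r = 32 / r by field; rewrite gt_eqF.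
rewrite E; set b := bd _ _ _ _ _; set c := cint _ _ _ => bc.
have b1 : 1 <= normc b by exact: bd_pkernel.
have h1 : normc (F 'i) <= normc (F 'i * b).
  by rewrite [X in _ <= X]normcM ler_peMr ?normc_ge0.
have h2 := le_normcD (F 'i * b - c) c; rewrite subrK in h2.
have contf : ccont (- r) r (fun t => f (t +i* 0)).
  by apply: ccont_hor_diff => x _; apply: df.
have contK : {within `[(- r), r], continuous (fun t : R => normc (f (t +i* 0)) / (1 + t ^+ 2))}.
  apply: continuous_in_subspaceT => x /[!inE]; rewrite /= in_itv/= => xab.
  apply: cvgM; first by apply: normc_hor_continuous => t; exact: df.
  apply: cvgV; first by rewrite gt_eqF// ltr_pwDl// sqr_ge0.
  by apply: cvgD; [exact: cvg_cst|exact: exprn_continuous].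
have h3 : normc c <= 4 * \int[mu]_(t in `[(- r), r]) (normc (f (t +i* 0)) / (1 + t ^+ 2)).
  have [cc _ _ _] := cb.
  rewrite (le_trans (normc_cint cc))//.
  rewrite (_ : 4 * _ = 2 * \int[mu]_(t in `[(- r),
    r]) (2 * (normc (f (t +i* 0)) / (1 + t ^+ 2)))); last first.
    rewrite RintegralZl//; first by rewrite mulrA -natrM.
    apply: continuous_compact_integrable; first exact: segment_compact.
    exact: contK.
  rewrite ler_wpM2l//; apply: le_Rintegral => //.
  - exact: ccont_integrable cc normc_lip.
  - rewrite (_ : EFin \o _ = fun x => (2%:E * (normc (f (x +i* 0)) / (1 + x ^+ 2))%:E)%E)//.
    apply: integrableZl => //.
    apply: continuous_compact_integrable; first exact: segment_compact.
    exact: contK.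
  - move=> x _; rewrite normcM pkernel_real normc_ver ger0_norm; last first.
      by rewrite divr_ge0// addr_ge0// sqr_ge0.
    rewrite mulrCA ler_wpM2l// ler_wpM2r//.
    by rewrite invr_ge0 addr_ge0// sqr_ge0.
lra.
Qed.

(** Letting r grow removes the error 32 / r. The constant depends on k but not on r0, so it is
    uniform over all functions with the same growth rate. *)
Lemma poisson_bound (k r0 : R) (f : C -> C) : 0 <= k ->
  (forall z : C, 0 <= complex.Im z -> differentiable f z) ->
  (forall z : C, 0 <= complex.Im z -> r0 <= normc z ->
    normc (f z) <= expR (k * normc z)) ->
  ((normc (f 'i))%:E <=
    (4 * expR (4 * k))%:E * \int[mu]_t (normc (f (t +i* 0)) / (1 + t ^+ 2))%:E)%E.
Proof.
move=> k0 df fk.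
have : (0 <= \int[mu]_t (normc (f (t +i* 0)) / (1 + t ^+ 2))%:E)%E.
  by apply: integral_ge0 => t _; rewrite lee_fin divr_ge0 ?normc_ge0// addr_ge0// sqr_ge0.
have K0 : 0 < 4 * expR (4 * k) by rewrite mulr_gt0// expR_gt0.
set J := (X in (_ * X)%E); rewrite -[X in (_ <= X)%E -> _]/J; case Ey : J => [I| |] //; last first.
  by move=> _; rewrite gt0_muley ?leey// lte_fin.
rewrite lee_fin => I0; rewrite -EFinM lee_fin.
suff H (e : R) : 0 < e -> normc (f 'i) * expR (- (4 * k)) <= 4 * I + e.
  have : normc (f 'i) * expR (- (4 * k)) <= 4 * I by apply/ler_addgt0Pr.
  rewrite expRN ler_pdivrMr ?expR_gt0//; congr (_ <= _); ring.
move=> e0; pose r := Num.max (Num.max 32 r0) (32 / e).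
have r32 : 32 <= r by rewrite !le_max lexx.
have fk' (z : C) : 0 <= complex.Im z -> r <= normc z ->
    normc (f z) <= expR (k * normc z).
  by move=> z0 rz; apply: fk => //; apply: le_trans rz; rewrite !le_max lexx orbT.
apply: (le_trans (damped_bound k0 r32 df fk')); rewrite lerD//; last first.
  rewrite ler_pdivrMr; last by lra.
  by rewrite mulrC -ler_pdivrMr// le_max lexx orbT.
rewrite ler_wpM2l// -lee_fin.
have mf : measurable_fun setT (fun t : R => normc (f (t +i* 0)) / (1 + t ^+ 2) : R).
  apply: continuous_measurable_fun => x.
  apply: cvgM; first by apply: normc_hor_continuous => t; exact: df.
  apply: cvgV; first by rewrite gt_eqF// ltr_pwDl// sqr_ge0.
  by apply: cvgD; [exact: cvg_cst|exact: exprn_continuous].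
have le1 : (\int[mu]_(t in `[(- r)%R, r]) (normc (f (t +i* 0)) / (1 + t ^+ 2))%:E <= I%:E)%E.
  rewrite -Ey /J; apply: ge0_subset_integral => //; first exact/measurable_EFinP.
  by move=> t _; rewrite lee_fin divr_ge0 ?normc_ge0// addr_ge0// sqr_ge0.
rewrite /Rintegral fineK// ge0_fin_numE; first exact: le_lt_trans le1 (ltry _).
by apply: integral_ge0 => t _; rewrite lee_fin divr_ge0 ?normc_ge0// addr_ge0// sqr_ge0.
Qed.
End poissonbound.

(** * The weighted bound on a line *)

Section affine.
Context {R : realType}.
Notation mu := (@lebesgue_measure R).

Let aff (c t : R) : measurableTypeR R -> measurableTypeR R := fun x => c * x + t.

Let maff c t : measurable_fun setT (aff c t).
Proof. by apply: measurable_funD => //; exact: mulrl_measurable. Qed.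

Let paff c t := pushforward mu (aff c t).

Let paff0 c t : paff c t set0 = 0%E.
Proof. by rewrite /paff /pushforward preimage_set0 measure0. Qed.

Let paff_ge0 c t A : (0 <= paff c t A)%E.
Proof. exact: measure_ge0. Qed.

Let paff_sigma_additive c t : semi_sigma_additive (paff c t).
Proof.
exact: (@measure_semi_sigma_additive _ _ _
  (measure_function_pushforward__canonical__measure_function_Measure mu (maff c t))). Qed.

HB.instance Definition _ c t := isMeasure.Build _ _ _ (paff c t)
  (paff0 c t) (@paff_ge0 c t) (@paff_sigma_additive c t).

(** By uniqueness of the measure with given values on half-open intervals. For c < 0 the preimage of
    ]a, b] is closed on the left instead, with the same length. *)
Lemma lebesgue_measure_aff (c t : R) (A : set (measurableTypeR R)) : c != 0 -> measurable A ->
  mu A = (`|c|%:E * mu (aff c t @^-1` A))%E.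
Proof.
move=> c0 mA.
have c0' : 0 <= `|c| by [].
pose nu := mscale (NngNum c0') (paff c t).
rewrite (_ : (_ * _)%E = nu A)//.
apply: lebesgue_measure_unique => //= X [[a b] /= _ <-].
rewrite /nu /mscale /= /paff /pushforward.
have [ba|ab] := leP b a.
  rewrite set_itv_ge ?bnd_simp -?leNgt//.
  by rewrite preimage_set0 !measure0 mule0.
have hE : mu (aff c t @^-1` [set` `]a, b]]) = ((b - a) / `|c|)%:E.
  have [c_gt0|c_lt0|/eqP] := ltgtP 0 c; last by rewrite eq_sym (negPf c0).
    rewrite (_ : _ @^-1` _ = [set` `](a - t) / c, (b - t) / c]]).
      have := lebesgue_measure_itv `](a - t) / c, (b - t) / c] => /= ->.
      rewrite lte_fin ltr_pM2r ?invr_gt0// ltrD2r ab gtr0_norm// -EFinB.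
      by congr _%:E; field.
    apply/seteqP; split => x; rewrite /= !in_itv/= /aff ltr_pdivrMr// ler_pdivlMr//;
      rewrite ltrBlDr lerBrDr [x * c]mulrC//.
  rewrite (_ : _ @^-1` _ = [set` `[(b - t) / c, (a - t) / c[]).
    have := lebesgue_measure_itv `[(b - t) / c, (a - t) / c[ => /= ->.
    rewrite lte_fin ltr_nM2r ?invr_lt0// ltrD2r ab ltr0_norm// -EFinB.
    by congr _%:E; field.
  apply/seteqP; split => x; rewrite /= !in_itv/= /aff ltr_ndivlMr// ler_ndivrMr//;
    by rewrite ltrBlDr lerBrDr [x * c]mulrC// andbC.
rewrite hE -EFinM mulrC divfK ?normr_eq0//.
by have := lebesgue_measure_itv `]a, b] => /= ->; rewrite lte_fin ab.
Qed.

Lemma ge0_integral_aff (c t : R) (f : measurableTypeR R -> \bar R) : c != 0 ->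
  measurable_fun setT f -> (forall x, 0 <= f x)%E ->
  (\int[mu]_x f x = `|c|%:E * \int[mu]_x f (c * x + t)%R)%E.
Proof.
move=> c0 mf f0.
have c0' : 0 <= `|c| by [].
rewrite (@eq_measure_integral _ _ _ _ (mscale (NngNum c0') (paff c t))).
  rewrite ge0_integral_mscale//= ge0_integral_pushforward//.
move=> A mA _; exact: lebesgue_measure_aff.
Qed.
End affine.

Section power.
Context {R : realType}.
Notation mu := (@lebesgue_measure R).

Lemma measurable_abspowR (p : R) : measurable_fun setT (fun s : R => `|s| `^ p).
Proof. exact: (measurableT_comp (measurable_powR p) (@normr_measurable R setT)). Qed.

Lemma measurable_abs_le (r : R) : measurable [set s : R | `|s| <= r].
Proof.
rewrite (_ : [set _ | _] = `[(- r), r]%classic)//.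
by apply/seteqP; split => x; rewrite /= in_itv/= ler_norml.
Qed.

Lemma integral_powR_itv (p a : R) : -1 < p -> 0 < a -> a <= 1 ->
  (\int[mu]_(s in `[a, 1%R]) (s `^ p)%:E <= (p + 1)^-1%:E)%E.
Proof.
move=> p1 a0; have q0 : 0 < p + 1 by lra.
rewrite le_eqVlt => /predU1P[->|a1].
  by rewrite set_itv1 integral_set1 lee_fin invr_ge0 ltW.
have dF (x : R) : 0 < x -> is_derive x 1 (fun x : R => x `^ (p + 1) / (p + 1)) (x `^ p).
  move=> x0; rewrite (_ : (fun x => _) = (p + 1)^-1 \*: (fun x : R => x `^ (p + 1))); last first.
    by apply/funext => y; rewrite /= mulrC.
  apply: is_derive_eq; first by apply: is_deriveZ; exact: is_derive1_powR.
  by rewrite addrK /GRing.scale/= mulKf// gt_eqF.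
have cF (x : R) : 0 < x -> {for x, continuous (fun x : R => x `^ (p + 1) / (p + 1))}.
  move=> x0; apply: differentiable_continuous; apply/derivable1_diffP.
  by have [] := dF x x0.
rewrite (@continuous_FTC2 _ _ (fun x => x `^ (p + 1) / (p + 1)))//.
- rewrite powR1 mul1r -EFinB lee_fin gerDl oppr_le0.
  by rewrite divr_ge0 ?powR_ge0// ltW.
- apply: continuous_in_subspaceT => x /[!inE]; rewrite /= in_itv/= => /andP[ax _].
  apply: differentiable_continuous; apply/derivable1_diffP.
  by apply: derivable_powR; rewrite in_itv/= andbT (lt_le_trans a0).
- split.
  + move=> x; rewrite in_itv/= => /andP[ax _]; have [] := dF x (lt_trans a0 ax) => //.
  + exact: cvg_at_right_filter (cF _ a0).
  + exact: cvg_at_left_filter (cF _ ltr01).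
- move=> x; rewrite in_itv/= => /andP[ax _].
  by rewrite derive1E; have [_] := dF x (lt_trans a0 ax).
Qed.

(** For p < 0 the integrand is unbounded at 0, so ]0, 1] is exhausted by [1/(n+1), 1], where the
    bound is uniform in n. *)
Lemma integral_powR_0c (p : R) : -1 < p ->
  (\int[mu]_(s in `]0%R, 1%R]) (s `^ p)%:E <= (p + 1)^-1%:E)%E.
Proof.
move=> p1; pose F n := `[(n.+1%:R)^-1, 1]%classic : set R.
have FU : `]0%R, 1%R]%classic = \bigcup_n F n :> set R.
  apply/seteqP; split => x; rewrite /= ?in_itv/=.
    move=> /andP[x0 x1]; exists (Num.bound x^-1) => //.
    rewrite /F/= in_itv/= x1 andbT -[leRHS]invrK lef_pV2 ?posrE ?invr_gt0//.
    rewrite (le_trans (ltW (archi_boundP _))) ?invr_ge0 ?(ltW x0)// ler_nat//.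
  move=> [n _]; rewrite /F/= in_itv/= => /andP[h ->]; rewrite andbT.
  by rewrite (lt_le_trans _ h).
rewrite FU.
have mp : measurable_fun setT (fun s : R => (s `^ p)%:E).
  by apply/measurable_EFinP; exact: measurable_powR.
have ndF : nondecreasing_seq F.
  move=> m n mn; apply/subsetPset => x; rewrite /F/= !in_itv/= => /andP[h ->].
  by rewrite andbT (le_trans _ h)// lef_pV2 ?posrE// ler_nat.
have cv : (\int[mu]_(x in F i) (x `^ p)%:E)%E @[i --> \oo] -->
    (\int[mu]_(x in \bigcup_i F i) (x `^ p)%:E)%E.
  apply: ge0_nondecreasing_set_cvg_integral => //; first by move=> i; exact: measurable_itv.
    by move=> i; exact: measurable_funS mp.
  by move=> i x _; rewrite lee_fin powR_ge0.
rewrite -(cvg_lim _ cv)//; apply: lime_le; first by apply/cvg_ex; eexists; exact: cv.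
apply: nearW => n; apply: integral_powR_itv; rewrite ?invr_gt0//.
by rewrite invf_le1// ler1n.
Qed.

Lemma integral_abspowR_unit (p : R) : -1 < p ->
  exists2 C : R, 0 < C &
  (\int[mu]_(s in [set s : R | (`|s| <= 1)%R]) (`|s| `^ p)%:E <= C%:E)%E.
Proof.
move=> p1; have q0 : 0 < p + 1 by lra.
exists (2 * (p + 1)^-1); first by rewrite mulr_gt0// invr_gt0.
(* [psi] carries the half [0, 1], its reflection the other half; counting 0 twice does not hurt an
   upper bound. *)
pose psi (s : R) : R := if (0 <= s <= 1) then s `^ p else 0.
have mpsi : measurable_fun setT psi.
  rewrite (_ : psi = (fun s => s `^ p) \_ `[0, 1]).
    apply/(measurable_restrictT _ _).1 => //.
    exact: measurable_funS (measurable_powR p).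
  by apply/funext => s; rewrite patchE mem_setE in_itv.
have psi0 s : 0 <= psi s by rewrite /psi; case: ifP => // _; exact: powR_ge0.
have E1 : (\int[mu]_s (psi s)%:E <= (p + 1)^-1%:E)%E.
  rewrite (_ : (\int[mu]_s (psi s)%:E = \int[mu]_(s in `[0%R, 1%R]) (s `^ p)%:E)%E).
    rewrite -integral_itv_obnd_cbnd; first exact: integral_powR_0c.
    apply/measurable_EFinP; exact: measurable_funS (measurable_powR p).
  rewrite [RHS]integral_mkcond/=; apply: eq_integral => s _.
  by rewrite patchE /psi mem_setE/= in_itv/=; case: ifP.
have psiE s : 0 <= s -> s <= 1 -> psi s = s `^ p by rewrite /psi => -> ->.
clearbody psi.
have E2 : (\int[mu]_s (psi (- s))%:E = \int[mu]_s (psi s)%:E)%E.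
  rewrite [RHS](@ge0_integral_aff _ (-1) 0) ?oppr_eq0 ?oner_eq0//.
  - rewrite normrN normr1 mul1e; apply: eq_integral => s _.
    by rewrite mulN1r addr0.
  - exact/measurable_EFinP.
apply: (@le_trans _ _ (\int[mu]_s ((psi s)%:E + (psi (- s))%:E))%E).
  rewrite integral_mkcond/=; apply: ge0_le_integral => //.
  - move=> x _; rewrite patchE; case: ifP => // _; rewrite lee_fin powR_ge0//.
  - apply/(measurable_restrictT _ _).1; first exact: measurable_abs_le.
    by apply/measurable_EFinP; apply: measurable_funS (measurable_abspowR p).
  - apply: emeasurable_funD; apply/measurable_EFinP => //.
    exact: measurableT_comp.
  - move=> x _; rewrite patchE; case: ifPn; last by rewrite adde_ge0// lee_fin.
    rewrite inE/= -EFinD lee_fin => x1.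
    have [x0|x0] := leP 0 x.
      by rewrite -psiE// (ger0_norm x0) lerDl.
    by rewrite -psiE// (ltr0_norm x0) lerDr.
rewrite ge0_integralD//=.
- by rewrite E2 mulr2n mulrDl mul1r EFinD leeD.
- by move=> x _; rewrite lee_fin.
- exact/measurable_EFinP.
- by move=> x _; rewrite lee_fin.
- by apply/measurable_EFinP; exact: measurableT_comp.
Qed.
End power.

(** * From the real axis to the line Im z = -1 *)

Section line.
Context {R : realType}.
Notation C := (R[i]^o).
Notation mu := (@lebesgue_measure R).

Lemma normc_sq (x y : R) : normc (x +i* y) ^+ 2 = x ^+ 2 + y ^+ 2.
Proof. by rewrite /normc sqr_sqrtr// addr_ge0// sqr_ge0. Qed.

Lemma normc_le_sq (z w : R[i]) : normc z ^+ 2 <= normc w ^+ 2 -> normc z <= normc w.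
Proof. by rewrite ler_pXn2r// nnegrE normc_ge0. Qed.

Lemma normcX (z : R[i]) n : normc (z ^+ n) = normc z ^+ n.
Proof. by elim: n => [|n IH]; rewrite ?expr0 ?normc1// !exprS normcM IH. Qed.

Definition expgrowth (k : R) (f : C -> C) :=
  exists r0 : R, forall z : C, r0 <= normc z -> normc (f z) <= expR (k * normc z).

(** Squaring doubles the rate, and the extra 1 absorbs the translation by w once |z| >= 2k|w|. Only
    the threshold r0 depends on w, so the constant of [poisson_bound] is the same for all
    translates. *)
Lemma expgrowth_sq_shift (k : R) (f h : C -> C) (w : C) (s : R) : 0 <= k ->
  expgrowth k f -> `|s| = 1 ->
  (forall z : C, 0 <= complex.Im z -> normc (h z) <= normc (f (w + s%:C * z)) ^+ 2) ->
  exists r0 : R, forall z : C, 0 <= complex.Im z -> r0 <= normc z ->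
    normc (h z) <= expR ((2 * k + 1) * normc z).
Proof.
move=> k0 [r0 fr] s1 hf; exists (Num.max (r0 + normc w) (2 * k * normc w)) => z z0.
rewrite ge_max => /andP[h1 h2].
have sz : normc (s%:C * z) = normc z by rewrite normcM normcR s1 mul1r.
have a1 : r0 <= normc (w + s%:C * z).
  have := le_normcD (w + s%:C * z) (- w); rewrite addrAC subrr add0r sz normcN; lra.
have a2 : normc (w + s%:C * z) <= normc w + normc z by rewrite -sz le_normcD.
rewrite (le_trans (hf _ z0))// (le_trans (_ : _ <= expR (k * normc (w + s%:C * z)) ^+ 2))//.
  by rewrite ler_pXn2r ?nnegrE ?normc_ge0 ?expR_ge0// fr.
rewrite -expRM_natl ler_expR.
have : k * normc (w + s%:C * z) <= k * (normc w + normc z) by rewrite ler_wpM2l.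
lra.
Qed.

(** The squared modulus of (s / (s + i))^m at real s. *)
Definition rho (m : nat) (s : R) : R := (s ^+ 2 / (1 + s ^+ 2)) ^+ m.

Lemma oneDsq_gt0 (s : R) : 0 < 1 + s ^+ 2.
Proof. by rewrite ltr_pwDl// sqr_ge0. Qed.

Lemma rho_ge0 m s : 0 <= rho m s.
Proof. by rewrite exprn_ge0// divr_ge0 ?sqr_ge0// ltW// oneDsq_gt0. Qed.

(** Passes from the Poisson density centred at t to the one centred at 0, at the cost of a factor of
    order 1 + t^2. *)
Lemma peetre (t s : R) : 1 + s ^+ 2 <= 2 * (1 + t ^+ 2) * (1 + (t - s) ^+ 2).
Proof.
have := sqr_ge0 (t + (t - s)); have := mulr_ge0 (sqr_ge0 t) (sqr_ge0 (t - s)).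
have := sqr_ge0 (2 * t - s).
rewrite !expr2; nra.
Qed.

(** For |s| <= 1 the zero of order 2m of [rho] beats |s|^(2b+1); for |s| > 1 one has [rho] <= 1 and
    s^-2 <= |s|^(2b+1). At s = 0 the left side is 0 since m > 0, whatever value [powR] takes
    there. *)
Lemma rho_weight m b s : (0 < m)%N -> -1 <= b -> 2 * b + 1 <= (2 * m)%:R ->
  rho m s / (1 + s ^+ 2) <= `|s| `^ (2 * b + 1).
Proof.
move=> m0 b1 bm; have [->|s0] := eqVneq s 0.
  by rewrite /rho [0 ^+ 2]expr2 mulr0 mul0r expr0n gtn_eqF// mul0r powR_ge0.
have s0' : 0 < `|s| by rewrite normr_gt0.
have s2 : s ^+ 2 = `|s| ^+ 2 by rewrite real_normK// num_real.
have h0 := oneDsq_gt0 s.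
have [s1|s1] := leP `|s| 1.
  apply: (@le_trans _ _ (`|s| `^ (2 * m)%:R)).
    rewrite powR_mulrn// exprM -s2 ler_pdivrMr//.
    rewrite (@le_trans _ _ ((s ^+ 2) ^+ m))//.
      rewrite /rho ler_pXn2r ?nnegrE ?divr_ge0 ?sqr_ge0 ?(ltW h0)//.
      by rewrite ler_pdivrMr// ler_peMr ?sqr_ge0// ?lerDl ?sqr_ge0.
    by apply: ler_peMr; [exact: exprn_ge0 (sqr_ge0 s)|rewrite lerDl sqr_ge0].
  by apply: ger_powR => //; rewrite s0' s1.
apply: (@le_trans _ _ (`|s| `^ (- 2%:R))); last by apply: ler_powR => //; [exact: ltW|lra].
rewrite powRN powR_mulrn// -s2.
rewrite (@le_trans _ _ (1 + s ^+ 2)^-1)//.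
  rewrite ler_piMl ?invr_ge0 ?(ltW h0)// exprn_ile1// ?divr_ge0 ?sqr_ge0 ?(ltW h0)//.
  by rewrite ler_pdivrMr// mul1r lerDr.
by rewrite lef_pV2 ?posrE// ?lerDr// exprn_even_gt0.
Qed.

(* The Poisson majorization is applied to (f(t - z) ((z - t) / (z - t + i))^m)^2;
   the second factor absorbs the weight |s|^(2b+1) at its zero s = 0. *)
Lemma line_shifted_bound (k b : R) (m : nat) (f : C -> C) (t : R) : 0 <= k -> (0 < m)%N ->
  -1 <= b ->
  2 * b + 1 <= (2 * m)%:R ->
  (forall z : C, differentiable f z) -> expgrowth k f ->
  ((normc (f (t -i* 1)) ^+ 2)%:E <=
    (4 ^+ m * (4 * expR (4 * (2 * k + 1))) * (2 * (1 + t ^+ 2)))%:E *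
    \int[mu]_s (normc (f (s +i* 0)) ^+ 2 * `|s| `^ (2 * b + 1))%:E)%E.
Proof.
move=> k0 m0 b1 bm df fk.
pose q (z : C) : C := (z - t%:C) * (z - t%:C + 'i)^-1.
have qD (z : C) : 0 <= complex.Im z -> z - t%:C + 'i != 0.
  case: z => x y /= y0; rewrite (_ : _ + 'i = (x - t) +i* (y + 1)); last by simpc.
  by apply/eqP => -[_ /eqP]; rewrite gt_eqF// ltr_wpDl.
pose h (z : C) : C := (f (t%:C + (-1)%:C * z) * q z ^+ m) ^+ 2.
have dh (z : C) : 0 <= complex.Im z -> differentiable h z.
  move=> z0; apply: cdiffX; apply: cdiffM.
    apply: (@differentiable_comp _ _ _ _ (fun z : C => t%:C + (-1)%:C * z : C) f); last exact: df.
    by apply: cdiffD; [exact: cdiff_cst|apply: cdiffM; [exact: cdiff_cst|exact: cdiff_id]].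
  apply: cdiffX; apply: cdiffM; first by apply: cdiffB; [exact: cdiff_id|exact: cdiff_cst].
  apply: (@cdiffV _ _ (fun z : C => z - t%:C + 'i : C)); last exact: qD.
  by apply: cdiffD; [apply: cdiffB; [exact: cdiff_id|exact: cdiff_cst]|exact: cdiff_cst].
have q1 (z : C) : 0 <= complex.Im z -> normc (q z) <= 1.
  move=> z0; rewrite /q normcM normcV ler_pdivrMr ?mul1r.
    apply: normc_le_sq; case: z z0 => x y; rewrite [complex.Im _]/= => y0.
    rewrite (_ : x +i* y - _ = (x - t) +i* y); last by simpc.
    rewrite (_ : _ + 'i = (x - t) +i* (y + 1)); last by simpc.
    rewrite !normc_sq lerD2l; nra.
  by rewrite lt_neqAle normc_ge0 andbT eq_sym; apply: contra (qD z z0) => /eqP/eq0_normc/eqP.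
have [r0 hr] : exists r0 : R, forall z : C, 0 <= complex.Im z -> r0 <= normc z ->
    normc (h z) <= expR ((2 * k + 1) * normc z).
  apply: (@expgrowth_sq_shift k f h t%:C (-1)) => //; first by rewrite normrN normr1.
  move=> z z0; rewrite /h normcX ler_pXn2r ?nnegrE ?normc_ge0//.
  by rewrite normcM ler_piMr ?normc_ge0// normcX exprn_ile1 ?normc_ge0// q1.
have k0' : 0 <= 2 * k + 1 by lra.
have := poisson_bound k0' dh hr.
(* At z = i the rational factor has squared modulus (t^2 + 1)/(t^2 + 4), at least 1/4: this is the
   origin of 4 ^+ m. *)
have hi : normc (f (t -i* 1)) ^+ 2 / 4 ^+ m <= normc (h 'i).
  rewrite /h normcX normcM exprMn.
  rewrite (_ : t%:C + _ = t -i* 1); last by simpc.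
  rewrite ler_wpM2l ?exprn_ge0 ?normc_ge0// normcX -exprM mulnC exprM -exprVn.
  rewrite ler_pXn2r ?nnegrE ?invr_ge0 ?exprn_ge0 ?normc_ge0//.
  rewrite /q normcM normcV exprMn exprVn.
  rewrite (_ : 'i - _ = (- t) +i* 1); last by simpc.
  rewrite (_ : _ + 'i = (- t) +i* 2); last by simpc.
  rewrite !normc_sq sqrrN expr1n.
  rewrite ler_pdivlMr; last by rewrite ltr_wpDl ?sqr_ge0// exprn_gt0.
  have := sqr_ge0 t; rewrite [2 ^+ 2]expr2; lra.
have hu (u : R) : normc (h (u +i* 0)) = normc (f ((t - u) +i* 0)) ^+ 2 * rho m (t - u).
  rewrite /h normcX normcM exprMn.
  rewrite (_ : t%:C + _ = (t - u) +i* 0); last by simpc.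
  congr (_ * _); rewrite normcX -exprM mulnC exprM; congr (_ ^+ _).
  rewrite /q normcM normcV exprMn exprVn.
  rewrite (_ : _ - _ = (u - t) +i* 0); last by simpc.
  rewrite (_ : _ + 'i = (u - t) +i* 1); last by simpc.
  by rewrite !normc_sq expr0n/= addr0 expr1n -(sqrrN (u - t)) opprB [_ + 1]addrC.
pose G (s : R) : R := normc (f (s +i* 0)) ^+ 2 * rho m s / (1 + (t - s) ^+ 2).
have mf : measurable_fun setT (fun s : R => normc (f (s +i* 0)) ^+ 2).
  apply: measurable_funX; apply: continuous_measurable_fun.
  by apply: normc_hor_continuous => x; exact: df.
have mV (g : R -> R) : (forall x, 0 < g x) -> continuous g ->
    measurable_fun setT (fun x => (g x)^-1).
  move=> g0 cg; apply: continuous_measurable_fun => x.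
  by apply: cvgV; [rewrite gt_eqF|exact: cg].
have cp (g : R -> R) : continuous g -> continuous (fun x => 1 + g x ^+ 2).
  move=> cg x; apply: cvgD; first exact: cvg_cst.
  exact: (cvg_comp _ _ (cg x) (@exprn_continuous R 2 (g x))).
have mG : measurable_fun setT G.
  apply: measurable_funM.
    apply: measurable_funM => //; apply: measurable_funX; apply: measurable_funM.
      exact: exprn_measurable.
    by apply: mV => [x|]; [exact: oneDsq_gt0|apply: cp => x; exact: cvg_id].
  apply: mV => [x|]; first exact: oneDsq_gt0.
  by apply: cp => x; apply: cvgB; [exact: cvg_cst|exact: cvg_id].
have G0 s : 0 <= G s.
  by rewrite divr_ge0 ?(ltW (oneDsq_gt0 _))// mulr_ge0 ?rho_ge0// exprn_ge0 ?normc_ge0.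
have Gw s : G s <= 2 * (1 + t ^+ 2) * (normc (f (s +i* 0)) ^+ 2 * `|s| `^ (2 * b + 1)).
  rewrite /G -mulrA [leRHS]mulrCA ler_wpM2l ?exprn_ge0 ?normc_ge0//.
  apply: (@le_trans _ _ (2 * (1 + t ^+ 2) * (rho m s / (1 + s ^+ 2)))).
    rewrite mulrCA ler_wpM2l ?rho_ge0//.
    rewrite ler_pdivlMr ?oneDsq_gt0// mulrC ler_pdivrMr ?oneDsq_gt0//.
    exact: peetre.
  by rewrite ler_wpM2l ?rho_weight// mulr_ge0// ltW// oneDsq_gt0.
have -> : (\int[mu]_u (normc (h (u +i* 0)) / (1 + u ^+ 2))%:E = \int[mu]_s (G s)%:E)%E.
  rewrite [RHS](@ge0_integral_aff _ (-1) t (fun s => (G s)%:E)) ?oppr_eq0 ?oner_eq0//.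
  - rewrite normrN normr1 mul1e; apply: eq_integral => u _.
    by rewrite hu /G mulN1r [- u + t]addrC (_ : t - (t - u) = u)//; ring.
  - exact/measurable_EFinP.
clearbody G; move: hi; clear hu hr dh qD q1; move: (normc (h 'i)) => H hi HG.
have A0 : 0 <= 4 * expR (4 * (2 * k + 1)) by rewrite mulr_ge0// expR_ge0.
apply: (@le_trans _ _ (4 ^+ m * H)%:E).
  by rewrite lee_fin mulrC -ler_pdivrMr// exprn_gt0.
rewrite EFinM (le_trans (lee_wpmul2l _ HG)) ?lee_fin ?exprn_ge0//.
rewrite muleA -EFinM [in leRHS]EFinM -muleA lee_wpmul2l ?lee_fin ?mulr_ge0 ?exprn_ge0 //.
rewrite -ge0_integralZl//=.
- apply: ge0_le_integral => //.
  + by move=> s _; rewrite lee_fin.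
  + exact/measurable_EFinP.
  + apply/measurable_EFinP; apply: measurable_funM => //; apply: measurable_funM => //.
    exact: measurable_abspowR.
  + by move=> s _; rewrite -EFinM lee_fin.
- apply/measurable_EFinP; apply: measurable_funM => //; exact: measurable_abspowR.
- by move=> s _; rewrite lee_fin mulr_ge0 ?powR_ge0// exprn_ge0 ?normc_ge0.
- by rewrite lee_fin mulr_ge0// ltW// oneDsq_gt0.
Qed.
End line.

Section line_bounds.
Context {R : realType}.
Notation C := (R[i]^o).
Notation mu := (@lebesgue_measure R).

Lemma cauchy_density_integral :
  exists2 P : R, 0 < P & (\int[mu]_t (1 + t ^+ 2)^-1%:E <= P%:E)%E.
Proof.
have E (t : R) : (1 + t ^+ 2)^-1 = (oneDsqr t)^-1 by [].
exists pi; first exact: pi_gt0.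
under eq_integral do rewrite E.
rewrite ge0_symfun_integralT.
- rewrite (_ : [set x : R | 0 <= x] = `[0, +oo[%classic); last first.
    by apply/seteqP; split => x; rewrite /= in_itv/= andbT.
  by rewrite integral0y_oneDsqr -EFinM lee_fin mulrCA mulfV// mulr1.
- by move=> x; rewrite invr_ge0 ltW// oneDsq_gt0.
- exact: continuous_oneDsqrV.
- by move=> x; rewrite /oneDsqr /= sqrrN.
Qed.

(** The way back to the real axis: Poisson for (f(x - i + z)/(z + i))^2, whose value at i is
    f(x)^2/(2i)^2. The divisor z + i compensates the growth B(1 + t^2) on the line Im z = -1, so the
    boundary values are at most 4B by [peetre], and only the total mass of the Cauchy density
    remains. *)
Lemma line_point_bound (k B : R) (f : C -> C) (x : R) : 0 <= k -> 0 <= B -> `|x| <= 1 ->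
  (forall z : C, differentiable f z) -> expgrowth k f ->
  (forall t : R, normc (f (t -i* 1)) ^+ 2 <= B * (1 + t ^+ 2)) ->
  ((normc (f (x +i* 0)) ^+ 2)%:E <=
   (4 * (4 * expR (4 * (2 * k + 1))) * (4 * B))%:E * \int[mu]_t (1 + t ^+ 2)^-1%:E)%E.
Proof.
move=> k0 B0 x1 df fk fB.
have qD (z : C) : 0 <= complex.Im z -> z + 'i != 0.
  case: z => u y /= y0; rewrite (_ : _ + 'i = u +i* (y + 1)); last by simpc.
  by apply/eqP => -[_ /eqP]; rewrite gt_eqF// ltr_wpDl.
pose h (z : C) : C := (f (x -i* 1 + 1%:C * z) * (z + 'i)^-1) ^+ 2.
have dh (z : C) : 0 <= complex.Im z -> differentiable h z.
  move=> z0; apply: cdiffX; apply: cdiffM.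
    apply: (@differentiable_comp _ _ _ _ (fun z : C => x -i* 1 + 1%:C * z : C) f); last exact: df.
    by apply: cdiffD; [exact: cdiff_cst|apply: cdiffM; [exact: cdiff_cst|exact: cdiff_id]].
  apply: (@cdiffV _ _ (fun z : C => z + 'i : C)); last exact: qD.
  by apply: cdiffD; [exact: cdiff_id|exact: cdiff_cst].
have q1 (z : C) : 0 <= complex.Im z -> normc ((z + 'i)^-1) <= 1.
  move=> z0; rewrite normcV invf_le1.
    rewrite -normci; apply: normc_le_sq; case: z z0 => u y; rewrite [complex.Im _]/= => y0.
    rewrite (_ : _ + 'i = u +i* (y + 1)); last by simpc.
    rewrite normci normc_sq expr1n; have := sqr_ge0 u; nra.
  by rewrite lt_neqAle normc_ge0 andbT eq_sym; apply: contra (qD z z0) => /eqP/eq0_normc/eqP.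
have [r0 hr] : exists r0 : R, forall z : C, 0 <= complex.Im z -> r0 <= normc z ->
    normc (h z) <= expR ((2 * k + 1) * normc z).
  apply: (@expgrowth_sq_shift _ k f h (x -i* 1) 1) => //; first by rewrite normr1.
  move=> z z0; rewrite /h normcX ler_pXn2r ?nnegrE ?normc_ge0//.
  by rewrite normcM ler_piMr ?normc_ge0// q1.
have k0' : 0 <= 2 * k + 1 by lra.
have := poisson_bound k0' dh hr.
have hi : normc (f (x +i* 0)) ^+ 2 = 4 * normc (h 'i).
  rewrite /h normcX normcM exprMn.
  rewrite (_ : x -i* 1 + _ = x +i* 0); last by simpc; rewrite addrC subrr.
  rewrite (_ : _ + 'i = 0 +i* 2); last by simpc.
  rewrite normcV exprVn normc_sq expr0n add0r [2 ^+ 2]expr2 -natrM.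
  by rewrite mulrC mulfVK.
have hu (u : R) : normc (h (u +i* 0)) <= 4 * B.
  rewrite /h normcX normcM exprMn.
  rewrite (_ : x -i* 1 + _ = (x + u) -i* 1); last by simpc.
  rewrite normcV exprVn (_ : _ + 'i = u +i* 1); last by simpc.
  rewrite normc_sq expr1n ler_pdivrMr; last by rewrite addrC oneDsq_gt0.
  rewrite (le_trans (fB _))// (_ : _ * (u ^+ 2 + 1) = B * (4 * (1 + u ^+ 2))); last by ring.
  rewrite ler_wpM2l//.
  have x2 : x ^+ 2 <= 1 by rewrite -real_normK ?num_real// exprn_ile1.
  have := peetre x (x + u); rewrite (_ : x - (x + u) = - u); last by ring.
  rewrite sqrrN => /le_trans; apply; rewrite ler_wpM2r ?(ltW (oneDsq_gt0 _))//; lra.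
have mV : measurable_fun setT (fun t : R => (1 + t ^+ 2)^-1).
  by apply: continuous_measurable_fun => t; exact: continuous_oneDsqrV.
have V0 (t : R) : 0 <= (1 + t ^+ 2)^-1 by rewrite invr_ge0 ltW// oneDsq_gt0.
have mh : measurable_fun setT (fun t : R => normc (h (t +i* 0))).
  apply: continuous_measurable_fun; apply: normc_hor_continuous => t.
  exact: (dh (t +i* 0) (lexx 0)).
clear hr q1 qD; clearbody h => H.
have A0 : 0 <= 4 * expR (4 * (2 * k + 1)) by rewrite mulr_ge0// expR_ge0.
move: A0 H; move: (4 * expR _) => A A0 H.
rewrite hi [leLHS]EFinM -mulrA [X in (_ <= X * _)%E]EFinM -muleA lee_wpmul2l ?lee_fin//.
apply: (le_trans H); rewrite [X in (_ <= X * _)%E]EFinM -muleA lee_wpmul2l ?lee_fin//.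
rewrite -ge0_integralZl//=.
- apply: ge0_le_integral => //.
  + by move=> t _; rewrite lee_fin divr_ge0 ?normc_ge0// ltW// oneDsq_gt0.
  + by apply/measurable_EFinP; exact: measurable_funM.
  + by apply/measurable_EFinP; exact: measurable_funM.
  + by move=> t _; rewrite -EFinM lee_fin ler_wpM2r.
- exact/measurable_EFinP.
- by move=> t _; rewrite lee_fin.
- by rewrite lee_fin mulr_ge0.
Qed.

(** The order m of the zero is chosen from b1, hence serves all b in [-1, b1], and the constant is
    uniform in b. *)
Lemma line_sup (b1 k : R) : 0 <= k -> exists2 C0 : R, 0 < C0 &
  forall b, -1 <= b -> b <= b1 -> forall f : C -> C,
  (forall z : C, differentiable f z) -> expgrowth k f -> forall x, `|x| <= 1 ->
  ((normc (f (x +i* 0)) ^+ 2)%:E <=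
   C0%:E * \int[mu]_s (normc (f (s +i* 0)) ^+ 2 * `|s| `^ (2 * b + 1))%:E)%E.
Proof.
move=> k0; have [m m0 hm] : exists2 m, (0 < m)%N & 2 * b1 + 1 <= m%:R.
  exists (Num.bound (`|2 * b1 + 1|)).+1 => //.
  rewrite (le_trans (ler_norm _))// (le_trans (ltW (archi_boundP _)))//.
  by rewrite ler_nat.
have M0 : 0 < 4 ^+ m :> R by rewrite exprn_gt0.
have [P P0 hP] := cauchy_density_integral.
have [A AE] : exists A, A = 4 * expR (4 * (2 * k + 1)) by eexists.
have A0 : 0 < A by rewrite AE mulr_gt0// expR_gt0.
exists (4 * A * (4 * (4 ^+ m * A * 2)) * P).
  by rewrite !mulr_gt0.
move=> b b_ge b_le f df fk x x1.
set N := (X in (_ <= _ * X)%E).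
have N0 : (0 <= N)%E.
  by apply: integral_ge0 => s _; rewrite lee_fin mulr_ge0 ?powR_ge0// exprn_ge0 ?normc_ge0.
have bm : 2 * b + 1 <= (2 * m)%:R.
  have : 2 * b + 1 <= 2 * b1 + 1 by lra.
  have : m%:R <= (2 * m)%:R :> R by rewrite ler_nat leq_pmull.
  lra.
have : forall t, ((normc (f (t -i* 1)) ^+ 2)%:E <= (4 ^+ m * A * (2 * (1 + t ^+ 2)))%:E * N)%E.
  by move=> t; rewrite AE; exact: line_shifted_bound.
case: N N0 => [N| |]//; last first.
  by move=> _ _; rewrite gt0_muley ?leey// lte_fin !mulr_gt0.
rewrite lee_fin => N0 s1.
have B0 : 0 <= 4 ^+ m * A * 2 * N by rewrite !mulr_ge0// ltW.
have st2 := @line_point_bound k _ f x k0 B0 x1 df fk; rewrite -AE in st2.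
apply: (le_trans (st2 _)).
  move=> t; have := s1 t; rewrite -EFinM lee_fin => /le_trans; apply.
  by rewrite le_eqVlt; apply/orP; left; apply/eqP; ring.
apply: (le_trans (lee_wpmul2l _ hP)).
  by rewrite lee_fin !mulr_ge0// ltW.
rewrite -EFinM -EFinM lee_fin le_eqVlt; apply/orP; left; apply/eqP; ring.
Qed.

(** On [-1, 1] the supremum bound is integrated against |s|^(2g+1), which is integrable because g >
    -1; outside, the weight increases with its exponent. This gives the two summands of the
    constant. *)
Lemma line_bound (g b1 k : R) : -1 < g -> 0 <= k -> exists2 C0 : R, 0 < C0 &
  forall b, g <= b -> b <= b1 -> forall f : C -> C,
  (forall z : C, differentiable f z) -> expgrowth k f ->
  (\int[mu]_s (normc (f (s +i* 0)) ^+ 2 * `|s| `^ (2 * g + 1))%:E <=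
   C0%:E * \int[mu]_s (normc (f (s +i* 0)) ^+ 2 * `|s| `^ (2 * b + 1))%:E)%E.
Proof.
move=> g1 k0; have [C1 C10 hC1] := line_sup b1 k0.
have [|C2 C20 hC2] := @integral_abspowR_unit R (2 * g + 1); first by lra.
exists (C1 * C2 + 1); first by rewrite ltr_wpDl// mulr_ge0// ltW.
move=> b gb bb f df fk.
set N := (X in (_ <= _ * X)%E).
have N0 : (0 <= N)%E.
  by apply: integral_ge0 => s _; rewrite lee_fin mulr_ge0 ?powR_ge0// exprn_ge0 ?normc_ge0.
have b_ge : -1 <= b by lra.
have : forall x, `|x| <= 1 -> ((normc (f (x +i* 0)) ^+ 2)%:E <= C1%:E * N)%E.
  exact: hC1.
have := erefl N; rewrite {1}/N; case: N N0 => [N| |]//; last first.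
  by move=> _ _ _; rewrite gt0_muley ?leey// lte_fin ltr_wpDl// mulr_ge0// ltW.
rewrite lee_fin => N0 EN fx.
have mf : measurable_fun setT (fun s : R => normc (f (s +i* 0)) ^+ 2).
  apply: measurable_funX; apply: continuous_measurable_fun.
  by apply: normc_hor_continuous => x; exact: df.
have mfp (p : R) : measurable_fun setT (fun s : R => normc (f (s +i* 0)) ^+ 2 * `|s| `^ p).
  by apply: measurable_funM => //; exact: measurable_abspowR.
have mD : measurable [set s : R | `|s| <= 1] := @measurable_abs_le R 1.
rewrite -(setUv [set s : R | `|s| <= 1]) ge0_integral_setU//=; last 4 first.
- exact: measurableC.
- by rewrite setUv; apply/measurable_EFinP; exact: mfp.
- by move=> s _; rewrite lee_fin mulr_ge0 ?powR_ge0// exprn_ge0 ?normc_ge0.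
- exact/disj_setPCl.
rewrite (_ : ((C1 * C2 + 1)%:E * N%:E = (C1 * C2 * N)%:E + N%:E)%E); last first.
  by rewrite -EFinM mulrDl mul1r EFinD.
rewrite leeD//.
  apply: (@le_trans _ _ (\int[mu]_(s in [set s : R | (`|s| <= 1)%R]) ((C1 * N)%:E * (`|s| `^ (2 *
    g + 1))%:E))%E).
    apply: ge0_le_integral => //.
    - by move=> s _; rewrite lee_fin mulr_ge0 ?powR_ge0// exprn_ge0 ?normc_ge0.
    - by apply: measurable_funTS; apply/measurable_EFinP; exact: mfp.
    - apply: measurable_funTS; apply/measurable_EFinP; apply: measurable_funM => //.
      exact: measurable_abspowR.
    - move=> s /= s1; rewrite -EFinM lee_fin ler_wpM2r ?powR_ge0//.
      by have := fx s s1; rewrite -EFinM lee_fin.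
  rewrite ge0_integralZl//=.
  - rewrite mulrAC [in leRHS]EFinM lee_wpmul2l// lee_fin mulr_ge0// ltW//.
  - by apply: measurable_funTS; apply/measurable_EFinP; exact: measurable_abspowR.
  - by rewrite lee_fin mulr_ge0// ltW.
rewrite -EN; apply: (@le_trans _ _ (\int[mu]_(s in ~` [set s : R | (`|s| <= 1)%R]) (normc (f (s
  +i* 0)) ^+ 2 * `|s| `^ (2 * b + 1))%:E)%E).
  apply: ge0_le_integral => //.
  - exact: measurableC.
  - by move=> s _; rewrite lee_fin mulr_ge0 ?powR_ge0// exprn_ge0 ?normc_ge0.
  - by apply: measurable_funTS; apply/measurable_EFinP; exact: mfp.
  - by apply: measurable_funTS; apply/measurable_EFinP; exact: mfp.
  - move=> s /= /negP; rewrite -ltNge => s1.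
    rewrite lee_fin ler_wpM2l ?exprn_ge0 ?normc_ge0//.
    by apply: ler_powR; [exact: ltW|lra].
apply: ge0_subset_integral => //.
- exact: measurableC.
- apply/measurable_EFinP; exact: mfp.
- by move=> s _; rewrite lee_fin mulr_ge0 ?powR_ge0// exprn_ge0 ?normc_ge0.
Qed.
End line_bounds.

(** * The weighted bound in R^n *)

Section Rn_measure.
Context {R : realType}.
Notation mu := (@lebesgue_measure R).

(** f is the pointwise limit of its values at the corners of grids of mesh 1/(k+1). Each
    approximation is constant on countably many boxes, which are measurable coordinate by
    coordinate. *)
Lemma measurable_tuple_continuous n (f : Rn R n -> R) :
  (forall x e, 0 < e -> exists2 d : R, 0 < d &
     forall y : Rn R n, (forall i, `|tnth y i - tnth x i| < d) -> `|f y - f x| < e) ->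
  measurable_fun setT f.
Proof.
move=> cf.
pose fl k (x : Rn R n) : n.-tuple int := [tuple Num.floor (k.+1%:R * tnth x i) | i < n].
pose bk k (v : n.-tuple int) : Rn R n := [tuple ((tnth v i)%:~R / k.+1%:R : measurableTypeR R) | i
  < n].
apply: (@measurable_fun_cvg _ _ _ setT (fun k x => f (bk k (fl k x)))).
  move=> k _ Y mY; rewrite setTI.
  have mfl (v : n.-tuple int) : measurable (fl k @^-1` [set v]).
    rewrite (_ : _ @^-1` _ = \bigcap_(i in [set: 'I_n]) (fun x : Rn R n => tnth x i) @^-1`
        (`[((tnth v i)%:~R / k.+1%:R), ((tnth v i + 1)%:~R / k.+1%:R : R)[%classic)).
      apply: fin_bigcap_measurable => // i _.
      rewrite -[X in measurable X]setTI; apply: measurable_tnth => //.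
    have E (x : Rn R n) i : (Num.floor (k.+1%:R * tnth x i) == tnth v i) =
        (tnth x i \in `[((tnth v i)%:~R / k.+1%:R), ((tnth v i + 1)%:~R / k.+1%:R)[).
      rewrite in_itv/= ler_pdivrMr// ltr_pdivlMr// mulrC.
      by rewrite floor_eq.
    apply/seteqP; split => x /=.
      move=> vE i _; have := E x i; rewrite -{1}vE tnth_mktuple eqxx => /esym.
      exact.
    move=> H; apply: eq_from_tnth => i; rewrite /fl tnth_mktuple.
    by apply/eqP; rewrite E; exact: (H i I).
  rewrite (_ : _ @^-1` _ = \bigcup_v (if `[< Y (f (bk k v)) >] then fl k @^-1` [set v] else set0)).
    apply: countable_bigcupT_measurable => [|v]; first exact: countableP.
    by case: ifP => _; [exact: mfl|exact: measurable0].
  apply/seteqP; split => x /=.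
    by move=> Yx; exists (fl k x) => //; rewrite asboolT.
  by move=> [v _]; case: ifPn => // /asboolP Yv /= ->.
move=> x _; apply/cvgrPdist_lt => e e0; have [d d0 dP] := cf x e e0.
exists (Num.bound d^-1) => // k /= kd; rewrite distrC; apply: dP => i.
rewrite !tnth_mktuple distrC.
have k0 : 0 < k.+1%:R :> R by [].
have kd' : k.+1%:R^-1 < d.
  rewrite invf_plt ?posrE// (lt_le_trans (archi_boundP _)) ?invr_ge0 ?(ltW d0)//.
  by rewrite ler_nat (leq_trans kd).
have /andP[f1 f2] := floor_itv (k.+1%:R * tnth x i).
rewrite (le_lt_trans _ kd')// ger0_norm.
  move: f2; set F := Num.Def.floor _; rewrite intrD => /ltW F2.
  rewrite lerBlDr (_ : _ + _ = (F%:~R + 1) / k.+1%:R); last by rewrite mulrDl mul1r addrC.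
  by rewrite ler_pdivlMr// mulrC.
by rewrite subr_ge0 ler_pdivrMr// [leRHS]mulrC.
Qed.

Definition scaleT n (c : R) (x : Rn R n) : Rn R n :=
  [tuple (c * tnth x i : measurableTypeR R) | i < n].

Lemma measurable_scaleT n c : measurable_fun setT (@scaleT n c).
Proof.
apply/measurable_fun_tnthP => i.
rewrite (_ : _ \o _ = (fun y => c * y) \o (fun x : Rn R n => tnth x i)).
  apply: measurableT_comp; first exact: mulrl_measurable.
  exact: measurable_tnth.
by apply/funext => x; rewrite /= tnth_mktuple.
Qed.

Lemma measurable_scaleT2 n :
  measurable_fun setT (fun p : measurableTypeR R * Rn R n => scaleT p.1 p.2).
Proof.
apply/measurable_fun_tnthP => i.
rewrite (_ : _ \o _ = (fun p : measurableTypeR R * Rn R n => p.1 * tnth p.2 i)).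
  apply: measurable_funM => //.
  exact: (measurableT_comp (@measurable_tnth _ _ n i) measurable_snd).
by apply/funext => x; rewrite /= tnth_mktuple.
Qed.

Lemma measurable_enorm n : measurable_fun setT (@enorm R n).
Proof.
apply: (@measurableT_comp _ _ _ _ _ _ (@Num.sqrt R) _ (fun x : Rn R n =>
  \sum_(i < n) tnth x i ^+ 2)).
  by apply: continuous_measurable_fun; exact: sqrt_continuous.
apply: measurable_sum => i; apply: measurable_funX; exact: measurable_tnth.
Qed.

Lemma measurable_tcons n : measurable_fun setT (@tcons R n).
Proof. exact: measurable_funP. Qed.

Lemma measurable_comp_tcons n (f : Rn R n.+1 -> \bar R) :
  measurable_fun setT f -> measurable_fun setT (f \o @tcons R n).
Proof. by move=> mf; apply: (measurableT_comp mf); exact: measurable_tcons. Qed.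

Lemma integral_lebesgue_RnS n (f : Rn R n.+1 -> \bar R) :
  measurable_fun setT f -> (forall x, 0 <= f x)%E ->
  (\int[lebesgue_Rn n.+1]_x f x = \int[mu]_a \int[lebesgue_Rn n]_t f (tcons (a, t)))%E.
Proof.
move=> mf f0; rewrite /= /lebesgue_step ge0_integral_pushforward//=.
rewrite preimage_setT.
exact: (fubini_tonelli1 _ (measurable_comp_tcons mf) (fun p => f0 (tcons p))).
Qed.

Lemma ge0_integral_scaleT n (c : R) (f : Rn R n -> \bar R) : c != 0 ->
  measurable_fun setT f -> (forall x, 0 <= f x)%E ->
  (\int[lebesgue_Rn n]_x f x = (`|c| ^+ n)%:E * \int[lebesgue_Rn n]_x f (scaleT c x))%E.
Proof.
move=> c0; elim: n f => [|n IH] f mf f0.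
  rewrite expr0 mul1e; apply: eq_integral => x _; congr f.
  by apply: eq_from_tnth => -[].
have mfc : measurable_fun setT (f \o @tcons R n) := measurable_comp_tcons mf.
rewrite !integral_lebesgue_RnS//; last first.
  by apply: measurableT_comp => //; exact: measurable_scaleT.
pose g (a : measurableTypeR R) := (\int[lebesgue_Rn n]_t f (tcons (a, scaleT c t)))%E.
transitivity (\int[mu]_a ((`|c| ^+ n)%:E * g a))%E.
  apply: eq_integral => a _; rewrite (IH (fun t => f (tcons (a, t))))//.
  by apply: (measurableT_comp mfc); exact: measurable_pair1.
have mg : measurable_fun setT g.
  apply: (@measurable_fun_fubini_tonelli_F _ _ _ _ _ (lebesgue_Rn n) (fun p => f (tcons (p.1,
    scaleT c p.2)))); last by move=> x; exact: f0.
  apply: (measurableT_comp mfc (g := fun p => (p.1, scaleT c p.2))).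
  apply: measurable_fun_pair => //=; apply: (measurableT_comp (@measurable_scaleT n c)).
  exact: measurable_snd.
have g0 a : (0 <= g a)%E by exact: integral_ge0.
rewrite ge0_integralZl// (@ge0_integral_aff _ c 0 g)// muleA -EFinM -exprSr.
congr (_ * _)%E; apply: eq_integral => a _; apply: eq_integral => t _; congr f.
apply: eq_from_tnth => i; rewrite tnth_mktuple addr0.
have [j ->|->] := unliftP ord0 i; first by rewrite !tnthS tnth_mktuple.
by rewrite !tnth0.
Qed.
End Rn_measure.

(** * The norm on C^n and exponential type *)

Section cnorm.
Context {R : realType}.
Notation C := (R[i]^o).

Lemma enorm_ge0 n (x : Rn R n) : 0 <= enorm x.
Proof. exact: sqrtr_ge0. Qed.

Lemma sqr_enorm n (x : Rn R n) : enorm x ^+ 2 = \sum_(i < n) tnth x i ^+ 2.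
Proof. by rewrite sqr_sqrtr// sumr_ge0// => i _; exact: sqr_ge0. Qed.

Lemma abs_tnth_le_enorm n (x : Rn R n) i : `|tnth x i| <= enorm x.
Proof.
rewrite -(ler_pXn2r (n := 2)) ?nnegrE ?enorm_ge0// sqr_enorm real_normK ?num_real//.
by rewrite (bigD1 i)//= lerDl sumr_ge0// => j _; exact: sqr_ge0.
Qed.

Lemma enorm_scaleT n c (x : Rn R n) : enorm (scaleT c x) = `|c| * enorm x.
Proof.
apply/eqP; rewrite -(eqrXn2 (n := 2)) ?enorm_ge0 ?mulr_ge0 ?enorm_ge0//.
rewrite exprMn !sqr_enorm real_normK ?num_real// mulr_sumr; apply/eqP.
by apply: eq_bigr => i _; rewrite tnth_mktuple exprMn.
Qed.

(** Cauchy-Schwarz, through 2 |x_i| |t_i| <= x_i^2/|x| + |x| t_i^2 summed over i. *)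
Lemma sum_normM_le n (x t : Rn R n) : enorm t <= 1 ->
  \sum_(i < n) `|tnth x i| * `|tnth t i| <= enorm x.
Proof.
move=> t1; have [x0|x0] := eqVneq (enorm x) 0.
  rewrite x0 big1// => i _; have := abs_tnth_le_enorm x i; rewrite x0 => h.
  have -> : `|tnth x i| = 0 by apply/eqP; rewrite eq_le h normr_ge0.
  by rewrite mul0r.
have a0 : 0 < enorm x by rewrite lt_neqAle eq_sym x0 enorm_ge0.
have h i : `|tnth x i| * `|tnth t i| <= (tnth x i ^+ 2 / enorm x + enorm x * tnth t i ^+ 2) / 2.
  rewrite -(real_normK (num_real (tnth x i))) -(real_normK (num_real (tnth t i))).
  rewrite ler_pdivlMr//.
  have : 0 <= (`|tnth x i| / enorm x - `|tnth t i|) ^+ 2 * enorm x by rewrite mulr_ge0 ?sqr_ge0//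
    ltW.
  rewrite (_ : _ * _ = `|tnth x i| ^+ 2 / enorm x + enorm x * `|tnth t i| ^+ 2 - `|tnth x i| *
    `|tnth t i| * 2).
    by rewrite subr_ge0.
  by field.
apply: (le_trans (ler_sum _ (fun i _ => h i))).
rewrite -mulr_suml big_split/= -mulr_suml -mulr_sumr -!sqr_enorm.
rewrite ler_pdivrMr// expr2 mulfK// mulr2n mulrDr mulr1 lerD2l.
by rewrite ler_piMr ?(ltW a0)// exprn_ile1// enorm_ge0.
Qed.

Definition pair (n : nat) (z : Cn R n) (t : Rn R n) : R :=
  normc (\sum_(i < n) z ord0 i * (tnth t i)%:C).

Lemma normc_sum n (F : 'I_n -> R[i]) : normc (\sum_(i < n) F i) <= \sum_(i < n) normc (F i).
Proof.
elim/big_ind2 : _ => //; first by rewrite normc0.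
by move=> z a w b za wb; rewrite (le_trans (le_normcD _ _))// lerD.
Qed.

Lemma cnorm_ub n (z : Cn R n) (t : Rn R n) : enorm t <= 1 -> pair z t <= cnorm z.
Proof.
move=> t1; apply: sup_upper_bound; last by exists t.
split; first by exists (pair z t); exists t.
exists (\sum_(i < n) normc (z ord0 i)) => _ [s s1 <-].
rewrite (le_trans (normc_sum _))// ler_sum// => i _.
rewrite normcM normcR ler_piMr ?normc_ge0// (le_trans (abs_tnth_le_enorm _ _))//.
Qed.

Definition zeroT n : Rn R n := [tuple (0 : measurableTypeR R) | i < n].

Lemma enorm_zeroT n : enorm (zeroT n) = 0.
Proof. by rewrite /enorm big1 ?sqrtr0// => i _; rewrite tnth_mktuple expr0n. Qed.

Lemma cnorm_le n (z : Cn R n) K : (forall t, enorm t <= 1 -> pair z t <= K) -> cnorm z <= K.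
Proof.
move=> H; apply: sup_le_ub; last by move=> _ [s s1 <-]; exact: H.
by exists (pair z (zeroT n)); exists (zeroT n) => //=; rewrite enorm_zeroT.
Qed.

Lemma cnorm_ge0 n (z : Cn R n) : 0 <= cnorm z.
Proof.
by apply: le_trans (@cnorm_ub n z (zeroT n) _); [exact: normc_ge0|rewrite enorm_zeroT].
Qed.

Lemma cnormD n (z w : Cn R n) : cnorm (z + w) <= cnorm z + cnorm w.
Proof.
apply: cnorm_le => t t1; rewrite (le_trans _ (lerD (cnorm_ub z t1) (cnorm_ub w t1)))//.
rewrite /pair (_ : \sum_i _ = \sum_(i < n) z ord0 i * (tnth t i)%:C + \sum_(i < n) w ord0 i *
  (tnth t i)%:C).
  exact: le_normcD.
by rewrite -big_split/=; apply: eq_bigr => i _; rewrite mxE mulrDl.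
Qed.

Lemma cnormZ n (c : R[i]) (z : Cn R n) : cnorm (c *: z) = normc c * cnorm z.
Proof.
have pZ (u : R[i]) (w : Cn R n) t : pair (u *: w) t = normc u * pair w t.
  rewrite /pair -normcM mulr_sumr; congr normc.
  by apply: eq_bigr => i _; rewrite mxE mulrA.
have H (u : R[i]) (w : Cn R n) : cnorm (u *: w) <= normc u * cnorm w.
  by apply: cnorm_le => t t1; rewrite pZ ler_wpM2l ?normc_ge0// cnorm_ub.
apply/eqP; rewrite eq_le H/=; have [->|c0] := eqVneq c 0.
  by rewrite normc0 mul0r cnorm_ge0.
rewrite -ler_pdivlMl; last first.
  by rewrite lt_neqAle normc_ge0 andbT eq_sym; apply: contra c0 => /eqP/eq0_normc/eqP.
by rewrite -normcV (le_trans _ (H _ _))// scalerA mulVf// scale1r.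
Qed.

Lemma normc_coord_le_cnorm n (z : Cn R n) i : normc (z ord0 i) <= cnorm z.
Proof.
pose t : Rn R n := [tuple ((i == j)%:R : measurableTypeR R) | j < n].
have t1 : enorm t <= 1.
  rewrite /enorm (bigD1 i)//= tnth_mktuple eqxx expr1n big1 ?addr0 ?sqrtr1// => j ji.
  by rewrite tnth_mktuple eq_sym (negPf ji) expr0n.
have := cnorm_ub z t1; rewrite /pair (bigD1 i)//= tnth_mktuple eqxx mulr1 big1 ?addr0//.
by move=> j ji; rewrite tnth_mktuple eq_sym (negPf ji) mulr0.
Qed.

Lemma cnorm_real n (x : Rn R n) : cnorm (Rn_to_Cn x) = enorm x.
Proof.
have pE t : pair (Rn_to_Cn x) t = `|\sum_(i < n) tnth x i * tnth t i|.
  rewrite /pair -normcR; congr normc; rewrite (raddf_sum (real_complex R)).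
  by apply: eq_bigr => i _; rewrite mxE -(rmorphM (real_complex R)).
apply/eqP; rewrite eq_le; apply/andP; split.
  apply: cnorm_le => t t1; rewrite pE (le_trans (ler_norm_sum _ _ _))//.
  by under eq_bigr do rewrite normrM; exact: sum_normM_le.
have [x0|x0] := eqVneq (enorm x) 0; first by rewrite x0 cnorm_ge0.
have a0 : 0 < enorm x by rewrite lt_neqAle eq_sym x0 enorm_ge0.
have t1 : enorm (scaleT (enorm x)^-1 x) <= 1.
  by rewrite enorm_scaleT gtr0_norm ?invr_gt0// mulVf.
rewrite (le_trans _ (cnorm_ub _ t1))// pE.
under eq_bigr do rewrite tnth_mktuple mulrCA -expr2.
by rewrite -mulr_sumr -sqr_enorm expr2 mulKf// gtr0_norm.
Qed.

(** The bound exp_type F <= d with the limit superior and the logarithm unfolded; the next two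
    lemmas give the equivalence. Products, dilations and restrictions to lines are read off directly
    in this form. *)
Definition growth n (d : R) (F : Cn R n -> C) := forall e : R, 0 < e ->
  exists M : R, forall z, M < cnorm z -> normc (F z) <= expR ((d + e) * cnorm z).

Lemma exp_type_growth n d (F : Cn R n -> C) : (exp_type F <= d%:E)%E -> growth d F.
Proof.
move=> tF e e0; have : (exp_type F < (d + e)%:E)%E.
  by rewrite (le_lt_trans tF)// lte_fin ltrDl.
move=> /ereal_inf_lt[_ [V [M _ MV] <-]] sV.
exists (Num.max M 0) => z; rewrite gt_max => /andP[Mz z0].
have : (((cnorm z)^-1%:E * lne (normc (F z))%:E) <= (d + e)%:E)%E.
  apply: le_trans (ltW sV); apply: ereal_sup_ubound; exists z => //.
  exact: MV.
have [->|Fz] := eqVneq (normc (F z)) 0; first by move=> _; exact: expR_ge0.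
have Fz0 : 0 < normc (F z) by rewrite lt_neqAle eq_sym Fz normc_ge0.
rewrite lne_EFin// -EFinM lee_fin ler_pdivrMl// => h.
by rewrite -[leLHS]lnK ?posrE// ler_expR mulrC.
Qed.

Lemma growth_exp_type n d (F : Cn R n -> C) : growth d F -> (exp_type F <= d%:E)%E.
Proof.
move=> gF; apply/lee_addgt0Pr => e e0; have [M FM] := gF e e0.
apply: (@le_trans _ _ (ereal_sup ((fun z => ((cnorm z)^-1%:E * lne (normc (F z))%:E)%E) @` [set z
  | Num.max M 0 < cnorm z]))).
  by apply: ereal_inf_lbound; exists [set z | Num.max M 0 < cnorm z] => //; exists (Num.max M 0).
apply: ge_ereal_sup => _ [z zM <-].
have /andP[/FM Fz z0] : (M < cnorm z) && (0 < cnorm z) by rewrite -gt_max.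
have [->|Fz0] := eqVneq (normc (F z)) 0.
  by rewrite le0_lneNy ?lexx// gt0_muleNy ?lte_fin ?invr_gt0// leNye.
have {}Fz0 : 0 < normc (F z) by rewrite lt_neqAle eq_sym Fz0 normc_ge0.
rewrite lne_EFin// -EFinM lee_fin ler_pdivrMl// mulrC.
by rewrite -ler_expR lnK.
Qed.
End cnorm.

(** * Averaging over lines through the origin *)

Section polar.
Context {R : realType}.
Notation C := (R[i]^o).
Notation mu := (@lebesgue_measure R).

Lemma measurable_entire n (F : Cn R n -> C) : entire F ->
  measurable_fun setT (fun x : Rn R n => normc (F (Rn_to_Cn x))).
Proof.
move=> dF; apply: measurable_tuple_continuous => x e e0.
have cF := differentiable_continuous (dF (Rn_to_Cn x)).
have : nbhs (F (Rn_to_Cn x)) [set w : C | normc (w - F (Rn_to_Cn x)) < e].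
  by apply/nbhsCP; exists e => // h; rewrite /= addrAC subrr add0r.
move=> /cF /nbhs_ballP[[a b] /=]; rewrite ltcE /= => /andP[/eqP -> a0] aP.
exists a => // y yx; rewrite (le_lt_trans (normc_lip _ _))//; apply: aP.
split; first by rewrite ltcE /= eqxx.
move=> i j; rewrite /ball/= !mxE normCE (_ : a +i* 0 = a%:C)// ltcR.
by rewrite -(rmorphB (real_complex R)) normcR distrC.
Qed.

Lemma enorm_eq0_set1 n : [set x : Rn R n | enorm x = 0] = [set zeroT n].
Proof.
apply/seteqP; split => x /=; last by move=> ->; exact: enorm_zeroT.
move=> x0; apply: eq_from_tnth => i; rewrite tnth_mktuple.
by apply/eqP; rewrite -normr_le0 -x0; exact: abs_tnth_le_enorm.
Qed.

Lemma lebesgue_Rn_origin n : (0 < n)%N -> lebesgue_Rn n [set x : Rn R n | enorm x = 0] = 0%E.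
Proof.
case: n => // n _.
have -> : [set x : Rn R n.+1 | enorm x = 0] =
   [set t | forall i, [set (0 : measurableTypeR R)] (tnth t i)].
  rewrite enorm_eq0_set1; apply/seteqP; split => x /=.
    by move=> -> i; rewrite tnth_mktuple.
  by move=> H; apply: eq_from_tnth => i; rewrite H tnth_mktuple.
rewrite (@lebesgue_Rn_box R n.+1 (fun=> [set 0])) => [|_]; last exact: measurable_set1.
by rewrite big_ord_recl/= lebesgue_measure_set1 mul0e.
Qed.

Lemma measurable_origin n : measurable [set x : Rn R n | enorm x = 0].
Proof.
rewrite enorm_eq0_set1 (_ : [set _] = (fun x => enorm x) @^-1` [set 0]).
  by rewrite -[X in measurable X]setTI; apply: measurable_enorm.
by rewrite -enorm_eq0_set1.
Qed.

(** [powR] takes a conventional value at 0, so weights are only compared at points with [enorm x] >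
    0; the origin is negligible in positive dimension. *)
Lemma ae_enorm_gt0 n (P : Rn R n -> Prop) : (0 < n)%N ->
  (forall x, 0 < enorm x -> P x) -> {ae lebesgue_Rn n, forall x, P x}.
Proof.
move=> n0 H; exists [set x | enorm x = 0]; split; first exact: measurable_origin.
  exact: lebesgue_Rn_origin.
move=> x /= Px; apply: contrapT => x0; apply: Px; apply: H.
by rewrite lt_neqAle enorm_ge0 andbT eq_sym; apply/eqP.
Qed.

Lemma measurable_section1 d1 d2 d3 (T1 : measurableType d1) (T2 : measurableType d2)
  (T3 : measurableType d3) (f : T1 * T2 -> T3) x :
  measurable_fun setT f -> measurable_fun setT (fun y => f (x, y)).
Proof. by move=> mf; apply: (measurableT_comp mf); exact: measurable_pair1. Qed.

(** The indicator of a <= b <= 2a. It is unchanged when a and b are multiplied by the same positive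
    number, which makes the substitution y = s x below possible. *)
Definition ring01 (a b : R) : R := if (a <= b) && (b <= 2 * a) then 1 else 0.

Lemma ring01_ge0 a b : 0 <= ring01 a b.
Proof. by rewrite /ring01; case: ifP. Qed.

Lemma measurable_ring01 d (T : measurableType d) (f g : T -> R) :
  measurable_fun setT f -> measurable_fun setT g ->
  measurable_fun setT (fun x => ring01 (f x) (g x)).
Proof.
move=> mf mg; apply: measurable_fun_ifT => //.
apply: measurable_and; apply: measurable_fun_ler => //.
exact: measurable_funM.
Qed.

(* The logarithmic length of the set of s with |s| <= r <= 2|s|. *)
Lemma shell_length (r : R) : 0 <= r ->
  (\int[mu]_s (`|s| `^ (-1) * ring01 `|s| r)%:E <= 4%:E)%E /\
  (0 < r -> (2^-1%:E <= \int[mu]_s (`|s| `^ (-1) * ring01 `|s| r)%:E)%E).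
Proof.
move=> r0.
have mi : measurable_fun setT (fun s : R => `|s| `^ (-1) * ring01 `|s| r).
  by apply: measurable_funM; [exact: measurable_abspowR|apply: measurable_ring01 => //;
    exact: normr_measurable].
have i0 s : 0 <= `|s| `^ (-1) * ring01 `|s| r by rewrite mulr_ge0 ?powR_ge0 ?ring01_ge0.
have [rpos|] := ltP 0 r; last first.
  move=> rneg; have {rneg}r0 : r = 0 by apply/eqP; rewrite eq_le rneg.
  subst r; split => //; rewrite integral0_eq ?lee_fin// => s _.
  rewrite /ring01; case: ifP => [/andP[s0 _]|]; last by rewrite mulr0.
  have -> : `|s| = 0 by apply/eqP; rewrite eq_le s0 normr_ge0.
  by rewrite powR0 ?mul0r// oppr_eq0 oner_eq0.
have E (a c : R) : a <= c -> mu `[a, c] = (c - a)%:E.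
  move=> ac; rewrite -(fine_mu_itv ac) fineK//.
  by have := lebesgue_measure_itv `[a, c]; rewrite /= => ->; case: ifP.
split=> [|_].
  rewrite (_ : 4 = (2 / r) * (r - - r)); last by field; rewrite gt_eqF.
  rewrite EFinM -E; last by lra.
  rewrite -integral_cst// integral_mkcond; apply: ge0_le_integral => //.
  - by move=> s _; rewrite lee_fin.
  - exact/measurable_EFinP.
  - by apply/(measurable_restrictT _ _).1 => //; exact: measurable_cst.
  - move=> s _; rewrite patchE mem_setE/= in_itv/= -ler_norml.
    rewrite /ring01; have [sr|sr] /= := leP `|s| r; last by rewrite mulr0.
    case: ifP => rs; last by rewrite mulr0 lee_fin divr_ge0// ltW.
    have s0 : 0 < `|s| by lra.
    rewrite mulr1 lee_fin powR_inv1// ler_pdivlMr// mulrC ler_pdivrMr//.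
apply: (@le_trans _ _ (\int[mu]_(s in `[(r / 2)%R, r]) (r^-1)%:E)%E).
  have -> : (\int[mu]_(s in `[(r / 2)%R, r]) (r^-1)%:E = (r^-1)%:E * mu `[(r / 2)%R, r])%E.
    exact: integral_cst.
  rewrite E; last by lra.
  by rewrite -EFinM lee_fin le_eqVlt; apply/orP; left; apply/eqP; field; rewrite gt_eqF.
apply: (@le_trans _ _ (\int[mu]_(s in `[(r / 2)%R, r]) (`|s| `^ (-1) * ring01 `|s| r)%:E)%E).
  apply: ge0_le_integral => //.
  - by move=> s _; rewrite lee_fin invr_ge0.
  - by apply: measurable_funTS; exact/measurable_EFinP.
  - move=> s; rewrite /= in_itv/= => /andP[s1 s2].
    have s0 : 0 < s by apply: lt_le_trans s1; rewrite divr_gt0.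
    rewrite gtr0_norm// lee_fin /ring01 s2 (_ : r <= 2 * s) ?mulr1/=; last by lra.
    by rewrite powR_inv1 ?(ltW s0)// lef_pV2.
apply: ge0_subset_integral => //.
- exact/measurable_EFinP.
- by move=> s _; rewrite lee_fin.
Qed.

Section shells.
Context (n : nat) (h : Rn R n -> R) (g : R) (n0 : (0 < n)%N)
  (mh : measurable_fun setT h) (h0 : forall x, 0 <= h x).
Let q := 2 * g + 2 - n%:R.

(* With shell_length and Fubini this is the norm of weight g up to a factor between
   1/2 and 4, although the inner integral runs over whole lines through 0. *)
Definition polar_int : \bar R :=
  (\int[lebesgue_Rn n]_x
    ((ring01 1 (enorm x) * enorm x `^ q)%:E * \int[mu]_s (h (scaleT s x) * `|s| `^ (2 * g +
      1))%:E))%E.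

Let P (s : R) (y : Rn R n) : R := (`|s| `^ (-1) * ring01 `|s| (enorm y)) * (h y * enorm y `^ q).

Let mh2 : measurable_fun setT (fun p : Rn R n * measurableTypeR R => h (scaleT p.2 p.1)).
Proof.
apply: (measurableT_comp mh).
apply: (measurableT_comp (@measurable_scaleT2 R n) (g := fun p : Rn R n * measurableTypeR R =>
  (p.2, p.1))).
by apply: measurable_fun_pair.
Qed.

Let menq (p : R) : measurable_fun setT (fun x : Rn R n => enorm x `^ p).
Proof. exact: (measurableT_comp (measurable_powR p) (@measurable_enorm R n)). Qed.

Let mP : measurable_fun setT (fun p : measurableTypeR R * Rn R n => P p.1 p.2).
Proof.
have m1 : measurable_fun setT (fun p : measurableTypeR R * Rn R n => `|p.1|).
  exact: (measurableT_comp (@normr_measurable R setT) measurable_fst).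
have m2 : measurable_fun setT (fun p : measurableTypeR R * Rn R n => enorm p.2).
  exact: (measurableT_comp (@measurable_enorm R n) measurable_snd).
apply: measurable_funM; apply: measurable_funM.
- exact: (measurableT_comp (measurable_powR _) m1).
- exact: measurable_ring01.
- exact: (measurableT_comp mh measurable_snd).
- exact: (measurableT_comp (measurable_powR _) m2).
Qed.

Let P0 s y : 0 <= P s y.
Proof. by rewrite /P !mulr_ge0 ?powR_ge0 ?ring01_ge0. Qed.

Lemma measurable_polar : measurable_fun setT (fun x : Rn R n =>
  ((ring01 1 (enorm x) * enorm x `^ q)%:E * \int[mu]_s (h (scaleT s x) * `|s| `^ (2 * g +
    1))%:E)%E).
Proof.
apply: emeasurable_funM.
  apply/measurable_EFinP; apply: measurable_funM => //.
  by apply: measurable_ring01 => //; exact: measurable_enorm.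
apply: (@measurable_fun_fubini_tonelli_F _ _ _ _ R mu
    (fun p : Rn R n * measurableTypeR R => (h (scaleT p.2 p.1) * `|p.2| `^ (2 * g + 1))%:E)).
  apply/measurable_EFinP; apply: measurable_funM => //.
  apply: (measurableT_comp (measurable_powR _)).
  exact: (measurableT_comp (@normr_measurable R setT) measurable_snd).
by move=> p; rewrite lee_fin mulr_ge0 ?powR_ge0.
Qed.

(** Fubini, the substitution y = s x for fixed s != 0, and Fubini again. The shell condition 1 <=
    |x| <= 2 turns into |s| <= |y| <= 2|s|. *)
Lemma polar_intE : (polar_int = \int[lebesgue_Rn n]_y
  ((h y * enorm y `^ q)%:E * \int[mu]_s (`|s| `^ (-1) * ring01 `|s| (enorm y))%:E))%E.
Proof.
pose Q (x : Rn R n) (s : measurableTypeR R) : R :=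
  (ring01 1 (enorm x) * enorm x `^ q) * (h (scaleT s x) * `|s| `^ (2 * g + 1)).
have Q0 x s : 0 <= Q x s by rewrite /Q !mulr_ge0 ?powR_ge0 ?ring01_ge0.
have mQ : measurable_fun setT (fun p : Rn R n * measurableTypeR R => Q p.1 p.2).
  have m2 : measurable_fun setT (fun p : Rn R n * measurableTypeR R => `|p.2|).
    exact: (measurableT_comp (@normr_measurable R setT) measurable_snd).
  have m1 : measurable_fun setT (fun p : Rn R n * measurableTypeR R => enorm p.1).
    exact: (measurableT_comp (@measurable_enorm R n) measurable_fst).
  apply: measurable_funM; apply: measurable_funM.
  - exact: measurable_ring01.
  - exact: (measurableT_comp (measurable_powR _) m1).
  - exact: mh2.
  - exact: (measurableT_comp (measurable_powR _) m2).
have QP (s : R) : s != 0 ->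
    (\int[lebesgue_Rn n]_x (Q x s)%:E = \int[lebesgue_Rn n]_y (P s y)%:E)%E.
  move=> s0; rewrite [RHS](@ge0_integral_scaleT _ _ s)//; last 2 first.
  - apply/measurable_EFinP; exact: (measurable_section1 s mP).
  - by move=> x; rewrite lee_fin.
  rewrite -ge0_integralZl//=; last 2 first.
  - apply/measurable_EFinP; apply: (measurableT_comp (measurable_section1 s mP)).
    exact: measurable_scaleT.
  - by move=> x _; rewrite lee_fin.
  apply: eq_integral => x _; rewrite -EFinM; congr _%:E.
  have sp : 0 < `|s| by rewrite normr_gt0.
  rewrite /Q /P enorm_scaleT powRM ?enorm_ge0//.
  have -> : ring01 `|s| (`|s| * enorm x) = ring01 1 (enorm x).
    by rewrite /ring01 ler_pMr// [2 * `|s|]mulrC ler_pM2l// mulr1.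
  (* 2g + 1 = n - 1 + q: the Jacobian |s|^n, the density of ds/|s|, and the homogeneity of the
     weight |y|^q. *)
  have -> : `|s| `^ (2 * g + 1) = `|s| ^+ n * `|s| `^ (-1) * `|s| `^ q.
    rewrite -powR_mulrn// -!powRD ?(gt_eqF sp) ?implybT//.
    by congr (_ `^ _); rewrite /q; ring.
  ring.
transitivity (\int[lebesgue_Rn n]_x \int[mu]_s (Q x s)%:E)%E.
  apply: eq_integral => x _; rewrite -ge0_integralZl//=.
  - apply/measurable_EFinP; apply: measurable_funM; last exact: measurable_abspowR.
    exact: (measurable_section1 x mh2).
  - by move=> s _; rewrite lee_fin mulr_ge0 ?powR_ge0.
  - by rewrite lee_fin mulr_ge0 ?powR_ge0 ?ring01_ge0.
have := @fubini_tonelli _ _ _ _ R (lebesgue_Rn n) mu (fun p => (Q p.1 p.2)%:E).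
rewrite /= => ->; last 2 first.
- exact/measurable_EFinP.
- by move=> p; rewrite lee_fin.
transitivity (\int[mu]_s \int[lebesgue_Rn n]_y (P s y)%:E)%E.
  apply: ge0_ae_eq_integral => //.
  - apply: (@measurable_fun_fubini_tonelli_G _ _ _ _ R (lebesgue_Rn n) (fun p : Rn R n *
      measurableTypeR R => (Q p.1 p.2)%:E)).
      exact/measurable_EFinP.
    by move=> p; rewrite lee_fin.
  - apply: (@measurable_fun_fubini_tonelli_F _ _ _ _ R (lebesgue_Rn n) (fun p : measurableTypeR R
      * Rn R n => (P p.1 p.2)%:E)).
      exact/measurable_EFinP.
    by move=> p; rewrite lee_fin.
  - by move=> s _; apply: integral_ge0 => x _; rewrite lee_fin.
  - by move=> s _; apply: integral_ge0 => x _; rewrite lee_fin.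
  - exists [set 0]; split; [exact: measurable_set1|exact: lebesgue_measure_set1|].
    move=> s /= Hs; apply: contrapT => s0; apply: Hs => _; apply: QP.
    by apply/eqP.
have := @fubini_tonelli _ _ _ _ R mu (lebesgue_Rn n) (fun p => (P p.1 p.2)%:E).
rewrite /= => ->; last 2 first.
- exact/measurable_EFinP.
- by move=> p; rewrite lee_fin.
apply: eq_integral => y _; rewrite -ge0_integralZl//=.
- by apply: eq_integral => s _; rewrite -EFinM /P mulrC.
- apply/measurable_EFinP; apply: measurable_funM; first exact: measurable_abspowR.
  by apply: measurable_ring01 => //; exact: normr_measurable.
- by move=> s _; rewrite lee_fin mulr_ge0 ?powR_ge0 ?ring01_ge0.
- by rewrite lee_fin mulr_ge0 ?powR_ge0.
Qed.

Let N := (\int[lebesgue_Rn n]_x (h x * enorm x `^ q)%:E)%E.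

Let mshell : measurable_fun setT (fun y : Rn R n =>
  ((h y * enorm y `^ q)%:E * \int[mu]_s (`|s| `^ (-1) * ring01 `|s| (enorm y))%:E)%E).
Proof.
apply: emeasurable_funM.
  by apply/measurable_EFinP; apply: measurable_funM.
apply: (@measurable_fun_fubini_tonelli_F _ _ _ _ R mu (fun p : Rn R n * measurableTypeR R =>
  (`|p.2| `^ (-1) * ring01 `|p.2| (enorm p.1))%:E)).
  have m2 : measurable_fun setT (fun p : Rn R n * measurableTypeR R => `|p.2|).
    exact: (measurableT_comp (@normr_measurable R setT) measurable_snd).
  have m1 : measurable_fun setT (fun p : Rn R n * measurableTypeR R => enorm p.1).
    exact: (measurableT_comp (@measurable_enorm R n) measurable_fst).
  apply/measurable_EFinP; apply: measurable_funM.
    exact: (measurableT_comp (measurable_powR _) m2).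
  exact: measurable_ring01.
by move=> p; rewrite lee_fin mulr_ge0 ?powR_ge0 ?ring01_ge0.
Qed.

Lemma polar_upper : (polar_int <= 4%:E * N)%E.
Proof.
rewrite polar_intE /N -ge0_integralZl//=; last 2 first.
- by apply/measurable_EFinP; exact: measurable_funM.
- by move=> x _; rewrite lee_fin mulr_ge0 ?powR_ge0.
apply: ge0_le_integral => //.
- move=> x _; rewrite mule_ge0// ?lee_fin ?mulr_ge0 ?powR_ge0//.
  by apply: integral_ge0 => s _; rewrite lee_fin mulr_ge0 ?powR_ge0 ?ring01_ge0.
- by apply: emeasurable_funM => //; apply/measurable_EFinP; exact: measurable_funM.
- move=> x _; rewrite muleC lee_wpmul2r ?lee_fin ?mulr_ge0 ?powR_ge0//.
  by have [] := shell_length (enorm_ge0 x).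
Qed.

Lemma polar_lower : (N <= 2%:E * polar_int)%E.
Proof.
rewrite polar_intE -ge0_integralZl//=; last first.
  move=> x _; rewrite mule_ge0// ?lee_fin ?mulr_ge0 ?powR_ge0//.
  by apply: integral_ge0 => s _; rewrite lee_fin mulr_ge0 ?powR_ge0 ?ring01_ge0.
(* The lower bound in [shell_length] requires |y| > 0, so the integrands are compared almost
   everywhere only. *)
apply: ae_ge0_le_integral => //.
- by move=> x _; rewrite lee_fin mulr_ge0 ?powR_ge0.
- by apply/measurable_EFinP; exact: measurable_funM.
- move=> x _; rewrite mule_ge0// mule_ge0// ?lee_fin ?mulr_ge0 ?powR_ge0//.
  by apply: integral_ge0 => s _; rewrite lee_fin mulr_ge0 ?powR_ge0 ?ring01_ge0.
- by apply: emeasurable_funM.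
apply: ae_enorm_gt0 => // x xpos _.
have [_ /(_ xpos) h1] := shell_length (enorm_ge0 x).
rewrite muleCA -[leLHS]mule1 lee_wpmul2l ?lee_fin ?mulr_ge0 ?powR_ge0//.
rewrite (_ : 1%E = 2%:E * 2^-1%:E)%E; last by rewrite -EFinM mulfV.
by rewrite lee_wpmul2l.
Qed.
End shells.
End polar.

Section claim.
Context {R : realType}.
Notation C := (R[i]^o).

Lemma growthS n d d' (F : Cn R n -> C) : d <= d' -> growth d F -> growth d' F.
Proof.
move=> dd gF e e0; have [M FM] := gF e e0; exists M => z /FM /le_trans; apply.
by rewrite ler_expR ler_wpM2r ?cnorm_ge0// lerD2r.
Qed.

Definition sqf n (F : Cn R n -> C) (x : Rn R n) : R := normc (F (Rn_to_Cn x)) ^+ 2.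

Lemma sqf_ge0 n (F : Cn R n -> C) x : 0 <= sqf F x.
Proof. by rewrite exprn_ge0// normc_ge0. Qed.

Lemma measurable_sqf n (F : Cn R n -> C) : entire F -> measurable_fun setT (sqf F).
Proof. by move=> dF; apply: measurable_funX; exact: measurable_entire. Qed.

Lemma line_diff n (F : Cn R n -> C) (u v : Cn R n) : entire F ->
  forall w : C, differentiable (fun w : C => F (u + w *: v)) w.
Proof.
move=> dF w; apply: (@differentiable_comp _ _ _ _ (fun w : C => u + w *: v) F); last exact: dF.
apply: (@differentiableD _ _ _ (fun _ : C => u) (fun w : C => w *: v)).
  exact: differentiable_cst.
by apply: (@differentiableZl _ _ _ (fun w : C => w)); exact: cdiff_id.
Qed.

(** The rate involves only the bounds a and b on the sizes of u and v; the individual line affects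
    only the threshold. This is what makes the one-dimensional constant the same for all lines met
    below. *)
Lemma line_expgrowth n d (F : Cn R n -> C) (u v : Cn R n) (a b : R) : 0 <= d -> growth d F ->
  cnorm u <= a -> cnorm v <= b -> 0 < cnorm v -> 0 <= a ->
  expgrowth ((d + 1) * (a + b)) (fun w : C => F (u + w *: v)).
Proof.
move=> d0 gF ua vb v0 a0; have [M FM] := gF 1 ltr01.
exists (Num.max 1 ((`|M| + 1 + a) / cnorm v)) => w; rewrite ge_max => /andP[w1 w2].
have h1 : `|M| + 1 + a <= normc w * cnorm v by rewrite -ler_pdivrMr.
have h2 : normc w * cnorm v <= cnorm (u + w *: v) + cnorm u.
  have E : cnorm (- u) = cnorm u by rewrite -scaleN1r cnormZ normcN normc1 mul1r.
  by rewrite -cnormZ; have := cnormD (u + w *: v) (- u); rewrite E addrAC subrr add0r.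
have h3 : M < cnorm (u + w *: v) by have := ler_norm M; lra.
rewrite (le_trans (FM _ h3))// ler_expR -mulrA ler_wpM2l//; first by rewrite addr_ge0.
rewrite (le_trans (cnormD _ _))// cnormZ mulrDl lerD//.
  by rewrite (le_trans ua)// ler_peMr.
by rewrite mulrC ler_wpM2r ?normc_ge0.
Qed.

Lemma Rn_to_Cn_scaleT n s (x : Rn R n) : Rn_to_Cn (scaleT s x) = (s +i* 0 : C) *: Rn_to_Cn x.
Proof. by apply/rowP => i; rewrite !mxE tnth_mktuple; simpc. Qed.

(** [line_bound] on each line through x with 1 <= |x| <= 2, where the slice w -> F(w x) has rate (d1
    + 1) * 2 and where |x|^(2g+2-n) <= |x|^(2b+2-n) because |x| >= 1. The factor 8 is 2 * 4, from
    [polar_lower] and [polar_upper]. *)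
Lemma weighted_sqnorm_dominated n (g b1 d1 : R) : (0 < n)%N -> -1 < g -> 0 <= d1 ->
  exists2 C0 : R, 0 < C0 & forall b, g <= b -> b <= b1 ->
  forall F : Cn R n -> C, entire F -> growth d1 F ->
  (weighted_sqnorm g F <= C0%:E * weighted_sqnorm b F)%E.
Proof.
move=> n0 g1 d0; have k0 : 0 <= (d1 + 1) * (0 + 2) by rewrite mulr_ge0// addr_ge0.
have [C0 C00 hC0] := @line_bound R g b1 _ g1 k0.
exists (8 * C0); first by rewrite mulr_gt0.
move=> b gb bb F dF gF.
have mh := measurable_sqf dF; have h0 := sqf_ge0 F.
have lo := polar_lower g n0 mh h0; have up := polar_upper b mh h0.
apply: (le_trans lo).
have mid : (polar_int (sqf F) g <= C0%:E * polar_int (sqf F) b)%E.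
  rewrite /polar_int -ge0_integralZl//=; last 3 first.
  - exact: measurable_polar.
  - move=> x _; rewrite mule_ge0// ?lee_fin ?mulr_ge0 ?powR_ge0 ?ring01_ge0//.
    by apply: integral_ge0 => s _; rewrite lee_fin mulr_ge0 ?powR_ge0.
  - by rewrite lee_fin ltW.
  apply: ge0_le_integral => //.
  - move=> x _; rewrite mule_ge0// ?lee_fin ?mulr_ge0 ?powR_ge0 ?ring01_ge0//.
    by apply: integral_ge0 => s _; rewrite lee_fin mulr_ge0 ?powR_ge0.
  - exact: measurable_polar.
  - by apply: emeasurable_funM => //; exact: measurable_polar.
  move=> x _; rewrite muleCA /ring01; case: ifPn => [/andP[x1 x2]|_]; last first.
    by rewrite !mul0r !mul0e.
  have xpos : 0 < enorm x by rewrite (lt_le_trans ltr01).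
  rewrite !mul1r; apply: lee_pmul; rewrite ?lee_fin ?powR_ge0//.
  - by apply: integral_ge0 => s _; rewrite lee_fin mulr_ge0 ?powR_ge0.
  - by apply: ler_powR => //; lra.
  have := hC0 b gb bb (fun w : C => F (0 + w *: Rn_to_Cn x)).
  under [in X in (_ -> _ -> X) -> _]eq_integral do rewrite add0r -Rn_to_Cn_scaleT.
  under [in X in (_ -> _ -> (_ <= X)%E) -> _]eq_integral do rewrite add0r -Rn_to_Cn_scaleT.
  apply; first exact: line_diff.
  apply: line_expgrowth => //.
  - by apply: cnorm_le => t _; rewrite /pair big1 ?normc0// => i _; rewrite mxE mul0r.
  - by rewrite cnorm_real; rewrite mulr1 in x2.
  - by rewrite cnorm_real.
rewrite (_ : 8 * C0 = 2 * (C0 * 4)); last by ring.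
rewrite EFinM -muleA lee_wpmul2l// EFinM -muleA (le_trans mid)// lee_wpmul2l//.
by rewrite lee_fin ltW.
Qed.
End claim.

(** * Nonzero functions have positive norm *)

Section positivity.
Context {R : realType}.
Notation C := (R[i]^o).

(** For z = x + iy with y != 0, [poisson_bound] for w -> F(x + w y) bounds the value at w = i, which
    is F(z), by an integral over real w, where F vanishes. *)
Lemma entire_eq0_real n d (F : Cn R n -> C) : 0 <= d -> entire F -> growth d F ->
  (forall x, F (Rn_to_Cn x) = 0) -> F = cst 0.
Proof.
move=> d0 dF gF F0; apply/funext => z.
pose x : Rn R n := [tuple (complex.Re (z ord0 i) : measurableTypeR R) | i < n].
pose y : Rn R n := [tuple (complex.Im (z ord0 i) : measurableTypeR R) | i < n].
have zE : z = Rn_to_Cn x + ('i : C) *: Rn_to_Cn y.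
  apply/rowP => i; rewrite !mxE !tnth_mktuple [LHS]complexE.
  by [].
have [y0|y0] := eqVneq (enorm y) 0.
  suff -> : z = Rn_to_Cn x by rewrite F0.
  rewrite zE (_ : Rn_to_Cn y = 0) ?scaler0 ?addr0//.
  apply/rowP => i; rewrite !mxE; have := abs_tnth_le_enorm y i.
  by rewrite y0 normr_le0 => /eqP ->.
have yp : 0 < enorm y by rewrite lt_neqAle enorm_ge0 eq_sym y0.
have [r0 fr] : expgrowth ((d + 1) * (enorm x + enorm y)) (fun w : C =>
  F (Rn_to_Cn x + w *: Rn_to_Cn y)).
  by apply: line_expgrowth; rewrite ?cnorm_real ?enorm_ge0.
have k0 : 0 <= (d + 1) * (enorm x + enorm y) by rewrite mulr_ge0// addr_ge0// ?enorm_ge0.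
have := @poisson_bound R _ r0 (fun w : C => F (Rn_to_Cn x + w *: Rn_to_Cn y)) k0
  (fun w _ => line_diff _ _ dF w) (fun w _ => fr w).
rewrite -zE (_ : (\int[_]_t _)%E = 0%E).
  rewrite mule0 lee_fin => h; apply: eq0_normc; apply/eqP.
  by rewrite eq_le h normc_ge0.
apply: integral0_eq => t _; rewrite (_ : Rn_to_Cn x + _ = Rn_to_Cn [tuple (tnth x i + t * tnth y i
  : measurableTypeR R) | i < n]).
  by rewrite F0 normc0 mul0r.
by apply/rowP => i; rewrite !mxE !tnth_mktuple; simpc.
Qed.

Lemma measurable_wsq n a (F : Cn R n -> C) : entire F ->
  measurable_fun setT (fun x : Rn R n => sqf F x * enorm x `^ a).
Proof.
move=> dF; apply: measurable_funM; first exact: measurable_sqf.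
exact: (measurableT_comp (measurable_powR _) (@measurable_enorm R n)).
Qed.

Lemma wsq_ge0 n a (F : Cn R n -> C) (x : Rn R n) : 0 <= sqf F x * enorm x `^ a.
Proof. by rewrite mulr_ge0 ?powR_ge0 ?sqf_ge0. Qed.

Lemma weighted_sqnorm_ge0 n a (F : Cn R n -> C) : (0 <= weighted_sqnorm a F)%E.
Proof. by apply: integral_ge0 => x _; rewrite lee_fin wsq_ge0. Qed.

(** If the norm were 0, a real point with F != 0 would have around it a box where F != 0 by
    continuity. Off the origin the integrand is positive there, so a box of positive measure would
    be negligible. *)
Lemma weighted_sqnorm_gt0 n a d (F : Cn R n -> C) : (0 < n)%N -> 0 <= d ->
  entire F -> growth d F -> F != cst 0 -> (0 < weighted_sqnorm a F)%E.
Proof.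
move=> n0 d0 dF gF FN0; rewrite lt_neqAle weighted_sqnorm_ge0 andbT eq_sym.
apply: contra_not_neq (negP FN0) => N0; apply/eqP.
apply: (entire_eq0_real d0 dF gF) => x0; apply/eqP; apply: contrapT => /negP Fx0.
have cp : 0 < normc (F (Rn_to_Cn x0)).
  by rewrite lt_neqAle normc_ge0 andbT eq_sym; apply: contra Fx0 => /eqP/eq0_normc/eqP.
have [e e0 eP] : exists2 e : R, 0 < e & forall y : Rn R n,
    (forall i, `|tnth y i - tnth x0 i| < e) -> 0 < normc (F (Rn_to_Cn y)).
  have cF := differentiable_continuous (dF (Rn_to_Cn x0)).
  have : nbhs (F (Rn_to_Cn x0)) [set w : C | 0 < normc w].
    apply/nbhsCP; exists (normc (F (Rn_to_Cn x0))) => // h hh /=.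
    have := le_normcD (F (Rn_to_Cn x0) + h) (- h); rewrite addrK normcN; lra.
  move=> /cF /nbhs_ballP[[r b] /=]; rewrite ltcE /= => /andP[/eqP -> r0] rP.
  exists r => // y yx; apply: rP; split; first by rewrite ltcE /= eqxx.
  move=> i j; rewrite /ball/= !mxE normCE (_ : r +i* 0 = r%:C)// ltcR.
  by rewrite -(rmorphB (real_complex R)) normcR distrC.
pose A (i : 'I_n) : set (measurableTypeR R) := `]tnth x0 i - e, tnth x0 i + e[%classic.
pose B := [set t : Rn R n | forall i, A i (tnth t i)].
have mA i : measurable (A i) by exact: measurable_itv.
have Bpos : (0 < lebesgue_Rn n B)%E.
  rewrite /B lebesgue_Rn_box//; elim/big_ind : _ => // [u v|i _]; first exact: mule_gt0.
  rewrite /A; have := lebesgue_measure_itv `]tnth x0 i - e, tnth x0 i + e[ => /= ->.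
  rewrite lte_fin ifT; last by lra.
  by rewrite -EFinB lte_fin; lra.
have mB : measurable B.
  rewrite (_ : B = \bigcap_(i in [set: 'I_n]) (fun t => tnth t i) @^-1` A i).
    apply: fin_bigcap_measurable => // i _.
    by rewrite -[X in measurable X]setTI; exact: measurable_tnth.
  by apply/seteqP; split => t /= At i; [move=> _|]; exact: At.
have mf : measurable_fun setT (fun x : Rn R n => (sqf F x * enorm x `^ (2 * a + 2 - n%:R))%:E).
  by apply/measurable_EFinP; exact: measurable_wsq.
have [Z [mZ Z0 ZP]] : ae_eq (lebesgue_Rn n) setT (fun x : Rn R n =>
  (sqf F x * enorm x `^ (2 * a + 2 - n%:R))%:E) (cst 0%E).
  apply/(ae_eq_integral_abs _ _ mf) => //.
  rewrite -[RHS]N0; apply: eq_integral => x _.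
  by rewrite gee0_abs// lee_fin wsq_ge0.
have BZ : B `<=` Z `|` [set x | enorm x = 0].
  move=> y By; have [y0|y0] := eqVneq (enorm y) 0; [by right|left].
  apply: ZP => /= /(_ I) [] /eqP; rewrite mulf_eq0 powR_eq0 (negPf y0)/= orbF.
  rewrite expf_eq0/= gt_eqF//; apply: eP => i.
  by have := By i; rewrite /A /= in_itv/= ltr_distl.
have mO := @measurable_origin R n.
have : (lebesgue_Rn n B <= lebesgue_Rn n (Z `|` [set x | enorm x = 0%R]))%E.
  by apply: le_measure; rewrite ?inE//; exact: measurableU.
rewrite leNgt (le_lt_trans _ Bpos)//.
have := @measureU2 _ _ _ (lebesgue_Rn n) Z [set x | enorm x = 0] mZ mO.
rewrite [X in (_ <= _ + X)%E -> _]lebesgue_Rn_origin// adde0 => /le_trans; apply.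
by rewrite [leLHS]Z0.
Qed.
End positivity.

(** * Products of cardinal sines *)

Section sinc.
Context {R : realType}.
Notation C := (R[i]^o).

Definition ch (b : R) : R := (expR b + expR (- b)) / 2.
Definition sh (b : R) : R := (expR b - expR (- b)) / 2.

Lemma is_derive_expRN (b : R) : is_derive b 1 (fun x : R => expR (- x)) (- expR (- b)).
Proof.
have h := @is_derive1_comp R expR (fun x => - x) b _ _ (is_derive_expR (- b)) (is_deriveNid b 1).
by apply: is_derive_eq h _; rewrite mulrN1.
Qed.

Lemma is_derive_sh (b : R) : is_derive b 1 sh (ch b).
Proof.
have h := is_derive_expRN b.
rewrite (_ : sh = 2^-1 \*: (expR - (fun x : R => expR (- x)))); last first.
  by apply/funext => x; rewrite /sh /= mulrC.
by apply: is_derive_eq; rewrite opprK /GRing.scale/= mulrC.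
Qed.

Lemma mvt0 (f df : R -> R) (a : R) : (forall x : R, is_derive x (1 : R) f (df x)) -> f 0 = 0 ->
  exists2 c, `|c| <= `|a| & f a = df c * a.
Proof.
move=> dfx f0; have cf x : {for x, continuous f}.
  by apply: differentiable_continuous; apply/derivable1_diffP; have [] := dfx x.
have [a0|a0|<-] := ltgtP 0 a; last by exists 0; rewrite ?mulr0.
- have [c /[!in_itv]/= /andP[c0 ca]] := @MVT R f df 0 a a0 (fun x _ =>
    dfx x) (continuous_subspaceT cf).
  rewrite f0 !subr0 => E; exists c => //.
  by rewrite !ger0_norm ?ltW// (lt_trans c0).
- have [c /[!in_itv]/= /andP[c0 ca]] := @MVT R f df a 0 a0 (fun x _ =>
    dfx x) (continuous_subspaceT cf).
  rewrite f0 !sub0r mulrN => /eqP; rewrite eqr_opp => /eqP E; exists c => //.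
  by rewrite !ler0_norm ?lerN2 ?ltW// (lt_trans ca).
Qed.

Lemma abs_sin_le (x : R) : `|sin x| <= `|x|.
Proof.
have [c _ ->] := @mvt0 sin cos x (fun x => is_derive_sin x) (sin0 R).
by rewrite normrM ler_piMl// ler_norml cos_geN1 cos_le1.
Qed.

Lemma ch_le (b : R) : ch b <= expR `|b|.
Proof.
have h1 : expR b <= expR `|b| by rewrite ler_expR ler_norm.
have h2 : expR (- b) <= expR `|b| by rewrite ler_expR -normrN ler_norm.
rewrite /ch ler_pdivrMr//; lra.
Qed.

Lemma ch_ge0 (b : R) : 0 <= ch b.
Proof. by rewrite divr_ge0// addr_ge0// expR_ge0. Qed.

Lemma sh0 : sh 0 = 0.
Proof. by rewrite /sh oppr0 subrr mul0r. Qed.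

Lemma abs_sh_le (b : R) : `|sh b| <= `|b| * expR `|b|.
Proof.
have [c cb ->] := @mvt0 sh ch b is_derive_sh sh0.
rewrite normrM mulrC ler_wpM2l// ger0_norm ?ch_ge0//.
by rewrite (le_trans (ch_le _))// ler_expR.
Qed.

Definition csin (w : R[i]) : R[i] :=
  (expC ('i * w) - expC (- 'i * w)) / (2 * 'i).

Lemma csinE a b : csin (a +i* b) = (sin a * ch b) +i* (cos a * sh b).
Proof.
rewrite /csin /expC (_ : 'i * (a +i* b) = (- b) +i* a); last by simpc.
rewrite (_ : - 'i * (a +i* b) = b +i* (- a)); last by simpc.
rewrite /= cosN sinN (_ : (2 * 'i)^-1 = 0 +i* (- 2^-1)); last first.
  rewrite invfM (_ : 'i^-1 = - 'i :> R[i]); last first.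
    by apply: (mulIf (x := 'i)); rewrite ?mulVf ?mulNr -?expr2 ?sqr_i ?opprK// eq_complex/=
      oner_eq0 andbF.
  rewrite -(rmorph_nat (real_complex R) 2) -(fmorphV (real_complex R)).
  by simpc.
by simpc; congr (_ +i* _); rewrite /ch /sh; field.
Qed.

Definition csinc (w : R[i]) : R[i] := if w == 0 then 1 else csin w / w.

Lemma normc_csin_le w : normc (csin w) <= 2 * normc w * expR (normc w).
Proof.
case: w => a b; have ha := @normRe R (a +i* b); have hb := @normIm R (a +i* b).
rewrite /= in ha hb; move: ha hb; rewrite -[Num.sqrt _]/(normc (a +i* b)).
rewrite csinE; move: (normc (a +i* b)) => N ha hb.
rewrite (le_trans (le_normcReIm _))//=.
have e1 : expR `|b| <= expR N by rewrite ler_expR.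
have N0 : 0 <= N by rewrite (le_trans _ ha).
rewrite -mulrA mulr2n mulrDl mul1r lerD// normrM.
  apply: ler_pM => //; first by rewrite (le_trans (abs_sin_le _)).
  by rewrite ger0_norm ?ch_ge0// (le_trans (ch_le _)).
rewrite (le_trans (ler_piMl _ _))//; first by rewrite ler_norml cos_geN1 cos_le1.
by rewrite (le_trans (abs_sh_le _))// ler_pM// expR_ge0.
Qed.

Lemma normc_gt0 (w : R[i]) : w != 0 -> 0 < normc w.
Proof.
by move=> w0; rewrite lt_neqAle normc_ge0 andbT eq_sym; apply: contra w0 => /eqP/eq0_normc/eqP.
Qed.

Lemma normc_csinc_le w : normc (csinc w) <= 2 * expR (normc w).
Proof.
rewrite /csinc; case: eqVneq => [->|w0].
  by rewrite normc1 normc0 expR0 mulr1 ler1n.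
rewrite normcM normcV ler_pdivrMr ?normc_gt0// mulrAC.
by exact: normc_csin_le.
Qed.

(** The first bound makes multiplication by the mollifier a contraction on real points; the second
    provides the decay at infinity. *)
Lemma csinc_real (x : R) : normc (csinc (x +i* 0)) <= 1 /\ `|x| * normc (csinc (x +i* 0)) <= 1.
Proof.
rewrite /csinc; case: eqVneq => [[->]|x0]; first by rewrite normr0 mul0r normc1.
have xp := normc_gt0 x0; rewrite normc_hor in xp.
rewrite csinE sh0 mulr0 (_ : ch 0 = 1) ?mulr1; last first.
  by rewrite /ch oppr0 expR0; field.
rewrite normcM normcV !normc_hor; split.
  by rewrite ler_pdivrMr// mul1r abs_sin_le.
by rewrite mulrC divfK ?gt_eqF// ler_norml sin_geN1 sin_le1.
Qed.

Lemma csinc_diff (w : C) : differentiable (csinc : C -> C) w.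
Proof.
have dsin (z : C) : differentiable (csin : C -> C) z.
  apply: cdiffM; last exact: cdiff_cst.
  apply: cdiffB.
    apply: (@differentiable_comp _ _ _ _ (fun z : C => 'i * z : C) (expC : C -> C));
      last exact: differentiable_expC.
    by apply: cdiffM; [exact: cdiff_cst|exact: cdiff_id].
  apply: (@differentiable_comp _ _ _ _ (fun z : C => - 'i * z : C) (expC : C -> C));
    last exact: differentiable_expC.
  by apply: cdiffM; [exact: cdiff_cst|exact: cdiff_id].
have [->|w0] := eqVneq w 0; last first.
  have [c cP] : exists c : C, forall e : R, 0 < e -> exists2 d : R, 0 < d &
      forall h : C, normc h < d ->
      normc (csin (w + h) / (w + h) - csin w / w - c * h) <= e * normc h.
    apply: (@differentiable_eps R (fun z : C => csin z / z : C)).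
    apply: cdiffM; first exact: dsin.
    by apply: (@cdiffV _ _ (fun z : C => z)); [exact: cdiff_id|].
  apply: (@eps_differentiable _ _ w c) => e e0; have [d d0 dP] := cP e e0.
  exists (Num.min d (normc w)); first by rewrite lt_min d0 normc_gt0.
  move=> h; rewrite lt_min => /andP[/dP hd hw].
  rewrite /csinc (negPf w0) ifN//; apply: contraTN hw => /eqP wh.
  by rewrite -leNgt (_ : h = - w) ?normcN//; apply/eqP; rewrite -addr_eq0 addrC wh.
apply: (@eps_differentiable _ _ 0 0) => e e0.
(* At 0 the derivative is 0: [csin h - h] has real and imaginary parts at most 3 * (k * (N * N)),
   and dividing by h leaves 6 * k * N, below e * N. *)
pose k := Num.min 1 (e / 8).
have k0 : 0 < k by rewrite lt_min ltr01 divr_gt0.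
have k1 : k <= 1 by rewrite /k ge_min lexx.
have ke : k <= e / 8 by rewrite /k ge_min lexx orbT.
have [d1 d10 dE] := derivable_eps (is_derive_expR 0) k0.
have [d2 d20 dC] := derivable_eps (is_derive_cos 0) k0.
clearbody k.
exists (Num.min (Num.min d1 d2) 1); first by rewrite !lt_min d10 d20 ltr01.
move=> h; rewrite !lt_min => /andP[/andP[h1 h2] h3].
rewrite add0r mul0r subr0 /csinc eqxx; case: eqVneq => [->|h0].
  by rewrite subrr normc0 mulr_ge0 ?normc_ge0// ltW.
have N0 := normc_gt0 h0.
rewrite (_ : csin h / h - 1 = (csin h - h) / h); last by rewrite mulrBl mulfV.
rewrite normcM normcV ler_pdivrMr//.
have chk b : `|b| <= normc h -> `|ch b - 1| <= k * `|b|.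
  move=> bh; have := dE b (le_lt_trans bh h1).
  have := dE (- b); rewrite normrN => /(_ (le_lt_trans bh h1)).
  rewrite !add0r expR0 !mul1r opprK => i1 i2.
  rewrite (_ : ch b - 1 = ((expR b - 1 - b) + (expR (- b) - 1 + b)) / 2); last by rewrite /ch;
    field.
  rewrite normrM (ger0_norm (_ : 0 <= 2^-1))// ler_pdivrMr// mulr2n mulrDr mulr1.
  by rewrite (le_trans (ler_normD _ _))// lerD.
have cosk a : `|a| <= normc h -> `|cos a - 1| <= k * `|a|.
  move=> ah; have := dC a (le_lt_trans ah h2).
  by rewrite !add0r cos0 sin0 oppr0 mul0r subr0.
have sink a : `|a| <= normc h -> `|sin a - a| <= k * (`|a| * `|a|).
  move=> ah; have [|c ca ->] := @mvt0 (fun x => sin x - x) (fun x => cos x - 1) a _.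
    by rewrite sin0 subr0.
  rewrite normrM mulrA ler_wpM2r// (le_trans (cosk _ _)) ?(le_trans ca)// ler_wpM2l// ltW//.
have shk b : `|b| <= normc h -> `|sh b - b| <= k * (`|b| * `|b|).
  move=> ah; have dsh := is_derive_sh.
  have [|c ca ->] := @mvt0 (fun x => sh x - x) (fun x => ch x - 1) b _.
    by rewrite sh0 subr0.
  rewrite normrM mulrA ler_wpM2r// (le_trans (chk _ _)) ?(le_trans ca)// ler_wpM2l// ltW//.
have ha := normRe h; have hb := normIm h.
move: chk cosk sink shk ha hb h3 N0 {h1 h2 h0 dE dC dsin}.
move: (normc h) => N.
case: h => a b; rewrite csinE [complex.Re _]/= [complex.Im _]/=.
move=> chk cosk sink shk ha hb N1 N0.
rewrite (le_trans (le_normcReIm _))//=.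
have a1 : `|a| <= 1 by rewrite (le_trans ha)// ltW.
have b1 : `|b| <= 1 by rewrite (le_trans hb)// ltW.
have NN x y : `|x| <= N -> `|y| <= N -> `|x| * `|y| <= N * N by move=> *; exact: ler_pM.
have cb2 : `|ch b| <= 2.
  rewrite (_ : ch b = (ch b - 1) + 1); last by ring.
  rewrite (le_trans (ler_normD _ _))// normr1.
  have := chk b hb; have : k * `|b| <= 1 by rewrite -[X in _ <= X]mulr1 ler_pM// ltW.
  lra.
have sb2 : `|sh b| <= 2 * N.
  rewrite (_ : sh b = (sh b - b) + b); last by ring.
  rewrite (le_trans (ler_normD _ _))// mulr2n mulrDl mul1r lerD//.
  rewrite (le_trans (shk b hb))// mulrA (le_trans _ hb)// ler_piMl//.
  by rewrite -[X in _ <= X]mulr1 ler_pM// ltW.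
have r1 : `|sin a * ch b - a| <= 3 * (k * (N * N)).
  rewrite (_ : _ - a = (sin a - a) * ch b + a * (ch b - 1)); last by ring.
  rewrite (le_trans (ler_normD _ _))// (normrM (sin a - a)) (normrM a).
  rewrite (_ : 3 * _ = k * (N * N) * 2 + k * (N * N)); last by ring.
  rewrite lerD//.
    apply: ler_pM => //; rewrite (le_trans (sink _ ha))// ler_wpM2l ?(ltW k0)//.
    exact: NN.
  rewrite (le_trans (ler_wpM2l _ (chk b hb)))//.
  by rewrite mulrCA ler_wpM2l ?(ltW k0)//; exact: NN.
have r2 : `|cos a * sh b - b| <= 3 * (k * (N * N)).
  rewrite (_ : _ - b = (cos a - 1) * sh b + (sh b - b)); last by ring.
  rewrite (le_trans (ler_normD _ _))// (normrM (cos a - 1)).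
  rewrite (_ : 3 * _ = (k * N) * (2 * N) + k * (N * N)); last by ring.
  rewrite lerD//.
    apply: ler_pM => //; rewrite (le_trans (cosk _ ha))// ler_wpM2l ?(ltW k0)//.
  by rewrite (le_trans (shk _ hb))// ler_wpM2l ?(ltW k0)//; exact: NN.
rewrite (le_trans (lerD r1 r2))//.
have -> : e * N * N = e * (N * N) by rewrite mulrA.
have : k * (N * N) <= e / 8 * (N * N) by rewrite ler_wpM2r// mulr_ge0// ltW.
have : 0 <= e * (N * N) by rewrite !mulr_ge0// ltW.
have -> : e / 8 * (N * N) = e * (N * N) / 8 by ring.
by clear; move: (k * (N * N)) (e * (N * N)) => u v; lra.
Qed.
End sinc.

Section mollifier.
Context {R : realType}.
Notation C := (R[i]^o).
Notation mu := (@lebesgue_measure R).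

Lemma growth_scale n d (F : Cn R n -> C) (l : R) : 0 < l -> growth d F ->
  growth (l * d) (fun z => F ((l%:C : C) *: z)).
Proof.
move=> l0 gF e e0; have [M FM] := gF (e / l) (divr_gt0 e0 l0).
exists (M / l) => z; rewrite ltr_pdivrMr// mulrC => Mz.
have E : cnorm ((l%:C : C) *: z) = l * cnorm z by rewrite cnormZ normcR gtr0_norm.
have := FM ((l%:C : C) *: z); rewrite E => /(_ Mz) /le_trans; apply.
rewrite ler_expR le_eqVlt; apply/orP; left; apply/eqP; field; exact: lt0r_neq0.
Qed.

Lemma growth_mul n d1 d2 (F G : Cn R n -> C) : growth d1 F -> growth d2 G ->
  growth (d1 + d2) (fun z => F z * G z : C).
Proof.
move=> gF gG e e0; have e20 : 0 < e / 2 by rewrite divr_gt0.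
have [M FM] := gF _ e20; have [N GN] := gG _ e20.
exists (Num.max M N) => z; rewrite gt_max => /andP[/FM Fz /GN Gz].
rewrite normcM.
have := ler_pM (normc_ge0 _) (normc_ge0 _) Fz Gz; rewrite -expRD.
by rewrite (_ : _ + _ = (d1 + d2 + e) * cnorm z)//; field.
Qed.

(** The power m = 1 serves for the perturbation argument; higher powers decay fast enough to be
    nonzero elements of H_a themselves. *)
Definition moll n (c : R) (m : nat) (z : Cn R n) : C :=
  \prod_(i < n) csinc (c%:C * z ord0 i) ^+ m.

Lemma entire_moll n c m : entire (@moll n c m).
Proof.
move=> z; rewrite /moll; elim: (index_enum _) => [|i r IH].
  rewrite (_ : (fun z => _) = (fun=> 1 : C)); first exact: cdiff_cst.
  by apply/funext => w; rewrite big_nil.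
rewrite (_ : (fun z => _) = (fun z : Cn R n => csinc (c%:C * z ord0 i) ^+ m *
    \prod_(j <- r) csinc (c%:C * z ord0 j) ^+ m : C)); last first.
  by apply/funext => w; rewrite big_cons.
apply: cdiffM => //; apply: cdiffX.
apply: (@differentiable_comp _ _ _ _ (fun z : Cn R n => c%:C * z ord0 i : C) (csinc : C -> C));
  last exact: csinc_diff.
by apply: cdiffM; [exact: cdiff_cst|exact: differentiable_coord].
Qed.

Lemma normc_prod n (f : 'I_n -> R[i]) : normc (\prod_(i < n) f i) = \prod_(i < n) normc (f i).
Proof. by elim/big_ind2 : _ => // [|u a v b <- <-]; rewrite ?normc1 ?normcM. Qed.

(** Each factor is at most 2 exp(c |z|). The constant 2 ^+ (m * n) is absorbed by exp(e |z|) for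
    large |z|, which explains the threshold. The type is estimated crudely, as it only has to vanish
    with c. *)
Lemma growth_moll n c m : 0 <= c -> growth (c * (m * n)%:R) (@moll n c m).
Proof.
move=> c0 e e0; exists (ln (2 ^+ (m * n)) / e) => z; rewrite ltr_pdivrMr// => zM.
rewrite /moll normc_prod.
apply: (@le_trans _ _ (\prod_(i < n) (2 * expR (c * cnorm z)) ^+ m)).
  apply: ler_prod => i _; rewrite normc_ge0 normcX/=; apply: lerXn2r.
  - by rewrite nnegrE normc_ge0.
  - by rewrite nnegrE mulr_ge0// expR_ge0.
  rewrite (le_trans (normc_csinc_le _))// ler_wpM2l// ler_expR normcM normcR ger0_norm//.
  by rewrite ler_wpM2l// normc_coord_le_cnorm.
rewrite prodr_const card_ord -exprM exprMn -expRM_natl mulrDl expRD mulrC.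
have p2 : 0 < 2 ^+ (m * n) :> R by rewrite exprn_gt0.
rewrite ler_pM ?expR_ge0 ?(ltW p2)//.
  by rewrite ler_expR mulrA [_%:R * c]mulrC.
by rewrite -[leLHS]lnK ?posrE// ler_expR mulrC ltW.
Qed.

Lemma moll_real n c m (x : Rn R n) :
  normc (moll c m (Rn_to_Cn x)) = \prod_(i < n) normc (csinc ((c * tnth x i) +i* 0)) ^+ m.
Proof.
rewrite /moll normc_prod; apply: eq_bigr => i _; rewrite normcX mxE.
by rewrite -(rmorphM (real_complex R)).
Qed.

Lemma moll_le1 n c m (x : Rn R n) : normc (moll c m (Rn_to_Cn x)) <= 1.
Proof.
rewrite moll_real; have h1 : \prod_(i < n) (1 : R) = 1 by rewrite big1.
rewrite -[leRHS]h1.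
apply: ler_prod => i _; rewrite exprn_ge0 ?normc_ge0// exprn_ile1 ?normc_ge0//.
by have [] := @csinc_real R (c * tnth x i).
Qed.

Lemma enorm_le_sum n (x : Rn R n) : enorm x <= \sum_(i < n) `|tnth x i|.
Proof.
have S0 : 0 <= \sum_(i < n) `|tnth x i| by apply: sumr_ge0.
rewrite -(ler_pXn2r (n := 2)) ?nnegrE ?enorm_ge0// sqr_enorm expr2 mulr_suml.
apply: ler_sum => i _; rewrite -real_normK ?num_real// expr2 ler_wpM2l//.
by rewrite (bigD1 i)//= lerDl sumr_ge0.
Qed.

(** |x| is at most the sum of the |x_i|, and each |x_i| is compensated by its own factor, the others
    being at most 1. *)
Lemma moll_decay n c (x : Rn R n) : 0 < c ->
  enorm x * normc (moll c 1 (Rn_to_Cn x)) <= n%:R / c.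
Proof.
move=> c0; apply: (@le_trans _ _ (\sum_(i < n) `|tnth x i| * normc (moll c 1 (Rn_to_Cn x)))).
  by rewrite -mulr_suml ler_wpM2r ?normc_ge0// enorm_le_sum.
rewrite (_ : n%:R / c = \sum_(i < n) c^-1); last first.
  by rewrite sumr_const card_ord mulr_natl.
apply: ler_sum => i _; rewrite moll_real (bigD1 i)//= expr1.
have [h1 h2] := @csinc_real R (c * tnth x i).
rewrite mulrA (le_trans (ler_piMr _ _))//.
- by rewrite mulr_ge0// normc_ge0.
- have h3 : \prod_(j < n | j != i) (1 : R) = 1 by rewrite big1.
  rewrite -[leRHS]h3.
  apply: ler_prod => j _; rewrite exprn_ge0 ?normc_ge0// exprn_ile1 ?normc_ge0//.
  by have [] := @csinc_real R (c * tnth x j).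
rewrite -(ler_pM2l c0) mulrA mulfV ?gt_eqF//.
by move: h2; rewrite normrM gtr0_norm.
Qed.

Lemma bernoulli_sub (x : R) k : 0 <= x -> x <= 1 -> 1 - k%:R * x <= (1 - x) ^+ k.
Proof.
move=> x0 x1; elim: k => [|k IH]; first by rewrite mul0r subr0 expr0.
rewrite exprS (@le_trans _ _ ((1 - x) * (1 - k%:R * x)))//; last by rewrite ler_wpM2l// subr_ge0.
rewrite -natr1; have : 0 <= k%:R * (x * x) by rewrite !mulr_ge0.
nra.
Qed.

Lemma moll_near1 n (e r : R) : 0 < e -> exists2 c0 : R, 0 < c0 &
  forall c, 0 < c -> c <= c0 -> forall x : Rn R n, enorm x <= r ->
  1 - e <= normc (moll c 1 (Rn_to_Cn x)) ^+ 2.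
Proof.
(* The square is a product of 2n factors, each at least 1 - e1, so Bernoulli loses at most 2n * e1.
   The successor in the divisor keeps it nonzero for every n. *)
move=> e0; pose e1 := Num.min (1 / 2) (e / (n * 2).+1%:R).
have e10 : 0 < e1 by rewrite lt_min !divr_gt0.
have e11 : e1 <= 1 by rewrite /e1 ge_min; apply/orP; left; lra.
have e1e : (n * 2)%:R * e1 <= e.
  apply: (@le_trans _ _ ((n * 2).+1%:R * (e / (n * 2).+1%:R))).
    by apply: ler_pM => //; rewrite ?(ltW e10)// ?ler_nat// /e1 ge_min lexx orbT.
  by rewrite mulrCA mulfV ?mulr1.
have [d d0 dP] := continuousCP (differentiable_continuous (@csinc_diff R 0)) e10.
exists (d / (`|r| + 1)); first by rewrite divr_gt0// ltr_wpDl.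
move=> c c0 cd x xr; rewrite moll_real.
apply: (@le_trans _ _ ((1 - e1) ^+ (n * 2))).
  by rewrite (le_trans _ (bernoulli_sub _ (ltW e10) e11))// lerD2l lerN2.
rewrite exprM ler_pXn2r ?nnegrE ?exprn_ge0 ?subr_ge0//; last first.
  by apply: prodr_ge0 => i _; rewrite exprn_ge0 ?normc_ge0.
rewrite -[X in _ ^+ X](card_ord n) -prodr_const.
apply: ler_prod => i _; rewrite subr_ge0 e11/= expr1.
have hd : normc ((c * tnth x i) +i* 0) < d.
  rewrite normc_hor normrM gtr0_norm//.
  move: cd; rewrite ler_pdivlMr ?ltr_wpDl// => /(lt_le_trans _); apply.
  rewrite ltr_pM2l// (le_lt_trans (abs_tnth_le_enorm _ _))//.
  by rewrite (le_lt_trans xr)// (le_lt_trans (ler_norm _))// ltrDl.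
have := dP _ hd; rewrite add0r {2}/csinc eqxx => h.
have := le_normcD (csinc ((c * tnth x i) +i* 0)) (1 - csinc ((c * tnth x i) +i* 0)).
rewrite subrKC normc1 -[X in _ + X]normcN opprB; lra.
Qed.

Lemma measurable_prod_cauchy n :
  measurable_fun setT (fun x : Rn R n => \prod_(i < n) (1 + tnth x i ^+ 2)^-1).
Proof.
apply: measurable_prod => i _.
apply: (measurableT_comp (f := fun t : R => (1 + t ^+ 2)^-1)); last exact: measurable_tnth.
by apply: continuous_measurable_fun => t; exact: continuous_oneDsqrV.
Qed.

Lemma prod_cauchy_ge0 n (x : Rn R n) : 0 <= \prod_(i < n) (1 + tnth x i ^+ 2)^-1.
Proof. by apply: prodr_ge0 => i _; rewrite invr_ge0 ltW// oneDsq_gt0. Qed.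

Lemma integral_prod_cauchy n :
  (\int[@lebesgue_Rn R n]_x (\prod_(i < n) (1 + tnth x i ^+ 2)^-1)%:E < +oo)%E.
Proof.
elim: n => [|n IH].
  under eq_integral do rewrite big_ord0.
  by rewrite integral_cst//= diracT mul1e ltry.
have mV : measurable_fun setT (fun t : R => (1 + t ^+ 2)^-1).
  by apply: continuous_measurable_fun => t; exact: continuous_oneDsqrV.
rewrite integral_lebesgue_RnS; last 2 first.
- by apply/measurable_EFinP; exact: measurable_prod_cauchy.
- by move=> x; rewrite lee_fin; exact: prod_cauchy_ge0.
set J := (\int[lebesgue_Rn n]_x _)%E in IH.
have J0 : (0 <= J)%E by apply: integral_ge0 => x _; rewrite lee_fin prod_cauchy_ge0.
have [P P0 PP] := @cauchy_density_integral R.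
rewrite (_ : (\int[_]_a _)%E = (\int[mu]_a (1 + a ^+ 2)^-1%:E * J)%E).
  case: J J0 IH => [J| |]//; rewrite lee_fin => J0 _.
  by rewrite (le_lt_trans (lee_wpmul2r _ PP)) ?lee_fin// -EFinM ltry.
rewrite -ge0_integralZr//=; last 2 first.
- exact/measurable_EFinP.
- by move=> t _; rewrite lee_fin invr_ge0 ltW// oneDsq_gt0.
apply: eq_integral => a _; rewrite /J -ge0_integralZl//=.
- apply: eq_integral => t _; rewrite -EFinM big_ord_recl tnth0; congr (_ * _)%:E.
  by apply: eq_bigr => i _; rewrite tnthS.
- by apply/measurable_EFinP; exact: measurable_prod_cauchy.
- by move=> x _; rewrite lee_fin; exact: prod_cauchy_ge0.
- by rewrite lee_fin invr_ge0 ltW// oneDsq_gt0.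
Qed.

Lemma prod_oneD_ge n (x : Rn R n) : 1 + enorm x ^+ 2 <= \prod_(i < n) (1 + tnth x i ^+ 2).
Proof.
rewrite sqr_enorm.
suff H (r : seq 'I_n) : 1 <= 1 + \sum_(i <- r) tnth x i ^+ 2 <= \prod_(i <- r) (1 + tnth x i ^+ 2).
  by have /andP[] := H (index_enum _).
elim: r => [|i r /andP[h1 h2]]; first by rewrite !big_nil addr0 lexx.
rewrite !big_cons; have s0 := sqr_ge0 (tnth x i).
set S := \sum_(j <- r) _ in h1 h2 *; set Q := \prod_(j <- r) _ in h2 *.
have : 0 <= tnth x i ^+ 2 * (Q - 1) by rewrite mulr_ge0//; lra.
move=> h3; apply/andP; split; first by lra.
rewrite mulrDl mul1r; lra.
Qed.

(** The weight is at most the product of the (1 + x_i^2)^k, and each squared sinc is at most K/(1 +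
    x_i^2), where K = 1 + c^-2 comes from the two bounds of [csinc_real]. With k + 1 powers one
    integrable factor 1/(1 + x_i^2) per coordinate is left. *)
Lemma moll_finite n c (b : R) k : 0 < c -> 0 <= 2 * b + 2 - n%:R ->
  2 * b + 2 - n%:R <= (2 * k)%:R ->
  (weighted_sqnorm b (@moll n c k.+1) < +oo)%E.
Proof.
move=> c0 q0 qk; set q := 2 * b + 2 - n%:R in q0 qk *.
pose K := 1 + (c ^+ 2)^-1; have K0 : 0 < K by rewrite ltr_wpDr// invr_ge0 sqr_ge0.
apply: (@le_lt_trans _ _ (\int[lebesgue_Rn n]_x ((K ^+ k.+1) ^+ n * \prod_(i < n) (1 + tnth x i ^+
  2)^-1)%:E)%E).
  have mp := @measurable_prod_cauchy n.
  apply: ge0_le_integral => //.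
  - by move=> x _; rewrite lee_fin wsq_ge0.
  - by apply/measurable_EFinP; apply: measurable_wsq; exact: entire_moll.
  - by apply/measurable_EFinP; exact: measurable_funM.
  move=> x _; rewrite lee_fin -/q moll_real.
  have h1 : enorm x `^ q <= \prod_(i < n) (1 + tnth x i ^+ 2) ^+ k.
    rewrite prodrXl; apply: (@le_trans _ _ ((1 + enorm x ^+ 2) ^+ k)); last first.
      apply: lerXn2r; rewrite ?nnegrE ?(ltW (oneDsq_gt0 _)) ?prod_oneD_ge//.
      by apply: prodr_ge0 => i _; rewrite ltW// oneDsq_gt0.
    have [x1|x1] := leP (enorm x) 1.
      apply: (@le_trans _ _ 1); last by rewrite exprn_ege1// lerDl sqr_ge0.
      have <- : (1 : R) `^ q = 1 by rewrite powR1.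
      by apply: ge0_ler_powR; rewrite ?nnegrE ?enorm_ge0.
    apply: (@le_trans _ _ (enorm x `^ (2 * k)%:R)); first by apply: ler_powR => //; exact: ltW.
    rewrite powR_mulrn ?enorm_ge0// exprM.
    by apply: lerXn2r; rewrite ?nnegrE ?sqr_ge0 ?(ltW (oneDsq_gt0 _))// lerDr.
  rewrite -prodrXl.
  apply: (le_trans (ler_wpM2l _ h1)).
    by apply: prodr_ge0 => i _; rewrite !exprn_ge0 ?normc_ge0.
  rewrite -big_split/= -[X in _ ^+ X * _](card_ord n) -prodr_const -big_split/=.
  apply: ler_prod => i _; apply/andP; split.
    by rewrite mulr_ge0// !exprn_ge0 ?normc_ge0// ltW// oneDsq_gt0.
  have [s1 s2] := @csinc_real R (c * tnth x i).
  have s0 := normc_ge0 (csinc ((c * tnth x i) +i* 0)).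
  set s := normc (csinc _) in s0 s1 s2 *; clearbody s.
  set t := tnth x i in s0 s1 s2 *; clearbody t.
  have sK : s ^+ 2 * (1 + t ^+ 2) <= K.
    rewrite mulrDr mulr1 lerD//; first by rewrite exprn_ile1.
    rewrite -[leRHS]mul1r ler_pdivlMr ?exprn_gt0// -!exprMn.
    rewrite -(real_normK (num_real (s * t * c))) exprn_ile1//.
    rewrite (_ : s * t * c = s * (c * t)); last by ring.
    by rewrite normrM (ger0_norm s0) mulrC.
  have t0 := oneDsq_gt0 t.
  rewrite -exprM mulnC exprM exprSr -mulrA mulrCA mulrC -mulrA.
  rewrite ler_pdivlMr// (_ : _ * _ * _ = (s ^+ 2 * (1 + t ^+ 2)) ^+ k.+1).
    rewrite ler_pXn2r ?nnegrE ?(ltW K0)// mulr_ge0 ?sqr_ge0// ltW//.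
  by set A := 1 + _; rewrite (exprSr (s ^+ 2 * A)) (exprMn k (s ^+ 2) A); ring.
under eq_integral do rewrite EFinM.
rewrite ge0_integralZl//=; last 3 first.
- by apply/measurable_EFinP; exact: measurable_prod_cauchy.
- by move=> x _; rewrite lee_fin prod_cauchy_ge0.
- by rewrite lee_fin !exprn_ge0// ltW.
have := integral_prod_cauchy n.
set J := (\int[_]_x _)%E.
have J0 : (0 <= J)%E.
  by apply: integral_ge0 => x _; rewrite lee_fin prod_cauchy_ge0.
by case: J J0 => [J| |]// _ _; rewrite -EFinM ltry.
Qed.
End mollifier.

(** * Comparison of weighted norms *)

Section comparison.
Context {R : realType}.
Notation C := (R[i]^o).

Lemma ae_integral_comb n (h0 h1 h2 h3 : Rn R n -> R) (c1 c2 c3 : R) : (0 < n)%N ->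
  measurable_fun setT h0 -> measurable_fun setT h1 -> measurable_fun setT h2 ->
    measurable_fun setT h3 ->
  (forall x, 0 <= h0 x) -> (forall x, 0 <= h1 x) -> (forall x, 0 <= h2 x) -> (forall x,
    0 <= h3 x) ->
  0 <= c1 -> 0 <= c2 -> 0 <= c3 ->
  (forall x, 0 < enorm x -> h0 x <= c1 * h1 x + c2 * h2 x + c3 * h3 x) ->
  (\int[lebesgue_Rn n]_x (h0 x)%:E <= c1%:E * (\int[lebesgue_Rn n]_x (h1 x)%:E) +
     c2%:E * (\int[lebesgue_Rn n]_x (h2 x)%:E) + c3%:E * (\int[lebesgue_Rn n]_x (h3 x)%:E))%E.
Proof.
move=> n0 m0 m1 m2 m3 p0 p1 p2 p3 k1 k2 k3 H.
have mc (c : R) h : measurable_fun setT h -> measurable_fun setT (fun x : Rn R n => (c * h x)%:E).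
  by move=> mh; apply/measurable_EFinP; exact: measurable_funM.
have pc (c : R) (h : Rn R n -> R) x : 0 <= c -> 0 <= h x -> (0 <= (c * h x)%:E)%E.
  by move=> ? ?; rewrite lee_fin mulr_ge0.
have Z (c : R) (h : Rn R n -> R) : 0 <= c -> measurable_fun setT h -> (forall x, 0 <= h x) ->
    (c%:E * (\int[lebesgue_Rn n]_x (h x)%:E) = \int[lebesgue_Rn n]_x (c * h x)%:E)%E.
  move=> c0 mh ph; rewrite -ge0_integralZl//=.
  - exact/measurable_EFinP.
  - by move=> x _; rewrite lee_fin.
rewrite !Z// -!ge0_integralD//=; try (by move=> *; rewrite ?adde_ge0// pc); try exact: mc;
  last first.
  by apply: emeasurable_funD; exact: mc.
apply: ae_ge0_le_integral => //.
- by move=> x _; rewrite lee_fin.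
- exact/measurable_EFinP.
- by move=> x _; rewrite !adde_ge0// pc.
- by apply: emeasurable_funD; [apply: emeasurable_funD|]; exact: mc.
apply: ae_enorm_gt0 => // x xpos _.
by rewrite -!EFinD lee_fin H.
Qed.

(** The common form of the later comparisons: a pointwise inequality between weights off the origin
    yields at once the finiteness of the left norm and the inequality between real numbers. *)
Lemma weighted_sqnorm_comb n (a0 a1 a2 a3 c1 c2 c3 : R) (F0 F1 F2 F3 : Cn R n -> C) : (0 < n)%N ->
  entire F0 -> entire F1 -> entire F2 -> entire F3 ->
  0 <= c1 -> 0 <= c2 -> 0 <= c3 ->
  (forall x, 0 < enorm x -> sqf F0 x * enorm x `^ (2 * a0 + 2 - n%:R) <=
     c1 * (sqf F1 x * enorm x `^ (2 * a1 + 2 - n%:R)) +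
     c2 * (sqf F2 x * enorm x `^ (2 * a2 + 2 - n%:R)) +
     c3 * (sqf F3 x * enorm x `^ (2 * a3 + 2 - n%:R))) ->
  (weighted_sqnorm a1 F1 < +oo)%E -> (weighted_sqnorm a2 F2 < +oo)%E ->
    (weighted_sqnorm a3 F3 < +oo)%E ->
  (weighted_sqnorm a0 F0 < +oo)%E /\
  fine (weighted_sqnorm a0 F0) <= c1 * fine (weighted_sqnorm a1 F1) +
    c2 * fine (weighted_sqnorm a2 F2) + c3 * fine (weighted_sqnorm a3 F3).
Proof.
move=> n0 d0 d1 d2 d3 k1 k2 k3 H f1 f2 f3.
have h : (weighted_sqnorm a0 F0 <= c1%:E * weighted_sqnorm a1 F1 + c2%:E * weighted_sqnorm a2 F2 +
  c3%:E * weighted_sqnorm a3 F3)%E.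
  apply: ae_integral_comb => //; try exact: measurable_wsq; try exact: wsq_ge0.
have fin a (F : Cn R n -> C) : (weighted_sqnorm a F < +oo)%E -> (weighted_sqnorm a F) \is a fin_num.
  by move=> f; rewrite ge0_fin_numE// weighted_sqnorm_ge0.
move: h; rewrite -(fineK (fin _ _ f1)) -(fineK (fin _ _ f2)) -(fineK (fin _ _ f3)) -!EFinM -!EFinD
  => h.
have f0 := le_lt_trans h (ltry _); split => //.
exact: (@fine_le _ _ _%:E (fin _ _ f0) isT h).
Qed.

Lemma weighted_sqnorm_comb2 n (a0 a1 a2 c1 c2 : R) (F0 F1 F2 : Cn R n -> C) : (0 < n)%N ->
  entire F0 -> entire F1 -> entire F2 -> 0 <= c1 -> 0 <= c2 ->
  (forall x, 0 < enorm x -> sqf F0 x * enorm x `^ (2 * a0 + 2 - n%:R) <=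
     c1 * (sqf F1 x * enorm x `^ (2 * a1 + 2 - n%:R)) +
     c2 * (sqf F2 x * enorm x `^ (2 * a2 + 2 - n%:R))) ->
  (weighted_sqnorm a1 F1 < +oo)%E -> (weighted_sqnorm a2 F2 < +oo)%E ->
  (weighted_sqnorm a0 F0 < +oo)%E /\
  fine (weighted_sqnorm a0 F0) <= c1 * fine (weighted_sqnorm a1 F1) + c2 * fine (weighted_sqnorm
    a2 F2).
Proof.
move=> n0 d0 d1 d2 k1 k2 H f1 f2.
have [|f0 b] := @weighted_sqnorm_comb n a0 a1 a2 a2 c1 c2 0 F0 F1 F2 F2 n0 d0 d1 d2 d2 k1 k2 (lexx
  0) _ f1 f2 f2.
  by move=> x x0; rewrite mul0r addr0; exact: H.
have drop0 (x y z : R) : x <= y + 0 * z -> x <= y by rewrite mul0r addr0.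
by split=> //; exact: drop0 b.
Qed.

Lemma entire_scale n (l : R) (F : Cn R n -> C) : entire F -> entire (fun z => F ((l%:C : C) *: z)).
Proof.
move=> dF z; apply: (@differentiable_comp _ _ _ _ (fun z : Cn R n => (l%:C : C) *: z) F);
  last exact: dF.
by apply: differentiableZ.
Qed.

Lemma weighted_sqnorm_scale n (a l : R) (F : Cn R n -> C) : (0 < n)%N -> 0 < l -> entire F ->
  weighted_sqnorm a F = ((l `^ (2 * a + 2))%:E * weighted_sqnorm a (fun z =>
    F ((l%:C : C) *: z)))%E.
Proof.
move=> n0 l0 dF; have l1 : l != 0 by rewrite gt_eqF.
have mF : measurable_fun setT (fun x : Rn R n => (sqf F x * enorm x `^ (2 * a + 2 - n%:R))%:E).
  by apply/measurable_EFinP; exact: measurable_wsq.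
have pF (x : Rn R n) : (0 <= (sqf F x * enorm x `^ (2 * a + 2 - n%:R))%:E)%E.
  by rewrite lee_fin wsq_ge0.
rewrite /weighted_sqnorm [LHS](ge0_integral_scaleT l1 mF pF).
rewrite (_ : l `^ (2 * a + 2) = `|l| ^+ n * l `^ (2 * a + 2 - n%:R)); last first.
  by rewrite gtr0_norm// -powR_mulrn ?ltW// -powRD ?(negbTE l1) ?implybT//; congr (_ `^ _); ring.
rewrite EFinM -muleA; congr (_ * _)%E.
rewrite -ge0_integralZl//=.
- apply: eq_integral => x _; rewrite -EFinM; congr EFin.
  rewrite enorm_scaleT gtr0_norm// powRM ?enorm_ge0 ?ltW//.
  by rewrite /sqf Rn_to_Cn_scaleT mulrCA.
- by apply/measurable_EFinP; exact: (measurable_wsq _ (entire_scale l dF)).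
- by move=> x _; rewrite lee_fin mulr_ge0 ?powR_ge0 ?exprn_ge0 ?normc_ge0.
- by rewrite lee_fin powR_ge0.
Qed.

Lemma sqf_cst0 n x : sqf (cst 0 : Cn R n -> C) x = 0.
Proof. by rewrite /sqf normc0 expr0n. Qed.

Lemma weighted_sqnorm_cst0 n (a : R) : weighted_sqnorm a (cst 0 : Cn R n -> C) = 0%E.
Proof. by apply: integral0_eq => x _; rewrite -/(sqf _ x) sqf_cst0 mul0r. Qed.

Lemma Hspace_growth n (a d : R) (F : Cn R n -> C) : Hspace a d F ->
  [/\ entire F, growth d F & (weighted_sqnorm a F < +oo)%E].
Proof.
move=> [dF [F0|tF] fF]; split => //; last exact: exp_type_growth.
by rewrite F0 => e e0; exists 0 => z _; rewrite normc0 expR_ge0.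
Qed.

Lemma HspaceP n (a d : R) (F : Cn R n -> C) :
  entire F -> growth d F -> (weighted_sqnorm a F < +oo)%E -> Hspace a d F.
Proof. by move=> dF gF fF; split => //; right; exact: growth_exp_type. Qed.

Lemma Hspace_le n (a b d : R) (F : Cn R n -> C) : (0 < n)%N -> -1 < b -> b <= a -> 0 <= d ->
  Hspace a d F -> Hspace b d F.
Proof.
move=> n0 b1 ba d0 /Hspace_growth[dF gF fF]; apply: (HspaceP dF gF).
have [C0 C00 /(_ a ba (lexx a) F dF gF)] := @weighted_sqnorm_dominated R n b a d n0 b1 d0.
move=> /le_lt_trans; apply.
have : weighted_sqnorm a F \is a fin_num by rewrite ge0_fin_numE// weighted_sqnorm_ge0.
by move=> /fineK <-; rewrite -EFinM ltry.
Qed.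

Lemma Hspace_fine_gt0 n (a d : R) (F : Cn R n -> C) : (0 < n)%N -> 0 <= d ->
  Hspace a d F -> F != cst 0 -> 0 < fine (weighted_sqnorm a F).
Proof.
move=> n0 d0 /Hspace_growth[dF gF fF] F0; apply: fine_gt0; rewrite fF andbT.
exact: weighted_sqnorm_gt0 gF F0.
Qed.

Lemma moll_at0 n c m : moll c m (0 : Cn R n) = 1.
Proof. by rewrite /moll big1// => i _; rewrite mxE mulr0 /csinc eqxx expr1n. Qed.

Lemma moll_neq0 n c m : (@moll R n c m : Cn R n -> C) != cst 0.
Proof.
apply/eqP => /(congr1 (fun f => f 0)); rewrite moll_at0 => /eqP.
by rewrite oner_eq0.
Qed.

Lemma Hspace_nonzero n (a d : R) : (0 < n)%N -> -1 < a -> 0 < d ->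
  exists2 F : Cn R n -> C, Hspace a d F & F != cst 0.
Proof.
(* [moll_finite] needs 2b + 2 - n >= 0, so the exponent is raised to b >= n and lowered again by
   [Hspace_le]; c makes the type bound exactly d. *)
move=> n0 a1 d0; pose b := Num.max a n%:R; pose k := (Num.truncn (2 * b + 2)).+1.
pose c := d / (k.+1 * n)%:R.
have c0 : 0 < c by rewrite divr_gt0// ltr0n muln_gt0.
exists (moll c k.+1); last exact: moll_neq0.
apply: (@Hspace_le _ b) => //; first by rewrite /b le_max lexx.
  exact: ltW.
apply: HspaceP; first exact: entire_moll.
  apply: (growthS (d := c * (k.+1 * n)%:R)); last by apply: growth_moll; exact: ltW.
  by rewrite /c divfK// gt_eqF// ltr0n muln_gt0.
have bn : n%:R <= b by rewrite /b le_max lexx orbT.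
have n0' : 0 <= n%:R :> R by rewrite ler0n.
apply: moll_finite => //; first by lra.
have := @truncnS_gt R (2 * b + 2); rewrite -/k natrM.
have : 0 <= k%:R :> R by rewrite ler0n.
lra.
Qed.

Notation N a F := (fine (weighted_sqnorm a F)).

Lemma fine_sqnorm_ge0 n (a : R) (F : Cn R n -> C) : 0 <= N a F.
Proof. by rewrite fine_ge0// weighted_sqnorm_ge0. Qed.

Lemma EP1_lbound n (a b d : R) : has_lbound
  [set N a F / N b F | F in Hspace a d `\ (cst 0 : Cn R n -> C)].
Proof. by exists 0 => _ [F _ <-]; rewrite divr_ge0// fine_sqnorm_ge0. Qed.

Lemma EP1_le n (a b d : R) (F : Cn R n -> C) : Hspace a d F -> F != cst 0 ->
  EP1 a b n d <= N a F / N b F.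
Proof.
move=> hF F0; apply: ge_inf; first exact: EP1_lbound.
by exists F => //; split => // /eqP; exact/negP.
Qed.

Lemma EP1_ge n (a b d : R) x : (0 < n)%N -> -1 < a -> 0 < d ->
  (forall F : Cn R n -> C, Hspace a d F -> F != cst 0 -> x <= N a F / N b F) -> x <= EP1 a b n d.
Proof.
move=> n0 a1 d0 H; have [F hF F0] := Hspace_nonzero n0 a1 d0; apply: lb_le_inf.
  by exists (N a F / N b F), F => //; split => // /eqP; exact/negP.
by move=> _ [G [hG G0] <-]; apply: H => //; apply/eqP.
Qed.

Lemma EP1_scale_le n (a b l d : R) : (0 < n)%N -> -1 < a -> 0 < d -> 0 < l ->
  EP1 a b n (l * d) * l `^ (2 * (a - b)) <= EP1 a b n d.
Proof.
move=> n0 a1 d0 l0; apply: EP1_ge => // F hF F0.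
have [dF gF fF] := Hspace_growth hF.
pose G : Cn R n -> C := fun z => F ((l%:C : C) *: z).
have dG : entire G by exact: entire_scale.
(* This holds for infinite norms too, where [fine] gives 0 on both sides; so no relation between a
   and b is required. *)
have NG c : N c F = l `^ (2 * c + 2) * N c G.
  rewrite (weighted_sqnorm_scale c n0 l0 dF) -/G.
  have := weighted_sqnorm_ge0 c G; case: (weighted_sqnorm c G) => [r| |]//= _.
  by rewrite mulry gtr0_sg ?powR_gt0// mul1e/= mulr0.
have G0 : G != cst 0.
  apply: contra_neq F0 => G0; apply/funext => z.
  have := congr1 (fun f => f ((l^-1%:C : C) *: z)) G0.
  rewrite /G scalerA -(rmorphM (real_complex R)) mulfV ?gt_eqF//.
  by rewrite scale1r.
have fG : (weighted_sqnorm a G < +oo)%E.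
  move: fF; rewrite (weighted_sqnorm_scale a n0 l0 dF) -/G.
  have := weighted_sqnorm_ge0 a G; case: (weighted_sqnorm a G) => [r| |]//= _; rewrite ?ltry//.
  by rewrite mulry gtr0_sg ?powR_gt0// mul1e.
have hG : Hspace a (l * d) G by apply: HspaceP => //; exact: growth_scale.
have ratioM (x y z p q r : R) : 0 <= r -> r = p / q -> z <= x / y -> z * r <= (p * x) / (q * y).
  by move=> r0 rE zxy; rewrite -mulf_div -rE mulrC ler_wpM2l.
rewrite !NG; apply: ratioM (powR_ge0 _ _) _ (EP1_le b hG G0).
rewrite -powRN -powRD ?(gt_eqF l0) ?implybT//; congr (_ `^ _); ring.
Qed.

(** The reverse inequality is [EP1_scale_le] with the inverse dilation. *)
Lemma EP1_scale n (a b l : R) : (0 < n)%N -> -1 < a -> 0 < l ->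
  EP1 a b n l = l `^ (- (2 * (a - b))) * EP1 a b n 1.
Proof.
move=> n0 a1 l0; have p0 : 0 < l `^ (2 * (a - b)) by rewrite powR_gt0.
have h1 := @EP1_scale_le n a b l 1 n0 a1 ltr01 l0.
have li0 : 0 < l^-1 by rewrite invr_gt0.
have := @EP1_scale_le n a b l^-1 l n0 a1 l0 li0.
rewrite mulVf ?gt_eqF// -(powR_inv1 (ltW l0)) -powRrM mulN1r powRN => h2.
apply/eqP; rewrite eq_le; apply/andP; split.
  by rewrite mulrC ler_pdivlMr//; rewrite mulr1 in h1.
by rewrite mulrC.
Qed.
End comparison.

(** * Pointwise inequalities between weights *)

Section powers.
Context {R : realType}.
Implicit Types t s r e k : R.

Lemma weight_split t a b n : 0 < t ->
  t `^ (2 * a + 2 - n) = t `^ (2 * b + 2 - n) * t `^ (2 * (a - b)).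
Proof.
move=> t0; rewrite -powRD ?(gt_eqF t0) ?implybT//; congr (_ `^ _); ring.
Qed.

Lemma powR_le_near0 r t s tau e : 0 < r -> r <= t -> t <= 1 -> `|s| <= tau -> 0 <= e ->
  1 <= (1 + e) * r `^ (2 * tau) -> t `^ (2 * s) <= 1 + e.
Proof.
move=> r0 rt t1 st e0 H; have t0 := lt_le_trans r0 rt.
have [s1 s2] : - tau <= s /\ s <= tau by apply/andP; rewrite -ler_norml.
have tau0 : 0 <= tau := le_trans (normr_ge0 s) st.
have h1 : r `^ (2 * tau) <= t `^ (2 * tau).
  by apply: ge0_ler_powR; rewrite ?nnegrE ?(ltW r0) ?(ltW t0) ?mulr_ge0.
have h2 : t `^ (2 * s) * t `^ (2 * tau) <= 1.
  rewrite -powRD ?(gt_eqF t0) ?implybT// -[leRHS](powRr0 t).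
  by apply: ger_powR; [rewrite t0|lra].
apply: (@le_trans _ _ (t `^ (2 * s) * ((1 + e) * t `^ (2 * tau)))).
  rewrite ler_peMr ?powR_ge0// (le_trans H)// ler_wpM2l//; lra.
by rewrite mulrCA -[leRHS]mulr1 ler_wpM2l//; lra.
Qed.

Lemma powR_le_ge1 t s tau k e : 1 <= t -> t <= k -> `|s| <= tau ->
  k `^ (2 * tau) <= 1 + e -> t `^ (2 * s) <= 1 + e.
Proof.
move=> t1 tk st H; have [s1 s2] : - tau <= s /\ s <= tau by apply/andP; rewrite -ler_norml.
have tau0 : 0 <= tau := le_trans (normr_ge0 s) st.
apply: le_trans H; apply: (@le_trans _ _ (t `^ (2 * tau))).
  by apply: ler_powR => //; lra.
by apply: ge0_ler_powR; rewrite ?nnegrE ?mulr_ge0//; lra.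
Qed.

(** On the compact range [r, k] a change of exponent by at most tau costs at most a factor 1 + e.
    The two hypotheses on tau are those supplied by [powR_near1], after r and k have been fixed. *)
Lemma powR_le_mid r t s tau e k : 0 < r -> r <= t -> t <= k -> `|s| <= tau -> 0 <= e ->
  1 <= (1 + e) * r `^ (2 * tau) -> k `^ (2 * tau) <= 1 + e -> t `^ (2 * s) <= 1 + e.
Proof.
move=> r0 rt tk st e0 H1 H2; have [t1|/ltW t1] := leP t 1.
  exact: powR_le_near0 r0 rt t1 st e0 H1.
exact: powR_le_ge1 t1 tk st H2.
Qed.

(* For t > k the decay of m, m t^2 <= k^2, makes up for the excess t^(2(a'-a)). *)
Lemma weight_upper (t m a a' g n r tau e k kap : R) : 0 < t -> 0 <= m -> m <= 1 ->
  m * t ^+ 2 <= k ^+ 2 ->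
  1 <= k -> 0 < r -> r <= 1 -> `|a' - a| <= tau -> tau <= 1 -> 0 <= e ->
  1 <= (1 + e) * r `^ (2 * tau) -> k `^ (2 * tau) <= 1 + e -> 0 <= kap -> kap <= a' - g ->
  m * t `^ (2 * a' + 2 - n) <=
  (1 + e) * t `^ (2 * a + 2 - n) + r `^ (2 * kap) * t `^ (2 * g + 2 - n).
Proof.
move=> t0 m0 m1 mt k1 r0 r1 aa tau1 e0 H1 H2 kap0 kg.
have [tr|rt] := ltP t r.
  rewrite (@weight_split t a' g)// ler_wpDl ?mulr_ge0 ?powR_ge0//; first lra.
  rewrite [r `^ _ * _]mulrC (@le_trans _ _ (t `^ (2 * g + 2 - n) * t `^ (2 * (a' - g))))//.
    by rewrite ler_piMl// mulr_ge0 ?powR_ge0.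
  rewrite ler_wpM2l ?powR_ge0// (@le_trans _ _ (t `^ (2 * kap)))//.
    by apply: ger_powR; [rewrite t0/=; lra|lra].
  by apply: ge0_ler_powR; rewrite ?nnegrE ?mulr_ge0//; exact: ltW.
rewrite (@weight_split t a' a)// ler_wpDr ?mulr_ge0 ?powR_ge0//.
rewrite mulrCA mulrC ler_wpM2r ?powR_ge0//.
have [tk|/ltW kt] := leP t k.
  apply: (@le_trans _ _ (t `^ (2 * (a' - a)))); first by rewrite ler_piMl ?powR_ge0.
  exact: powR_le_mid r0 rt tk aa e0 H1 H2.
have k0 : 0 < k by lra.
have [s1 s2] : - tau <= a' - a /\ a' - a <= tau by apply/andP; rewrite -ler_norml.
have [s0|s0] := leP (a' - a) 0.
  apply: (@le_trans _ _ 1); last by rewrite lerDl.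
  rewrite -[leRHS]mulr1 ler_pM ?powR_ge0// -[leRHS](powRr0 t).
  by apply: ler_powR; lra.
have v1 : 1 <= t / k by rewrite ler_pdivlMr// mul1r.
have -> : t `^ (2 * (a' - a)) = k `^ (2 * (a' - a)) * (t / k) `^ (2 * (a' - a)).
  rewrite -powRM ?(ltW k0) ?divr_ge0 ?(ltW t0) ?(ltW k0)//; congr (_ `^ _).
  by rewrite mulrC divfK ?gt_eqF.
have h1 : k `^ (2 * (a' - a)) <= 1 + e.
  by apply: le_trans H2; apply: ler_powR => //; lra.
have h2 : (t / k) `^ (2 * (a' - a)) <= (t / k) ^+ 2.
  by rewrite -powR_mulrn ?divr_ge0 ?(ltW t0) ?(ltW k0)//; apply: ler_powR => //; lra.
have h3 : m * (t / k) ^+ 2 <= 1.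
  by rewrite expr_div_n mulrA ler_pdivrMr ?exprn_gt0// mul1r.
rewrite mulrCA -[leRHS]mulr1 ler_pM ?mulr_ge0 ?powR_ge0//.
by apply: le_trans h3; rewrite ler_wpM2l.
Qed.

(** One summand per range of t: on [r, k] the mollified weight b', below r the weight g, and above k
    the weight a, which exceeds the weight b there by a factor t^(2(a-b)) >= k^(2c). The last term
    is useful only when c > 0, that is off the diagonal. *)
Lemma weight_lower (t m a b b' g n r tau e k kap c : R) : 0 < t -> 0 <= m -> (t <= k ->
  1 - e <= m) ->
  e < 1 -> 1 <= k -> 0 < r -> r <= 1 -> `|b' - b| <= tau -> 0 <= e ->
  1 <= (1 + e) * r `^ (2 * tau) -> k `^ (2 * tau) <= 1 + e -> 0 <= kap -> kap <= b - g ->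
  0 <= c -> c <= a - b ->
  t `^ (2 * b + 2 - n) <= (1 + e) / (1 - e) * (m * t `^ (2 * b' + 2 - n)) +
    r `^ (2 * kap) * t `^ (2 * g + 2 - n) + (k `^ (2 * c))^-1 * t `^ (2 * a + 2 - n).
Proof.
move=> t0 m0 mt e1 k1 r0 r1 bb e0 H1 H2 kap0 kg c0 ca.
have e10 : 0 < 1 - e by lra.
have k0 : 0 < k by lra.
have p1 : 0 <= (1 + e) / (1 - e) * (m * t `^ (2 * b' + 2 - n)).
  by rewrite mulr_ge0 ?mulr_ge0 ?powR_ge0 ?invr_ge0//; lra.
have p2 : 0 <= r `^ (2 * kap) * t `^ (2 * g + 2 - n) by rewrite mulr_ge0 ?powR_ge0.
have p3 : 0 <= (k `^ (2 * c))^-1 * t `^ (2 * a + 2 - n) by rewrite mulr_ge0 ?invr_ge0 ?powR_ge0.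
have [tr|rt] := ltP t r.
  suff : t `^ (2 * b + 2 - n) <= r `^ (2 * kap) * t `^ (2 * g + 2 - n) by lra.
  rewrite (@weight_split t b g)// [leRHS]mulrC.
  rewrite ler_wpM2l ?powR_ge0// (@le_trans _ _ (t `^ (2 * kap)))//.
    by apply: ger_powR; [rewrite t0/=; lra|lra].
  by apply: ge0_ler_powR; rewrite ?nnegrE ?mulr_ge0//; exact: ltW.
have [tk|kt] := leP t k.
  suff : t `^ (2 * b + 2 - n) <= (1 + e) / (1 - e) * (m * t `^ (2 * b' + 2 - n)) by lra.
  rewrite (@weight_split t b b')//.
  have h : t `^ (2 * (b - b')) <= 1 + e.
    by apply: powR_le_mid r0 rt tk _ e0 H1 H2; rewrite distrC.
  rewrite mulrA [leRHS]mulrC ler_wpM2l ?powR_ge0// (le_trans h)//.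
  rewrite -mulrA ler_peMr//; first lra.
  by rewrite mulrC ler_pdivlMr// mul1r mt.
suff : t `^ (2 * b + 2 - n) <= (k `^ (2 * c))^-1 * t `^ (2 * a + 2 - n) by lra.
rewrite (@weight_split t a b)// mulrCA ler_peMr ?powR_ge0//.
rewrite mulrC ler_pdivlMr ?powR_gt0// mul1r.
apply: (@le_trans _ _ (t `^ (2 * c))); last by apply: ler_powR; lra.
by apply: ge0_ler_powR; rewrite ?nnegrE ?mulr_ge0//; lra.
Qed.

(** No term at infinity is needed: for t >= 1 the weight b is below the weight a. This gives the
    lower bound for EP1 near the diagonal. *)
Lemma weight_near (t a b g n r tau e kap : R) : 0 < t -> 0 < r -> r <= 1 -> b <= a ->
  a - b <= tau -> 0 <= e ->
  1 <= (1 + e) * r `^ (2 * tau) -> 0 <= kap -> kap <= b - g ->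
  t `^ (2 * b + 2 - n) <= (1 + e) * t `^ (2 * a + 2 - n) + r `^ (2 * kap) * t `^ (2 * g + 2 - n).
Proof.
move=> t0 r0 r1 ba ab e0 H kap0 kg.
have [tr|rt] := ltP t r.
  rewrite ler_wpDl ?mulr_ge0 ?powR_ge0//; first lra.
  rewrite (@weight_split t b g)// [leRHS]mulrC.
  rewrite ler_wpM2l ?powR_ge0// (@le_trans _ _ (t `^ (2 * kap)))//.
    by apply: ger_powR; [rewrite t0/=; lra|lra].
  by apply: ge0_ler_powR; rewrite ?nnegrE ?mulr_ge0//; exact: ltW.
rewrite ler_wpDr ?mulr_ge0 ?powR_ge0// (@weight_split t b a)// [leRHS]mulrC.
rewrite ler_wpM2l ?powR_ge0//; have [t1|/ltW t1] := leP t 1.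
  by apply: powR_le_near0 r0 rt t1 _ e0 H; rewrite distrC ger0_norm//; lra.
apply: (@le_trans _ _ 1); last by rewrite lerDl.
by rewrite -[leRHS](powRr0 t); apply: ler_powR => //; lra.
Qed.

(** For a fixed test function in a smaller space H_a1: the tail costs a factor k^-2 because a1
    exceeds a by at least 1. *)
Lemma weight_far (t a b a1 n k : R) : 0 < t -> 1 <= k -> b <= a -> a + 1 <= a1 ->
  t `^ (2 * a + 2 - n) <= k `^ (2 * (a - b)) * t `^ (2 * b + 2 - n) + (k ^+ 2)^-1 * t `^ (2 * a1 +
    2 - n).
Proof.
move=> t0 k1 ba aa; have k0 : 0 < k by lra.
have [tk|/ltW kt] := leP t k.
  rewrite ler_wpDr ?mulr_ge0 ?powR_ge0 ?invr_ge0 ?sqr_ge0//.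
  rewrite (@weight_split t a b)// mulrC ler_wpM2r ?powR_ge0//.
  by apply: ge0_ler_powR; rewrite ?nnegrE; lra.
rewrite ler_wpDl ?mulr_ge0 ?powR_ge0//.
rewrite (@weight_split t a1 a)// mulrCA ler_peMr ?powR_ge0//.
rewrite mulrC ler_pdivlMr ?exprn_gt0// mul1r.
apply: (@le_trans _ _ (t ^+ 2)); first by apply: lerXn2r; rewrite ?nnegrE; lra.
by rewrite -powR_mulrn ?(ltW t0)//; apply: ler_powR; lra.
Qed.

Lemma powR_small k y : 0 < k -> 0 < y -> exists r : R, [/\ 0 < r, r <= 1 & r `^ k <= y].
Proof.
move=> k0 y0; exists (Num.min 1 (y `^ k^-1)); split.
- by rewrite lt_min ltr01 powR_gt0.
- by rewrite ge_min lexx.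
have p : y = (y `^ k^-1) `^ k by rewrite -powRrM mulVf ?gt_eqF// powRr1// ltW.
rewrite [leRHS]p; apply: ge0_ler_powR; rewrite ?nnegrE ?powR_ge0 ?(ltW k0)//.
  by rewrite le_min ler01 powR_ge0.
by rewrite ge_min lexx orbT.
Qed.

Lemma powR_large k y : 0 < k -> exists2 r : R, 1 <= r & y <= r `^ k.
Proof.
move=> k0; have y0 : 0 < (`|y| + 1)^-1 by rewrite invr_gt0 ltr_wpDl.
have [r [r0 r1 rk]] := powR_small k0 y0; exists r^-1; first by rewrite invf_ge1.
rewrite -powR_inv1 ?(ltW r0)// -powRrM mulN1r powRN.
apply: (@le_trans _ _ (`|y| + 1)); first by rewrite (le_trans (ler_norm _))// lerDl.
by rewrite -[leLHS]invrK lef_pV2// posrE powR_gt0.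
Qed.

Lemma powR_near1 x e : 0 < x -> 0 < e -> exists2 tau0 : R, 0 < tau0 &
  forall tau, 0 <= tau -> tau <= tau0 -> x `^ (2 * tau) <= 1 + e /\ 1 <= (1 + e) * x `^ (2 * tau).
Proof.
move=> x0 e0; have l0 : 0 < ln (1 + e) by rewrite ln_gt0// ltrDl.
have d0 : 0 < 2 * (`|ln x| + 1) by rewrite mulr_gt0// ltr_wpDl.
exists (ln (1 + e) / (2 * (`|ln x| + 1))); first by rewrite divr_gt0.
move=> tau t0; rewrite ler_pdivlMr// => H.
have e1 : 0 < 1 + e by lra.
have h : `|2 * tau * ln x| <= ln (1 + e).
  apply: le_trans H; rewrite normrM ger0_norm ?mulr_ge0//.
  have := normr_ge0 (ln x); nra.
have [h1 h2] : - ln (1 + e) <= 2 * tau * ln x /\ 2 * tau * ln x <= ln (1 + e).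
  by apply/andP; rewrite -ler_norml.
rewrite /powR gt_eqF//; split.
  by rewrite -[leRHS]lnK ?posrE// ler_expR.
rewrite -[X in _ <= X * _]lnK ?posrE// -expRD -[leLHS]expR0 ler_expR; lra.
Qed.

End powers.

(** * Quotients of norms before and after mollification *)

Section local_bounds.
Context {R : realType}.
Notation C := (R[i]^o).
Notation N a F := (fine (weighted_sqnorm a F)).

(** Here x, y stand for the norms of F with weights a, b, and X, Y for those of the mollified
    function with weights a', b'. The outer factor 1 + e is reserved for the dilation back to type
    1; E is the infimum, and B makes the error independent of it. *)
Lemma ratio_bound (e B E x y X Y : R) : 0 < e -> e <= 1 / 10 -> 0 <= E -> E <= B -> 0 < y ->
  0 <= x ->
  x <= (E + e) * y -> X <= (1 + e) * x + e * y -> y <= (1 + e) / (1 - e) * Y + e * y + e * y ->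
  (1 + e) * (X / Y) <= E + e * (12 * B + 6).
Proof.
move=> e0 e1 E0 EB y0 x0 xy hX hY.
have hY' : (1 - e) * (1 - 2 * e) * y <= (1 + e) * Y.
  have e10 : 0 < 1 - e by lra.
  have : (1 - 2 * e) * y <= (1 + e) / (1 - e) * Y by lra.
  rewrite mulrAC ler_pdivlMr//; lra.
have p0 : 0 < (1 - e) * (1 - 2 * e) by rewrite mulr_gt0; lra.
have Y0 : 0 < Y.
  have : 0 < (1 + e) * Y by apply: lt_le_trans hY'; rewrite mulr_gt0.
  by rewrite pmulr_rgt0//; lra.
rewrite mulrA ler_pdivrMr//.
set T := E + _.
have T0 : 0 <= T by rewrite addr_ge0// mulr_ge0//; lra.
have e10 : 0 < 1 + e by lra.
rewrite -(ler_pM2l e10).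
have h1 : X <= ((1 + e) * (E + e) + e) * y.
  have : (1 + e) * x <= (1 + e) * ((E + e) * y) by rewrite ler_pM2l.
  lra.
apply: (@le_trans _ _ (T * ((1 - e) * (1 - 2 * e) * y))); last first.
  by rewrite [leRHS]mulrCA ler_wpM2l.
apply: (@le_trans _ _ ((1 + e) * ((1 + e) * (((1 + e) * (E + e) + e) * y)))).
  by rewrite !ler_pM2l.
rewrite !mulrA ler_pM2r//.
have hT : E + e * (12 * E + 6) <= T.
  by rewrite /T lerD2l ler_pM2l//; lra.
apply: (@le_trans _ _ ((E + e * (12 * E + 6)) * ((1 - e) * (1 - 2 * e)))); last first.
  by rewrite -mulrA ler_wpM2r// ltW.
(* The difference of the two sides, split into the terms with and without E; both are nonnegative
   for e <= 1/10. *)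
have q1 : 0 <= E * (e * (6 - 37 * e + 23 * e ^+ 2)).
  apply: mulr_ge0 => //; apply: mulr_ge0; first exact: ltW.
  by have := sqr_ge0 e; lra.
have q2 : 0 <= e * (6 * ((1 - e) * (1 - 2 * e)) - (1 + e) ^+ 2 * (2 + e)).
  apply: mulr_ge0; first exact: ltW.
  have h3 : (1 + e) ^+ 2 * (2 + e) <= (11 / 10) ^+ 2 * (21 / 10).
    apply: ler_pM; rewrite ?sqr_ge0//; [lra| |lra].
    by apply: lerXn2r; rewrite ?nnegrE; lra.
  have := sqr_ge0 e; rewrite expr2; lra.
rewrite -subr_ge0; apply: le_trans (addr_ge0 q1 q2) _.
by rewrite le_eqVlt; apply/orP; left; apply/eqP; ring.
Qed.

(** Adds z, the norm of weight g, controlled by C0 * y. The smallness of rk = r^(2 kap) handles the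
    region near 0, the size of kc = k^(2c) the one at infinity. The conclusion 0 < Y also shows that
    the competitor is not zero. *)
Lemma ratio_bound_comb (e B E x y z X Y C0 rk kc eps : R) : 0 < e -> e <= 1 / 10 -> 0 <= E ->
  E <= B ->
  0 < y -> 0 <= x -> 0 < C0 -> 0 <= rk -> 0 < kc -> x <= (E + e) * y -> z <= C0 * y ->
    rk <= e / C0 ->
  (B + 1) / e <= kc -> X <= (1 + e) * x + rk * z ->
  y <= (1 + e) / (1 - e) * Y + rk * z + kc^-1 * x -> e * (12 * B + 6) <= eps ->
  0 < Y /\ (1 + e) * (X / Y) <= E + eps.
Proof.
move=> e0 e1 E0 EB y0 x0 C00 rk0 kc0 hx hz hrk hkc hX hY heps.
have h1 : rk * z <= e * y.
  apply: (@le_trans _ _ (rk * (C0 * y))); first by rewrite ler_wpM2l.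
  by rewrite mulrA ler_pM2r// -ler_pdivlMr.
have h2 : kc^-1 * x <= e * y.
  rewrite mulrC ler_pdivrMr//; apply: (le_trans hx).
  rewrite mulrAC ler_pM2r//; move: hkc; rewrite ler_pdivrMr// mulrC; lra.
have hY' : y <= (1 + e) / (1 - e) * Y + e * y + e * y.
  by apply: (le_trans hY); rewrite lerD// lerD2l.
split; last first.
  apply: (@le_trans _ _ (E + e * (12 * B + 6))); last by rewrite lerD2l.
  by apply: ratio_bound hx _ hY' => //; apply: (le_trans hX); rewrite lerD2l.
have h3 : 0 < (1 - 2 * e) * y by rewrite mulr_gt0//; lra.
have : 0 < (1 + e) / (1 - e) * Y by lra.
by rewrite pmulr_rgt0// divr_gt0//; lra.
Qed.

Lemma ratio_le_comb (x y z w p q C0 : R) : 0 <= q -> 0 <= w -> 0 < y -> 0 < z -> z <= C0 * y ->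
  x <= p * y + q * w -> x / y <= p + q * (C0 * w / z).
Proof.
move=> q0 w0 y0 z0 hz hx; rewrite ler_pdivrMr//; apply: (le_trans hx).
rewrite [leRHS]mulrDl lerD2l -[leRHS]mulrA; apply: (ler_wpM2l q0).
rewrite mulrAC ler_pdivlMr// mulrAC [leRHS]mulrC.
exact: ler_wpM2l.
Qed.

Lemma fine_sqnorm_dominated n (g b1 : R) : (0 < n)%N -> -1 < g ->
  exists2 C0 : R, 0 < C0 & forall b, g <= b -> b <= b1 ->
  forall F : Cn R n -> C, Hspace b 1 F -> N g F <= C0 * N b F.
Proof.
move=> n0 g1; have [C0 C00 H] := @weighted_sqnorm_dominated R n g b1 1 n0 g1 ler01.
exists C0 => // b gb bb F /Hspace_growth[dF gF fF].
have := H b gb bb F dF gF.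
have fb : weighted_sqnorm b F \is a fin_num by rewrite ge0_fin_numE// weighted_sqnorm_ge0.
rewrite -(fineK fb) -EFinM => h; have f0 := le_lt_trans h (ltry _).
have fg : weighted_sqnorm g F \is a fin_num by rewrite ge0_fin_numE// weighted_sqnorm_ge0.
exact: (@fine_le _ _ _%:E fg isT h).
Qed.

(** One test function from H_(a0+2) serves all nearby (a, b), so A is uniform. The free parameter k
    has two uses: k = 1 gives local boundedness, and a large k gives the upper limit 1 on the
    diagonal. *)
Lemma EP1_upper n (a0 b0 g : R) : (0 < n)%N -> -1 < g -> g <= b0 -> b0 <= a0 ->
  exists2 A : R, 0 <= A & forall a b k, g <= b -> b <= b0 + 1 -> b <= a -> a <= a0 + 1 -> 1 <= k ->
  EP1 a b n 1 <= k `^ (2 * (a - b)) + (k ^+ 2)^-1 * A.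
Proof.
move=> n0 g1 gb0 ba0.
have [C0 C00 HC] := @fine_sqnorm_dominated n g (b0 + 1) n0 g1.
have a01 : -1 < a0 + 2 by lra.
have [G hG G0] := @Hspace_nonzero R n _ _ n0 a01 ltr01.
have H c : g <= c -> c <= a0 + 2 -> Hspace c 1 G.
  by move=> gc ca; apply: Hspace_le hG => //; lra.
have ga : g <= a0 + 2 by lra.
have Ng := Hspace_fine_gt0 n0 ler01 (H g (lexx g) ga) G0.
exists (C0 * N (a0 + 2) G / N g G); first by rewrite divr_ge0 ?mulr_ge0 ?fine_sqnorm_ge0// ltW.
move=> a b k gb bb ba aa k1.
have Ha : Hspace a 1 G by apply: H; lra.
have Hb : Hspace b 1 G by apply: H; lra.
have [dG _ fG] := Hspace_growth hG.
have [_ _ fa] := Hspace_growth Ha; have [_ _ fb] := Hspace_growth Hb.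
have Nb : 0 < N b G by apply: Hspace_fine_gt0 Hb G0.
have p2 : 0 <= (k ^+ 2)^-1 by rewrite invr_ge0 sqr_ge0.
have aa1 : a + 1 <= a0 + 2 by clear -aa; lra.
have [|_ h] := @weighted_sqnorm_comb2 R n a b (a0 + 2) (k `^ (2 * (a - b))) (k ^+ 2)^-1 G G G
  n0 dG dG dG (powR_ge0 _ _) p2 _ fb fG.
  move=> x x0; rewrite mulrCA [X in _ <= _ + X]mulrCA -mulrDr.
  by rewrite ler_wpM2l ?sqf_ge0//; exact: weight_far.
apply: (le_trans (EP1_le b Ha G0)).
exact: ratio_le_comb p2 (fine_sqnorm_ge0 _ _) Nb Ng (HC b gb bb G Hb) h.
Qed.

(** Two radii occur: up to k the mollifier is close to 1, and beyond K >= n / eps its decay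
    compensates t^(2(a'-a)). The first inequality rests on [weight_upper] with K, the second on
    [weight_lower] with k. *)
Lemma mollified_comparison n (a b a' b' g r tau e k K kap c eps : R) (F : Cn R n ->
  C) : (0 < n)%N -> -1 < g ->
  Hspace a 1 F -> g <= b -> b <= a -> g <= b' -> b' <= a' ->
  0 < eps -> n%:R / eps <= K -> 1 <= K ->
  (forall x : Rn R n, enorm x <= k -> 1 - e <= normc (moll eps 1 (Rn_to_Cn x)) ^+ 2) ->
  0 < e -> e < 1 -> 1 <= k -> 0 < r -> r <= 1 ->
  `|a' - a| <= tau -> `|b' - b| <= tau -> tau <= 1 ->
  1 <= (1 + e) * r `^ (2 * tau) -> k `^ (2 * tau) <= 1 + e -> K `^ (2 * tau) <= 1 + e ->
  0 <= kap -> kap <= b - g -> kap <= a' - g -> 0 <= c -> c <= a - b ->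
  exists H : Cn R n -> C, [/\ Hspace a' (1 + eps * n%:R) H,
    N a' H <= (1 + e) * N a F + r `^ (2 * kap) * N g F &
    N b F <= (1 + e) / (1 - e) * N b' H + r `^ (2 * kap) * N g F + (k `^ (2 * c))^-1 * N a F].
Proof.
move=> n0 g1 hF gb ba gb' ba' eps0 epsK K1 M1 e0 e1 k1 r0 r1 aa bb tau1 Hr Hk HK kap0 kb ka c0 ca.
have [dF gF fF] := Hspace_growth hF.
pose m := @moll R n eps 1; have dm : entire m by exact: entire_moll.
pose H : Cn R n -> C := fun z => F z * m z : C.
have dH : entire H by move=> z; apply: cdiffM; [exact: dF|exact: dm].
have gH : growth (1 + eps * n%:R) H.
  by apply: growth_mul => //; rewrite -[n in n%:R]mul1n; apply: growth_moll; exact: ltW.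
have sH x : sqf H x = sqf F x * normc (m (Rn_to_Cn x)) ^+ 2.
  by rewrite /sqf /H normcM exprMn.
have [_ _ fb] := Hspace_growth (Hspace_le n0 (lt_le_trans g1 gb) ba ler01 hF).
have [_ _ fg] := Hspace_growth (Hspace_le n0 g1 (le_trans gb ba) ler01 hF).
have r2 : 0 <= r `^ (2 * kap) by exact: powR_ge0.
have e10 : 0 <= 1 + e by lra.
have [|fH hH] := @weighted_sqnorm_comb2 R n a' a g (1 + e) (r `^ (2 * kap)) H F F
  n0 dH dF dF e10 r2 _ fF fg.
  move=> x x0; rewrite mulrCA [X in _ <= _ + X]mulrCA -mulrDr sH -mulrA.
  rewrite ler_wpM2l ?sqf_ge0//.
  apply: (@weight_upper _ _ _ _ _ _ _ _ tau e K) => //; rewrite ?sqr_ge0 ?(ltW e0)//.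
    by apply: exprn_ile1; [exact: normc_ge0|exact: moll_le1].
  rewrite -exprMn; apply: lerXn2r; rewrite ?nnegrE ?mulr_ge0 ?normc_ge0 ?(ltW x0)//; first lra.
  by rewrite mulrC; apply: le_trans epsK; exact: moll_decay.
have hH' : Hspace a' (1 + eps * n%:R) H by apply: HspaceP.
have d0 : 0 <= 1 + eps * n%:R by rewrite addr_ge0// mulr_ge0// ltW.
have [_ _ fb'] := Hspace_growth (Hspace_le n0 (lt_le_trans g1 gb') ba' d0 hH').
have c10 : 0 <= (1 + e) / (1 - e) by rewrite divr_ge0// subr_ge0 ltW.
have k2 : 0 <= (k `^ (2 * c))^-1 by rewrite invr_ge0 powR_ge0.
have [|_] := @weighted_sqnorm_comb R n b b' g a _ _ _ F H F F n0 dF dH dF dF c10 r2 k2 _ fb' fg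
  fF; last first.
  by move=> hF'; exists H; split; [exact: hH'|exact: hH|exact: hF'].
move=> x x0; rewrite sH.
have := @weight_lower R (enorm x) (normc (m (Rn_to_Cn x)) ^+ 2) a b b' g n%:R r tau e k kap c
  x0 (sqr_ge0 _) (M1 x) e1 k1 r0 r1 bb (ltW e0) Hr Hk kap0 kb c0 ca.
move=> /(ler_wpM2l (sqf_ge0 F x)) /le_trans; apply.
by rewrite le_eqVlt; apply/orP; left; apply/eqP; ring.
Qed.
End local_bounds.

(** * Continuity at type 1 *)

Section semicontinuity.
Context {R : realType}.
Notation C := (R[i]^o).
Notation N a F := (fine (weighted_sqnorm a F)).

Lemma EP1_ge0 n (a b d : R) : (0 < n)%N -> -1 < a -> 0 < d -> 0 <= EP1 a b n d.
Proof. by move=> n0 a1 d0; apply: EP1_ge => // F _ _; rewrite divr_ge0// fine_sqnorm_ge0. Qed.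

Lemma EP1_adherent n (a b d e : R) : (0 < n)%N -> -1 < b -> b <= a -> 0 < d -> 0 < e ->
  exists F : Cn R n -> C, [/\ Hspace a d F, F != cst 0,
    0 < N b F & N a F <= (EP1 a b n d + e) * N b F].
Proof.
move=> n0 b1 ba d0 e0; have a1 := lt_le_trans b1 ba.
have [G hG G0] := Hspace_nonzero n0 a1 d0.
have [|_ [F [hF /eqP F0] <-] FE] := @inf_adherent R [set N a F / N b F | F in Hspace a d `\ (cst 0
  : Cn R n -> C)] e e0.
  split; last exact: EP1_lbound.
  by exists (N a G / N b G), G => //; split => // /eqP; exact/negP.
have Nb := Hspace_fine_gt0 n0 (ltW d0) (Hspace_le n0 b1 ba (ltW d0) hF) F0.
by exists F; split => //; rewrite -ler_pdivrMr// ltW.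
Qed.

Lemma powR_oneD_le (x s e : R) : 0 <= x -> 0 <= s -> 0 < e -> x * s <= ln (1 + e) ->
  (1 + x) `^ s <= 1 + e.
Proof.
move=> x0 s0 e0 H; have e1 : 0 < 1 + e by lra.
apply: (@le_trans _ _ (expR x `^ s)).
  by apply: ge0_ler_powR; rewrite ?nnegrE ?expR_ge0 ?expR_ge1Dx//; lra.
by rewrite -expRM -[leRHS]lnK ?posrE// ler_expR.
Qed.

Lemma near_params (a0 b0 g kap c t a b a' b' : R) : -1 < g -> 0 < kap -> b0 - g = 2 * kap ->
  a0 - b0 = 2 * c ->
  0 < t -> 2 * t <= 1 -> t <= kap -> 2 * t <= c ->
  `|a - a0| <= t -> `|b - b0| <= t -> `|a' - a0| <= t -> `|b' - b0| <= t -> b <= a -> b' <= a' ->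
  [/\ [/\ `|a' - a| <= 2 * t, `|b' - b| <= 2 * t, g <= b & g <= b'],
      [/\ kap <= b - g, kap <= a' - g & c <= a - b],
      [/\ -1 < b, -1 < a & -1 < a'], b <= b0 + 1 /\ a <= a0 + 1 &
      0 <= 2 * (a' - b') /\ 2 * (a' - b') <= 2 * (a0 - b0 + 1)].
Proof.
rewrite !ler_norml => ? ? ? ? ? ? ? ? /andP[? ?] /andP[? ?] /andP[? ?] /andP[? ?] ? ?.
split; split; try lra; split; lra.
Qed.

(** The order of choices is what makes it work: e from eps, then r and k, the mollifier width m from
    k, the decay radius K from m, and the neighbourhood size t last, from r, k and K. None of them
    depends on the nearly extremal F. *)
Lemma EP1_near_lt n (a0 b0 eps : R) : (0 < n)%N -> -1 < b0 -> b0 < a0 -> 0 < eps ->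
  exists2 t : R, 0 < t & forall a b a' b', `|a - a0| <= t -> `|b - b0| <= t ->
  `|a' - a0| <= t -> `|b' - b0| <= t -> b <= a -> b' <= a' ->
  EP1 a' b' n 1 <= EP1 a b n 1 + eps.
Proof.
move=> n0 b01 ba0 eps0.
have [g [g1 gb0]] : exists g : R, -1 < g /\ g < b0 by exists ((b0 - 1) / 2); lra.
have [kap [kap0 kapE]] : exists kap : R, 0 < kap /\ b0 - g = 2 * kap by exists ((b0 - g) / 2); lra.
have [c [c0 cE]] : exists c : R, 0 < c /\ a0 - b0 = 2 * c by exists ((a0 - b0) / 2); lra.
have [C0 C00 HC] := @fine_sqnorm_dominated R n g (b0 + 1) n0 g1.
have [A A0 HA] := @EP1_upper R n a0 b0 g n0 g1 (ltW gb0) (ltW ba0).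
pose B := 1 + A; have B0 : 1 <= B by rewrite lerDl.
have [e [e0 e1 eB]] : exists e : R, [/\ 0 < e, e <= 1 / 10 & e * (12 * B + 6) <= eps].
  exists (Num.min (1 / 10) (eps / (12 * B + 6))); split.
  - by rewrite lt_min !divr_gt0//; lra.
  - by rewrite ge_min lexx.
  - by rewrite -ler_pdivlMr ?ge_min ?lexx ?orbT//; lra.
have [r [r0 r1 rC]] := @powR_small R (2 * kap) (e / C0) (mulr_gt0 (ltr0Sn _ 1) kap0) (divr_gt0 e0
  C00).
(* The tail k^(-2c) N a F is then at most e N b F, because N a F <= (E + e) N b F with E + e <= B +
   1. *)
have [k k1 kB] := @powR_large R (2 * c) ((B + 1) / e) (mulr_gt0 (ltr0Sn _ 1) c0).
have [m0 m00 Hm] := @moll_near1 R n e k e0.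
pose s := 2 * (a0 - b0 + 1); have s0 : 0 < s by rewrite /s; lra.
have nR0 : 0 < n%:R :> R by rewrite ltr0n.
have l0 : 0 < ln (1 + e) by rewrite ln_gt0// ltrDl.
(* Besides being close to 1 on |x| <= k, the mollifier must raise the type so little that the
   dilation factor (1 + m n)^(2(a'-b')) stays below 1 + e; [s] bounds that exponent. *)
have [m [mp mm mn]] : exists m : R, [/\ 0 < m, m <= m0 & m * n%:R * s <= ln (1 + e)].
  exists (Num.min m0 (ln (1 + e) / (n%:R * s))); split.
  - by rewrite lt_min m00 divr_gt0// mulr_gt0.
  - by rewrite ge_min lexx.
  - rewrite -mulrA -ler_pdivlMr; first by rewrite ge_min lexx orbT.
    exact: mulr_gt0.
have [K [K1 Kn]] : exists K : R, 1 <= K /\ n%:R / m <= K.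
  by exists (Num.max 1 (n%:R / m)); rewrite !le_max !lexx orbT.
have [tr tr0 Hr] := @powR_near1 R r e r0 e0.
have [tk tk0 Hk] := @powR_near1 R k e (lt_le_trans ltr01 k1) e0.
have [tK tK0 HK] := @powR_near1 R K e (lt_le_trans ltr01 K1) e0.
have [t [t0 [t1 t2 t3] [t4 t5 t6]]] : exists t : R, [/\ 0 < t, [/\ 2 * t <= tr,
  2 * t <= tk & 2 * t <= tK] &
    [/\ 2 * t <= 1, t <= kap & 2 * t <= c]].
  exists (Num.min (Num.min (Num.min tr tk) (Num.min tK 1)) (Num.min kap c) / 2).
  have h : 0 < Num.min (Num.min (Num.min tr tk) (Num.min tK 1)) (Num.min kap c).
    by rewrite !lt_min tr0 tk0 tK0 kap0 c0 ltr01.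
  set M := Num.min _ _ in h *.
  have : M <= M by [].
  rewrite {2}/M !le_min => /andP[/andP[/andP[q1 q2] /andP[q3 q4]] /andP[q5 q6]].
  have E : 2 * (M / 2) = M by rewrite mulrCA mulfV ?mulr1.
  have M2 : M / 2 <= M by rewrite ler_pdivrMr// ler_peMr ?(ltW h)// ler1n.
  by rewrite E; split; [rewrite divr_gt0|split|split => //; exact: le_trans q5].
exists t => // a b a' b' ha hb ha' hb' ba ba'.
have [[aa bb gb gb'] [kb ka ca] [b1 a1 a'1] [bB aA] [s1 s2]] :=
  near_params g1 kap0 kapE cE t0 t4 t5 t6 ha hb ha' hb' ba ba'.
have t20 : 0 <= 2 * t by rewrite mulr_ge0// ltW.
have k0 : 0 < k := lt_le_trans ltr01 k1.
have e11 : e < 1 by apply: le_lt_trans e1 _; rewrite ltr_pdivrMr// mul1r ltr1n.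
have [F [hF F0 Nb FE]] := @EP1_adherent n a b 1 e n0 b1 ba ltr01 e0.
have hbF := Hspace_le n0 b1 ba ler01 hF.
have EB : EP1 a b n 1 <= B.
  by have := HA a b 1 gb bB ba aA (lexx 1); rewrite powR1 expr1n invr1 mul1r.
have E0 := @EP1_ge0 n a b 1 n0 a1 ltr01.
have Hmk (x : Rn R n) : enorm x <= k -> 1 - e <= normc (moll m 1 (Rn_to_Cn x)) ^+ 2.
  exact: Hm.
have [H [hH HX HY]] := @mollified_comparison R n a b a' b' g r (2 * t) e k K kap c m F n0 g1 hF gb
  ba gb' ba'
  mp Kn K1 Hmk e0 e11 k1 r0 r1 aa bb t4
  (Hr _ t20 t1).2 (Hk _ t20 t2).1 (HK _ t20 t3).1 (ltW kap0) kb ka (ltW c0) ca.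
have [NY main] := ratio_bound_comb e0 e1 E0 EB Nb (fine_sqnorm_ge0 a F) C00 (powR_ge0 _ _)
  (powR_gt0 (2 * c) k0)
  FE (HC b gb bB F hbF) rC kB HX HY eB.
have H0 : H != cst 0.
  by apply: contraTneq NY => ->; rewrite weighted_sqnorm_cst0/= ltxx.
have l1 : 0 < 1 + m * n%:R by rewrite addr_gt0// mulr_gt0.
(* H has type 1 + m n; homogeneity turns the estimate for that type into one for type 1. *)
have := EP1_le b' hH H0; rewrite (EP1_scale _ n0 a'1 l1) powRN mulrC.
rewrite ler_pdivrMr ?powR_gt0// => h.
apply: (le_trans h); apply: le_trans main.
rewrite mulrC; apply: ler_wpM2r; first by rewrite divr_ge0 ?fine_sqnorm_ge0.
apply: powR_oneD_le => //; first by rewrite mulr_ge0// ltW.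
by apply: le_trans mn; rewrite ler_wpM2l ?mulr_ge0 ?(ltW mp) ?(ltW nR0).
Qed.
Lemma ratio_near1 (e C0 rk x y z : R) : 0 < e -> 0 < C0 -> 0 <= rk -> rk <= e / C0 -> 0 < y ->
  z <= C0 * y -> y <= (1 + e) * x + rk * z -> 1 - 2 * e <= x / y.
Proof.
move=> e0 C00 rk0 hr y0 hz hy; rewrite ler_pdivlMr//.
have h1 : rk * z <= e * y.
  apply: (@le_trans _ _ (rk * (C0 * y))); first by rewrite ler_wpM2l.
  by rewrite mulrA ler_pM2r// -ler_pdivlMr.
have e12 : 0 < 1 + e by rewrite ltr_pwDl// ltW.
rewrite -(ler_pM2l e12); have := mulr_ge0 (mulr_ge0 (ltW e0) (ltW e0)) (ltW y0).
lra.
Qed.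

Lemma near_params_eq (b0 g kap t a b : R) : -1 < g -> 0 < kap -> b0 - g = 2 * kap ->
  2 * t <= 1 -> t <= kap -> `|a - b0| <= t -> `|b - b0| <= t -> b <= a ->
  [/\ g <= b /\ kap <= b - g, -1 < b /\ -1 < a, b <= b0 + 1 /\ a <= b0 + 1 & 0 <= a - b /\
    a - b <= 2 * t].
Proof.
rewrite !ler_norml => ? ? ? ? ? /andP[? ?] /andP[? ?] ?.
split; split; lra.
Qed.

(** Near the diagonal the value tends to 1: from above by the fixed test function of [EP1_upper],
    from below by [weight_near] together with the uniform bound of the norm of weight g, for every
    F. *)
Lemma EP1_near_eq n (b0 eps : R) : (0 < n)%N -> -1 < b0 -> 0 < eps ->
  exists2 t : R, 0 < t & forall a b, `|a - b0| <= t -> `|b - b0| <= t -> b <= a ->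
  `|EP1 a b n 1 - 1| <= eps.
Proof.
move=> n0 b01 eps0.
have [g [g1 gb0]] : exists g : R, -1 < g /\ g < b0 by exists ((b0 - 1) / 2); lra.
have [kap [kap0 kapE]] : exists kap : R, 0 < kap /\ b0 - g = 2 * kap by exists ((b0 - g) / 2); lra.
have [C0 C00 HC] := @fine_sqnorm_dominated R n g (b0 + 1) n0 g1.
have [A A0 HA] := @EP1_upper R n b0 b0 g n0 g1 (ltW gb0) (lexx b0).
have [e [e0 e1 eB]] : exists e : R, [/\ 0 < e, e < 1 & 2 * e <= eps].
  exists (Num.min (1 / 2) (eps / 2)); split.
  - by rewrite lt_min !divr_gt0.
  - by rewrite gt_min; apply/orP; left; lra.
  - by rewrite mulrC -ler_pdivlMr// ge_min lexx orbT.
have [r [r0 r1 rC]] := @powR_small R (2 * kap) (e / C0) (mulr_gt0 (ltr0Sn _ 1) kap0) (divr_gt0 e0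
  C00).
have [k k1 kA] : exists2 k : R, 1 <= k & (k ^+ 2)^-1 * A <= e.
  have A1 : 0 <= A / e by rewrite divr_ge0// ltW.
  exists (1 + A / e); first by rewrite lerDl.
  have p0 : 0 < 1 + A / e by rewrite ltr_pwDl.
  rewrite mulrC ler_pdivrMr ?exprn_gt0// mulrC -ler_pdivrMr//.
  by have := mulr_ge0 A1 A1; rewrite expr2; lra.
have [tr tr0 Hr] := @powR_near1 R r e r0 e0.
have [tk tk0 Hk] := @powR_near1 R k e (lt_le_trans ltr01 k1) e0.
have [t [t0 t1 t2 [t3 t4]]] : exists t : R, [/\ 0 < t, 2 * t <= tr, 2 * t <= tk & 2 * t <= 1 /\
  t <= kap].
  exists (Num.min (Num.min tr tk) (Num.min 1 kap) / 2).
  have h : 0 < Num.min (Num.min tr tk) (Num.min 1 kap).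
    by rewrite !lt_min tr0 tk0 kap0 ltr01.
  set M := Num.min _ _ in h *.
  have : M <= M by [].
  rewrite {2}/M !le_min => /andP[/andP[q1 q2] /andP[q3 q4]].
  have E : 2 * (M / 2) = M by rewrite mulrCA mulfV ?mulr1.
  have M2 : M / 2 <= M by rewrite ler_pdivrMr// ler_peMr ?(ltW h)// ler1n.
  by rewrite E; split; [rewrite divr_gt0| | |split => //; exact: le_trans q4].
exists t => // a b ha hb ba.
have [[gb kb] [b1 a1] [bB aA] [ab0 abt]] := near_params_eq g1 kap0 kapE t3 t4 ha hb ba.
have t20 : 0 <= 2 * t by rewrite mulr_ge0// ltW.
have upper : EP1 a b n 1 <= 1 + 2 * e.
  have := HA a b k gb bB ba aA k1.
  have := (Hk _ ab0 (le_trans abt t2)).1.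
  lra.
have lower : 1 - 2 * e <= EP1 a b n 1.
  apply: EP1_ge => // F hF F0.
  have hbF := Hspace_le n0 b1 ba ler01 hF.
  have Nb := Hspace_fine_gt0 n0 ler01 hbF F0.
  have [dF _ fF] := Hspace_growth hF.
  have [_ _ fg] := Hspace_growth (Hspace_le n0 g1 (le_trans gb ba) ler01 hF).
  have e11 : 0 <= 1 + e by rewrite addr_ge0// ltW.
  have [|_ h] := @weighted_sqnorm_comb2 R n b a g _ _ F F F n0 dF dF dF e11
    (powR_ge0 r (2 * kap)) _ fF fg.
    move=> x x0; rewrite mulrCA [X in _ <= _ + X]mulrCA -mulrDr.
    rewrite ler_wpM2l ?sqf_ge0//.
    exact: (@weight_near _ _ _ _ _ _ _ (2 * t)) x0 r0 r1 ba abt (ltW e0) (Hr _ t20 t1).2 (ltW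
      kap0) kb.
  exact: ratio_near1 e0 C00 (powR_ge0 _ _) rC Nb (HC b gb bB F hbF) h.
rewrite ler_norml; clear -upper lower eB; lra.
Qed.
End semicontinuity.

Lemma EP1_near (R : realType) n (a0 b0 eps : R) : (0 < n)%N -> -1 < b0 -> b0 <= a0 -> 0 < eps ->
  exists2 t : R, 0 < t & forall a b, `|a - a0| <= t -> `|b - b0| <= t -> b <= a ->
  `|EP1 a b n 1 - EP1 a0 b0 n 1| <= eps.
Proof.
move=> n0 b01 ba0 eps0; have [lt_ba|ge_ba] := ltP b0 a0.
  have [t t0 H] := EP1_near_lt n0 b01 lt_ba eps0; exists t => // a b ha hb ba.
  have z0 (x : R) : `|x - x| <= t by rewrite subrr normr0 ltW.
  have h1 := H a b a0 b0 ha hb (z0 _) (z0 _) ba ba0.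
  have h2 := H a0 b0 a b (z0 _) (z0 _) ha hb ba0 ba.
  by rewrite ler_distl; apply/andP; split; [rewrite lerBlDr; exact: h1|exact: h2].
have {ba0 ge_ba}-> : a0 = b0 by apply/eqP; rewrite eq_le ge_ba ba0.
have e20 : 0 < eps / 2 by rewrite divr_gt0.
have [t t0 H] := EP1_near_eq n0 b01 e20; exists t => // a b ha hb ba.
have z0 (x : R) : `|x - x| <= t by rewrite subrr normr0 ltW.
rewrite (le_trans (ler_distD 1 _ _))// [leRHS]splitr; apply: lerD; first exact: H.
by rewrite distrC; apply: H.
Qed.

Local Close Scope complex_scope.
Theorem theorem4 (R : realType) (d : nat) (hd : (0 < d)%N) :
  {within [set p : R * R * R | [/\ p.1.2 <= p.1.1, -1 < p.1.2 & 0 < p.2]],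
    continuous (fun p : R * R * R => EP1 p.1.1 p.1.2 d p.2)}.
Proof.
set D := [set p | _].
apply/subspace_continuousP => -[[a0 b0] d0] [/= ba0 b01 d00].
have fst1 : (fun p : R * R * R => p.1.1) @ within D (nbhs (a0, b0, d0)) --> a0.
  by apply: cvg_within_filter; apply: (cvg_comp _ _ (@cvg_fst _ _ _ _ _) (@cvg_fst _ _ _ _ _)).
have fst2 : (fun p : R * R * R => p.1.2) @ within D (nbhs (a0, b0, d0)) --> b0.
  by apply: cvg_within_filter; apply: (cvg_comp _ _ (@cvg_fst _ _ _ _ _) (@cvg_snd _ _ _ _ _)).
have snd1 : (fun p : R * R * R => p.2) @ within D (nbhs (a0, b0, d0)) --> d0.
  by apply: cvg_within_filter; apply: cvg_snd.
have inD : \forall p \near within D (nbhs (a0, b0, d0)), D p by exact: withinT.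
have a01 : -1 < a0 := lt_le_trans b01 ba0.
rewrite /from_subspace /= EP1_scale//.
have E1 : (fun p : R * R * R => EP1 p.1.1 p.1.2 d 1) @ within D (nbhs (a0, b0,
  d0)) --> EP1 a0 b0 d 1.
  apply/cvgrPdist_le => e e0; have [t t0 H] := EP1_near hd b01 ba0 e0.
  near=> p; rewrite distrC; apply: H.
  - by rewrite distrC; near: p; move/cvgrPdist_le : fst1; exact.
  - by rewrite distrC; near: p; move/cvgrPdist_le : fst2; exact.
  - by have [] : D p by near: p.
(* Base and exponent of the power both vary, so it is written with [expR] and [ln]; by [powR]'s
   definition the two agree where the base is positive. *)
have E2 : (fun p : R * R * R => expR (- (2 * (p.1.1 - p.1.2)) * ln p.2)) @ within D (nbhs (a0,
  b0, d0)) -->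
    expR (- (2 * (a0 - b0)) * ln d0).
  apply: continuous_cvg; first exact: continuous_expR.
  apply: cvgM; last by apply: continuous_cvg snd1; exact: continuous_ln.
  by apply: cvgN; apply: cvgMr; exact: cvgB.
have P0 : d0 `^ (- (2 * (a0 - b0))) = expR (- (2 * (a0 - b0)) * ln d0) by rewrite /powR gt_eqF.
rewrite P0; apply: cvg_trans (cvgM E2 E1); apply: near_eq_cvg.
near=> p; have [h1 h2 h3] : D p by near: p.
by rewrite /= [RHS]EP1_scale ?(lt_le_trans h2 h1)// /powR gt_eqF.
Unshelve. all: by end_near.
Qed.
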